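(* Let $\nu>0$ and let $b=(u^r,u^z)$ be a smooth axisymmetric divergence-free meridional velocity field, i.e. $\partial_r(ru^r)+\partial_z(ru^z)=0$. Let $g=g(r,z,t)$ be a smooth, sufficiently decaying (source-free) solution of $$\partial_tg+b\cdot\nabla g=\nu\Delta_5g .$$ Then for $1<p<\infty$, $$\frac{d}{dt}\int|g|^p\,d\mu_3+\nu p(p-1)\int|g|^{p-2}|\nabla g|^2\,d\mu_3+2\nu\int_{\mathbb R}|g(0,z,t)|^p\,dz=0 .$$ Moreover $g$ satisfies the forward contractions $\|g(t)\|_{L^1(\mu_3)}\le\|g(0)\|_{L^1(\mu_3)}$ and $\|g(t)\|_\infty\le\|g(0)\|_\infty$ for $t\ge 0$, and therefore $$\|U_g(t)\|_\infty\le B_g:=C_{\rm BS}\,\|g(0)\|_{L^1(\mu_3)}^{1/3}\,\|g(0)\|_\infty^{2/3},$$ where $C_{\rm BS}$ is an absolute constant. In particular a fixed initial $g(0)$ cannot by itself supply compression of size $\kappa_*\nu/R^2$ on arbitrarily small scales: for each fixed $\kappa_*>0$, for all sufficiently small $R>0$ (depending only on $\kappa_*,\nu,B_g$) one has $\|U_g(t)\|_\infty<\kappa_*\nu/R^2$ for all $t\ge0$ in the interval of existence.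
   Context: Cylindrical coordinates $r\ge0$, $z\in\mathbb R$; $\nabla=(\partial_r,\partial_z)$, $\Delta_5=\partial_{rr}+\frac3r\partial_r+\partial_{zz}$, and $d\mu_3=r\,dr\,dz$; spatial integrals without indicated domain are over $\mathbb R_+\times\mathbb R$. $U_g=b_g^r/r$, where $b_g=(b_g^r,b_g^z)$ is the divergence-free axisymmetric meridional velocity generated by $g$ through the axisymmetric Biot–Savart law, i.e. the field whose azimuthal vorticity is $\omega^\theta=rg$. *)

(* Defs.v *)
From mathcomp Require Import all_boot all_order all_algebra.
From mathcomp Require Import all_classical all_reals all_analysis.

Set Implicit Arguments.
Unset Strict Implicit.
Unset Printing Implicit Defensive.

Import Order.TTheory GRing.Theory Num.Theory.
Import numFieldNormedType.Exports.

Local Open Scope classical_set_scope.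
Local Open Scope ring_scope.

(* A function of (r, z) is a curried f : R -> R -> R, and a time-dependent one
   is f : R -> R -> R -> R with time first, so that [f t] is its time slice.
   Only the values at r >= 0 are meaningful. *)

Section Smoothness.
Variable R : realType.

(* C^oo on a set that need not be open: restriction of a function all of whose
   iterated directional derivatives are differentiable on an open
   neighbourhood of the set. *)
Definition smooth_on (V : normedModType R) (A : set V) (F : V -> R) : Prop :=
  exists (O : set V) (G : V -> R),
    [/\ open O, A `<=` O, forall x, A x -> F x = G x
      & forall (vs : seq V) x, O x ->
          differentiable (foldr (fun v H => 'D_v H : V -> R) G vs) x].

Definition lifespan (T : \bar R) : set R := [set t | 0 <= t /\ (t%:E < T)%E].

Definition spacetime (T : \bar R) : set (R * R * R * R) :=
  [set x | lifespan T x.2].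

(* Smoothness of axisymmetric objects is that of the Cartesian object on
   R^3 x [0, T); points are (x1, x2, z, t). *)
Definition smooth_scalar (T : \bar R) (f : R -> R -> R -> R) : Prop :=
  smooth_on (spacetime T)
    (fun '(x1, x2, z, t) => f t (Num.sqrt (x1 ^+ 2 + x2 ^+ 2)) z).

(* The horizontal Cartesian components of u^r e_r are (x_i / r) u^r.  Since
   0^-1 = 0, they vanish on the axis, as they do for any continuous
   axisymmetric meridional field. *)
Definition smooth_velocity (T : \bar R) (ur uz : R -> R -> R -> R) : Prop :=
  [/\ smooth_on (spacetime T)
        (fun '(x1, x2, z, t) => let r := Num.sqrt (x1 ^+ 2 + x2 ^+ 2) in
           x1 / r * ur t r z),
      smooth_on (spacetime T)
        (fun '(x1, x2, z, t) => let r := Num.sqrt (x1 ^+ 2 + x2 ^+ 2) in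
           x2 / r * ur t r z)
    & smooth_scalar T uz].

End Smoothness.

Section Equation.
Variable R : realType.

Definition d_r (f : R -> R -> R) (r z : R) : R := derive1 (fun r' => f r' z) r.
Definition d_z (f : R -> R -> R) (r z : R) : R := derive1 (f r) z.
Definition d_t (f : R -> R -> R -> R) (t r z : R) : R :=
  derive1 (fun s => f s r z) t.

Definition laplace5 (f : R -> R -> R) (r z : R) : R :=
  d_r (d_r f) r z + 3 / r * d_r f r z + d_z (d_z f) r z.

Definition grad_sq (f : R -> R -> R) (r z : R) : R :=
  d_r f r z ^+ 2 + d_z f r z ^+ 2.

Definition divergence_free (T : \bar R) (ur uz : R -> R -> R -> R) : Prop :=
  forall t r z, lifespan T t -> 0 < r ->
    d_r (fun r' z' => r' * ur t r' z') r z
    + d_z (fun r' z' => r' * uz t r' z') r z = 0.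

Definition drift_diffusion (nu : R) (T : \bar R)
    (ur uz g : R -> R -> R -> R) : Prop :=
  forall t r z, 0 < t -> (t%:E < T)%E -> 0 < r ->
    d_t g t r z + (ur t r z * d_r (g t) r z + uz t r z * d_z (g t) r z)
    = nu * laplace5 (g t) r z.

(* Decay, locally uniform in time, at the rate |x|^-4 (integrable against
   r dr dz) of g, of its time derivative and of the flux b g.  As b is not
   assumed bounded, decay of g alone would not rule out a flux at infinity. *)
Definition decaying (T : \bar R) (ur uz g : R -> R -> R -> R) : Prop :=
  forall tau, lifespan T tau -> exists C : R,
    forall t r z, 0 < t -> t <= tau -> 0 < r ->
      (1 + `|ur t r z| + `|uz t r z|) * `|g t r z| + `|d_t g t r z|
      <= C / (1 + r ^+ 2 + z ^+ 2) ^+ 2.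

Definition decaying_smooth_solution (nu : R) (T : \bar R)
    (ur uz g : R -> R -> R -> R) : Prop :=
  [/\ smooth_velocity T ur uz, divergence_free T ur uz,
      smooth_scalar T g, drift_diffusion nu T ur uz g
    & decaying T ur uz g].

(* l is the derivative at t of F restricted to [0, T) (one-sided at t = 0). *)
Definition derivative_on_lifespan (T : \bar R) (F : R -> R) (t l : R) : Prop :=
  (fun s => (F s - F t) / (s - t))
    @ within [set s | lifespan T s /\ s != t] (nbhs t) --> l.

End Equation.

Notation area R := (@lebesgue_measure R \x @lebesgue_measure R)%E.

Section Norms.
Variable R : realType.

Definition halfplane : set (R * R) := [set x | 0 < x.1].

Definition mu3_integrable (f : R -> R -> R) : Prop :=
  (area R).-integrable halfplane (fun x => (f x.1 x.2 * x.1)%:E).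

Definition mu3_integral (f : R -> R -> R) : \bar R :=
  (\int[area R]_(x in halfplane) (f x.1 x.2 * x.1)%:E)%E.

Definition norm1 (f : R -> R -> R) : \bar R :=
  mu3_integral (fun r z => `|f r z|).

(* Supremum over r > 0: U_g is defined there only, and for functions continuous
   up to the axis nothing is lost. *)
Definition normoo (f : R -> R -> R) : \bar R :=
  ereal_sup [set `|f x.1 x.2|%:E | x in halfplane].

(* ∫ |f|^p dμ_3, ∫ |f|^(p-2) |∇f|^2 dμ_3 and ∫ |f(0,z)|^p dz.  As
   0 `^ q = 0 for q != 0, the second integrand is 0 where f = 0 and p <> 2. *)
Definition energy_density (p : R) (f : R -> R -> R) (r z : R) : R :=
  `|f r z| `^ p.
Definition dissipation_density (p : R) (f : R -> R -> R) (r z : R) : R :=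
  `|f r z| `^ (p - 2) * grad_sq f r z.
Definition axis_density (p : R) (f : R -> R -> R) (z : R) : R :=
  `|f 0 z| `^ p.

Definition energy (p : R) (f : R -> R -> R) : R :=
  fine (mu3_integral (energy_density p f)).
Definition dissipation (p : R) (f : R -> R -> R) : R :=
  fine (mu3_integral (dissipation_density p f)).
Definition axis_energy (p : R) (f : R -> R -> R) : R :=
  \int[@lebesgue_measure R]_(z in setT) axis_density p f z.

End Norms.

Section BiotSavart.
Variable R : realType.

(* u(x) = 1/(4π) ∫ ω(y) × (x - y) / |x - y|^3 dy for ω = ω^θ e_θ, evaluated at
   x = (r, 0, z) with y = (ρ cos θ, ρ sin θ, ζ) and dy = ρ dθ dρ dζ. *)
Definition bs_distance (r z rho zeta theta : R) : R :=
  Num.sqrt (r ^+ 2 + rho ^+ 2 - 2 * r * rho * cos theta + (z - zeta) ^+ 2).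

Definition bs_kernel_r (r z rho zeta : R) : R :=
  rho / (4 * pi) * \int[@lebesgue_measure R]_(theta in `[0, 2 * pi])
    (cos theta * (z - zeta) / bs_distance r z rho zeta theta ^+ 3).

Definition bs_kernel_z (r z rho zeta : R) : R :=
  rho / (4 * pi) * \int[@lebesgue_measure R]_(theta in `[0, 2 * pi])
    ((rho - r * cos theta) / bs_distance r z rho zeta theta ^+ 3).

Definition biot_savart (vort : R -> R -> R) (r z : R) : R * R :=
  (\int[area R]_(y in @halfplane R)
     (bs_kernel_r r z y.1 y.2 * vort y.1 y.2),
   \int[area R]_(y in @halfplane R)
     (bs_kernel_z r z y.1 y.2 * vort y.1 y.2)).

Definition b_of (g : R -> R -> R) : R -> R -> R * R :=
  biot_savart (fun r z => r * g r z).

Definition U_of (g : R -> R -> R) (r z : R) : R := (b_of g r z).1 / r.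

Definition B_of (CBS : R) (g0 : R -> R -> R) : \bar R :=
  (CBS%:E * (norm1 g0 `^ (1 / 3)) * (normoo g0 `^ (2 / 3)))%E.

End BiotSavart.

(* Main.v *)
Require Import Defs.
From mathcomp Require Import all_boot all_order all_algebra.
From mathcomp Require Import all_classical all_reals all_analysis.
From mathcomp Require Import measurable_realfun ring lra.

Set Implicit Arguments.
Unset Strict Implicit.
Unset Printing Implicit Defensive.

Import Order.TTheory GRing.Theory Num.Theory.
Import numFieldNormedType.Exports.

Local Open Scope classical_set_scope.
Local Open Scope ring_scope.

(** Smoothness of the Cartesian objects makes every time slice of the solution
    extend smoothly across r = 0. Testing the equation with beta'(g) times a
    compactly supported cutoff, beta a C^2 approximation of |.|^p, gives an
    identity whose right-hand side is dominated by C r / (1 + r^2 + z^2)^2 (the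
    transport term is harmless because b g decays). Removing the cutoff, Fatou
    bounds the dissipation and dominated convergence yields the energy identity;
    the term 2/r d_r g of the five-dimensional Laplacian produces the integral over
    the axis. The energies are therefore nonincreasing, and letting p tend to 1
    and to infinity gives both contractions. For the velocity, integration by
    parts in the angle bounds the kernel of U_g by 6 / (sigma sigma'), sigma being
    the distance in the half plane and sigma' at least max(sigma, rho / 2);
    splitting at scale lam gives |U_g| <= 192 lam |g|_oo + 6 |g|_1 / lam^2, and
    lam^3 = |g|_1 / |g|_oo is optimal up to a constant. *)

(** * Integration over the half plane and over boxes *)

(** No decay of the gradient of g and no bound on the velocity is assumed, and this shapes the
    argument: in the localized identity every derivative of g outside the dissipation is moved onto
    the cutoff, so that only g, d_t g and b g remain to be estimated. Integrability of the
    dissipation is an output: Fatou yields it, and since the second derivatives of the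
    approximations are bounded by a multiple of their limit, the limit then serves as majorant and
    the inequality becomes an equality. A genuine approximation occurs for p < 2, where |s|^p is not
    C^2 at 0. Regularity at r = 0 comes from the plane x2 = 0 of the Cartesian extension, on which r
    runs through all reals. The equation is given for t > 0; smoothness up to t = 0 carries it to
    the initial time, from which the contractions start. In the velocity bound the angular
    integration by parts supplies the factor r that cancels the division in U_g. The constant is 198
    = 192 + 6 with 192 = 12 * 16: 12 from the kernel near its pole, 16 lam from the integral of the
    majorant of the inverse distance. *)

Lemma continuous_pair (S T U : topologicalType) (f : S -> T) (g : S -> U) :
  continuous f -> continuous g -> continuous (fun x => (f x, g x)).
Proof.
by move=> cf cg x; apply: (cvg_pair (G := nbhs (f x)) (H := nbhs (g x)));
  [exact: cf|exact: cg].
Qed.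

Section PlaneIntegrals.
Variable R : realType.
Implicit Types (f : R * R -> R) (n : R).
Local Notation mu := (@lebesgue_measure R).
Local Notation plane := (measurableTypeR R * measurableTypeR R)%type.

(** The plane carries the product sigma-algebra, so open sets have to be recovered from rectangles:
    an open set is the countable union of the rectangles with rational end points that it
    contains. *)
Lemma open_measurable_plane (A : set (R * R)) : open A -> measurable (A : set plane).
Proof.
move=> oA.
pose B (q : (rat * rat) * (rat * rat)) : set (R * R) :=
  `]ratr q.1.1, ratr q.1.2[ `*` `]ratr q.2.1, ratr q.2.2[.
have -> : A = \bigcup_(q in setT) (if `[< B q `<=` A >] then B q else set0).
  apply/seteqP; split=> [[x y] Axy|x [q _]]; last first.
    by case: asboolP => // + Bx; exact.
  have /nbhs_ballP[e /= e0 eA] := open_nbhs_nbhs (conj oA Axy).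
  have rat_near (c : R) : exists q : rat * rat, (c \in `]ratr q.1, ratr q.2[%R) /\
      (forall d : R, (d \in `]ratr q.1, ratr q.2[%R) -> ball c e d).
    have [|q1] := @rat_in_itvoo R (c - e) c; first by rewrite ltrBlDr ltrDl.
    have [|q2] := @rat_in_itvoo R c (c + e); first by rewrite ltrDl.
    rewrite !in_itv /= => /andP[? ?] /andP[? ?]; exists (q1, q2); split => /=.
      by rewrite in_itv /=; apply/andP.
    move=> d; rewrite in_itv /= => /andP[? ?].
    by rewrite /ball /= ltr_norml; apply/andP; split; lra.
  have [q1 [q1x q1e]] := rat_near x; have [q2 [q2y q2e]] := rat_near y.
  exists (q1, q2) => //; case: asboolP => [_|[]]; first by split.
  by move=> [u v] [/= uq vq]; apply: eA; split; [exact: q1e|exact: q2e].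
apply: countable_bigcupT_measurable => // q.
by case: asboolP => // _; apply: measurableX; exact: measurable_itv.
Qed.

Lemma continuous_measurable_plane f : continuous f -> measurable_fun (setT : set plane) f.
Proof.
move=> /continuousP cf; apply: (measurability _ (RGenOpens.measurableE R)).
move=> _ [_ [a [b ->] <-]]; rewrite setTI; apply: open_measurable_plane.
exact/cf/interval_open.
Qed.

Lemma continuous_measurable_line (D : set (measurableTypeR R)) (f : R -> R) :
  continuous f -> measurable_fun D (fun x => (f x)%:E).
Proof.
move=> cf; apply/measurable_EFinP; apply: (@measurable_funTS _ _ (measurableTypeR R)).
exact: continuous_measurable_fun.
Qed.

(** The side r = 0 is left out, so that the boxes lie in the open half plane and exhaust it; being
    negligible, it may be restored when integrating in r. *)
Definition box n : set (R * R) := `]0, n] `*` `[- n, n].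

Lemma measurable_box n : measurable (box n : set plane).
Proof. by apply: measurableX; exact: measurable_itv. Qed.

Lemma integrable_box n f : continuous f -> (area R).-integrable (box n) (EFin \o f).
Proof.
move=> cf; apply: measurable_bounded_integrable; first exact: measurable_box.
- change (((mu \x mu) (`]0%R, n] `*` `[(- n)%R, n]) < +oo)%E).
  rewrite product_measure1E /=; [|exact: measurable_itv..].
  rewrite !lebesgue_measure_itv /=; case: ifP => _; case: ifP => _.
  - by rewrite -!EFinD -EFinM ltry.
  - by rewrite mule0 ltry.
  - by rewrite mul0e ltry.
  - by rewrite mule0 ltry.
- by apply: measurable_funTS; exact: continuous_measurable_plane.
have cK : compact (f @` (`[0, n] `*` `[- n, n])).
  apply: continuous_compact; first exact: continuous_subspaceT.
  by apply: compact_setX; exact: segment_compact.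
have [M [Mr HM]] := compact_bounded cK; exists M; split => // x Mx y [/= y1 y2].
apply: HM => //; exists y => //; split => //=.
by move: y1; rewrite /= !in_itv /= => /andP[/ltW -> ->].
Qed.

Lemma continuous_slice1 f z : continuous f -> continuous (fun r => f (r, z)).
Proof.
move=> cf r; apply: (@continuous_comp _ _ _ (fun r => (r, z)) f); last exact: cf.
by apply: continuous_pair => ?; [exact: cvg_id|exact: cvg_cst].
Qed.

Lemma continuous_slice2 f r : continuous f -> continuous (fun z => f (r, z)).
Proof.
move=> cf z; apply: (@continuous_comp _ _ _ (fun z => (r, z)) f); last exact: cf.
by apply: continuous_pair => ?; [exact: cvg_cst|exact: cvg_id].
Qed.

Lemma continuous_itv_integrable (a b : R) (f : R -> R) : continuous f ->
  mu.-integrable `[a, b] (EFin \o f).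
Proof.
move=> cf; apply: continuous_compact_integrable; first exact: segment_compact.
exact: continuous_subspaceT.
Qed.

Lemma Rintegral_derive_on (F f : R -> R) (a b : R) : a <= b ->
  (forall x : R, a <= x <= b -> is_derive x 1 F (f x)) -> {within `[a, b], continuous f} ->
  \int[mu]_(x in `[a, b]) f x = F b - F a.
Proof.
rewrite le_eqVlt => /predU1P[<-|ab] dF cf.
  by rewrite set_itv1 Rintegral_set1 subrr.
have cF x : a <= x <= b -> {for x, continuous F}.
  by move=> /dF d; apply: differentiable_continuous; apply/derivable1_diffP; case: d.
rewrite /Rintegral (@continuous_FTC2 _ f F) //=.
- split.
  + move=> x; rewrite in_itv /= => /andP[? ?].
    by have [] : is_derive x 1 F (f x) by apply: dF; rewrite !ltW.
  + by apply: cvg_at_right_filter; apply: cF; rewrite lexx ltW.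
  + by apply: cvg_at_left_filter; apply: cF; rewrite lexx ltW.
- move=> x; rewrite in_itv /= => /andP[? ?]; rewrite derive1E.
  have d : is_derive x 1 F (f x) by apply: dF; rewrite !ltW.
  exact: derive_val.
Qed.

Lemma Rintegral_derive (F f : R -> R) (a b : R) : a <= b ->
  (forall x : R, is_derive x 1 F (f x)) -> continuous f ->
  \int[mu]_(x in `[a, b]) f x = F b - F a.
Proof.
move=> ab dF cf; apply: Rintegral_derive_on => //.
exact: continuous_subspaceT.
Qed.

Lemma integral_box_rz n f : continuous f ->
  \int[area R]_(x in box n) f x =
  \int[mu]_(z in `[- n, n]) \int[mu]_(r in `[0, n]) f (r, z).
Proof.
move=> cf; rewrite /Rintegral; congr fine.
have mB := measurable_box n.
have fB := (integrable_mkcond _ mB).1 (@integrable_box n _ cf).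
rewrite integral_mkcond -integral21_prod_meas1 // [RHS]integral_mkcond.
apply: eq_integral => z _; rewrite /fubini_G patchE; case: ifPn => zn; last first.
  apply: integral0_eq => r _; rewrite patchE memNset // => -[_ /= zin].
  by move: zn; rewrite mem_set.
rewrite fineK; last first.
  apply: integrable_fin_num => //.
  by apply: continuous_itv_integrable; exact: continuous_slice1.
rewrite -integral_itv_obnd_cbnd; last first.
  by apply: continuous_measurable_line; exact: continuous_slice1.
rewrite [RHS]integral_mkcond; apply: eq_integral => r _.
rewrite !patchE; congr (if _ then _ else _).
apply/idP/idP => [/set_mem[rn _]|/set_mem rn]; apply/mem_set => //.
by split => //; exact: set_mem zn.
Qed.

Lemma integral_box_zr n f : continuous f ->
  \int[area R]_(x in box n) f x =
  \int[mu]_(r in `]0, n]) \int[mu]_(z in `[- n, n]) f (r, z).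
Proof.
move=> cf; rewrite /Rintegral; congr fine.
have mB := measurable_box n.
have fB := (integrable_mkcond _ mB).1 (@integrable_box n _ cf).
rewrite integral_mkcond -integral12_prod_meas1 // [RHS]integral_mkcond.
apply: eq_integral => r _; rewrite /fubini_F patchE; case: ifPn => rn; last first.
  apply: integral0_eq => z _; rewrite patchE memNset // => -[/= rin _].
  by move: rn; rewrite mem_set.
rewrite fineK; last first.
  apply: integrable_fin_num => //.
  by apply: continuous_itv_integrable; exact: continuous_slice2.
rewrite [RHS]integral_mkcond; apply: eq_integral => z _.
rewrite !patchE; congr (if _ then _ else _).
apply/idP/idP => [/set_mem[_ zn]|/set_mem zn]; apply/mem_set => //.
by split => //; exact: set_mem rn.
Qed.

(** Together with [integral_box_d2_eq0] this is the divergence theorem on a box, with the two orders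
    of integration. The value at r = 0 is kept: it becomes the integral over the axis. *)
Lemma integral_box_d1 n (P P' : R -> R -> R) : 0 <= n ->
  (forall r z : R, is_derive r 1 (fun r => P r z) (P' r z)) ->
  continuous (fun x : R * R => P' x.1 x.2) ->
  \int[area R]_(x in box n) P' x.1 x.2 =
  \int[mu]_(z in `[- n, n]) (P n z - P 0 z).
Proof.
move=> n0 dP cP; rewrite integral_box_rz //; apply: eq_Rintegral => z _ /=.
rewrite (Rintegral_derive n0 (fun r => dP r z)) //.
exact: (@continuous_slice1 (fun x => P' x.1 x.2) z cP).
Qed.

Lemma integral_box_d2_eq0 n (Q Q' : R -> R -> R) : 0 <= n ->
  (forall r z : R, is_derive z 1 (Q r) (Q' r z)) ->
  continuous (fun x : R * R => Q' x.1 x.2) ->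
  (forall r, Q r n = 0) -> (forall r, Q r (- n) = 0) ->
  \int[area R]_(x in box n) Q' x.1 x.2 = 0.
Proof.
move=> n0 dQ cQ Qn QNn; rewrite integral_box_zr //.
(* Writing 0 as an integral over the empty set turns both sides into integrals of restrictions,
   which are compared pointwise. *)
rewrite -[RHS](@Rintegral_set0 _ _ _ mu (cst 0)).
rewrite [RHS]Rintegral_mkcond Rintegral_mkcond; apply: eq_Rintegral => r _.
rewrite !patchE in_set0; case: ifP => // _.
rewrite (Rintegral_derive _ (dQ r)) ?Qn ?QNn ?subrr //; first lra.
exact: (@continuous_slice2 (fun x => Q' x.1 x.2) r cQ).
Qed.

End PlaneIntegrals.

(** * Continuity and derivative rules for explicit expressions *)

Section RealFunctionRules.
Variables (R : realType) (T : topologicalType).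
Implicit Types f g : T -> R.

Lemma continuous_add f g : continuous f -> continuous g ->
  continuous (fun x => f x + g x).
Proof. by move=> cf cg x; apply: continuousD; [exact: cf|exact: cg]. Qed.

Lemma continuous_mul f g : continuous f -> continuous g ->
  continuous (fun x => f x * g x).
Proof. by move=> cf cg x; apply: continuousM; [exact: cf|exact: cg]. Qed.

Lemma continuous_opp f : continuous f -> continuous (fun x => - f x).
Proof. by move=> cf x; apply: continuousN; exact: cf. Qed.

Lemma continuous_exp f n : continuous f -> continuous (fun x => f x ^+ n).
Proof. by move=> cf x; apply: (@continuous_comp _ _ _ f (fun y : R => y ^+ n)); [exact: cf|exact: exprn_continuous]. Qed.

Lemma continuous_inv f : (forall x, f x != 0) -> continuous f ->
  continuous (fun x => (f x)^-1).
Proof. by move=> f0 cf x; apply: continuousV; [exact: f0|exact: cf]. Qed.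

Lemma continuous_const (c : R) : continuous (fun _ : T => c).
Proof. by move=> x; exact: cvg_cst. Qed.

Lemma continuous_compose (h : R -> R) f : continuous h -> continuous f ->
  continuous (fun x => h (f x)).
Proof. by move=> ch cf x; apply: (@continuous_comp _ _ _ f h); [exact: cf|exact: ch]. Qed.

End RealFunctionRules.

Section DerivativeRules.
Variable R : realType.
Implicit Types (u v h : R -> R) (x du dv dh : R).

Lemma is_derive_add u v x du dv : is_derive x 1 u du -> is_derive x 1 v dv ->
  is_derive x 1 (fun y => u y + v y) (du + dv).
Proof. by move=> ? ?; exact: is_deriveD. Qed.

Lemma is_derive_opp u x du : is_derive x 1 u du ->
  is_derive x 1 (fun y => - u y) (- du).
Proof. by move=> ?; exact: is_deriveN. Qed.

Lemma is_derive_mul u v x du dv : is_derive x 1 u du -> is_derive x 1 v dv ->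
  is_derive x 1 (fun y => u y * v y) (du * v x + u x * dv).
Proof.
move=> ? ?; apply: is_derive_eq.
by rewrite /GRing.scale /= addrC; congr (_ + _); rewrite mulrC.
Qed.

Lemma is_derive_pow u x du n : is_derive x 1 u du ->
  is_derive x 1 (fun y => u y ^+ n) (n%:R * u x ^+ n.-1 * du).
Proof.
move=> ud; elim: n => [|n IHn].
  by under eq_fun do rewrite expr0; rewrite !mul0r; exact: is_derive_cst.
under eq_fun do rewrite exprS.
apply: (is_derive_eq (is_derive_mul ud IHn)).
by case: n {IHn} => [|n] /=; rewrite ?expr0 ?exprS -?natr1; ring.
Qed.

Lemma is_derive_inv u x du : u x != 0 -> is_derive x 1 u du ->
  is_derive x 1 (fun y => (u y)^-1) (- du / u x ^+ 2).
Proof.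
move=> ux0 ud; apply: (is_derive_eq (is_deriveV _ _)) => //.
by rewrite /GRing.scale /= mulrC !mulrN mulNr.
Qed.

Lemma is_derive_compose h u x dh du : is_derive (u x) 1 h dh ->
  is_derive x 1 u du -> is_derive x 1 (fun y => h (u y)) (dh * du).
Proof. by move=> ? ?; exact: is_derive1_comp. Qed.

Lemma is_derive_continuous (f df : R -> R) :
  (forall x : R, is_derive x 1 f (df x)) -> continuous f.
Proof.
move=> fd x; apply: differentiable_continuous.
by apply/derivable1_diffP; case: (fd x).
Qed.

Lemma continuous_fst_real : continuous (fun x : R * R => x.1).
Proof. by move=> x; exact: cvg_fst. Qed.

Lemma continuous_snd_real : continuous (fun x : R * R => x.2).
Proof. by move=> x; exact: cvg_snd. Qed.

End DerivativeRules.

Ltac continuity := repeat first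
  [ match goal with H : continuous ?f |- continuous ?f => exact H end
  | lazymatch goal with
    | |- continuous (fun x => x) => move=> ?; exact: cvg_id
    | |- continuous (fun x => x.1) => exact: continuous_fst_real
    | |- continuous (fun x => x.2) => exact: continuous_snd_real
    | |- continuous (fun _ => ?c) => exact: (continuous_const (c := c))
    | |- continuous (fun x => @?f x + @?g x) => refine (@continuous_add _ _ f g _ _)
    | |- continuous (fun x => - @?f x) => refine (@continuous_opp _ _ f _)
    | |- continuous (fun x => @?f x * @?g x) => refine (@continuous_mul _ _ f g _ _)
    | |- continuous (fun x => @?f x ^+ ?n) => refine (@continuous_exp _ _ f n _)
    end ].

(** The derivative is computed from the syntax of the function, with facts about its atoms taken
    from the context; what is left is the equation between the computed and the announced
    derivative, usually closed by [ring] or [field]. *)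
Ltac differentiate :=
  notypeclasses refine (is_derive_eq _ _);
  [repeat first
    [ eassumption
    | lazymatch goal with
      | |- is_derive _ _ (fun x => x) _ => notypeclasses refine (is_derive_id _ _)
      | |- is_derive _ _ (fun _ => ?c) _ => notypeclasses refine (is_derive_cst c _ _)
      | |- is_derive _ _ (fun x => @?f x + @?g x) _ =>
          notypeclasses refine (@is_derive_add _ f g _ _ _ _ _)
      | |- is_derive _ _ (fun x => - @?f x) _ =>
          notypeclasses refine (@is_derive_opp _ f _ _ _)
      | |- is_derive _ _ (fun x => @?f x * @?g x) _ =>
          notypeclasses refine (@is_derive_mul _ f g _ _ _ _ _)
      | |- is_derive _ _ (fun x => @?f x ^+ ?n) _ =>
          notypeclasses refine (@is_derive_pow _ f _ _ n _)
      end ]|].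

(** * A polynomial cutoff *)

Section Cutoff.
Variable R : realType.
Implicit Types k x : R.

(* With k = n^-2 the cutoff and its first two derivatives vanish at x = n and x = -n. *)
Definition cutoff k x : R := (1 - k * x ^+ 2) ^+ 3.
Definition cutoff1 k x : R := - 6 * k * x * (1 - k * x ^+ 2) ^+ 2.
Definition cutoff2 k x : R :=
  - 6 * k * (1 - k * x ^+ 2) ^+ 2 + 24 * k ^+ 2 * x ^+ 2 * (1 - k * x ^+ 2).

Lemma is_derive_cutoff k x : is_derive x 1 (cutoff k) (cutoff1 k x).
Proof.
by rewrite /cutoff; differentiate; rewrite /cutoff1 /=; ring.
Qed.

Lemma is_derive_cutoff1 k x : is_derive x 1 (cutoff1 k) (cutoff2 k x).
Proof.
by rewrite /cutoff1; differentiate; rewrite /cutoff2 /=; ring.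
Qed.

Lemma continuous_cutoff k : continuous (cutoff k).
Proof. exact: is_derive_continuous (is_derive_cutoff k). Qed.

Lemma continuous_cutoff1 k : continuous (cutoff1 k).
Proof. exact: is_derive_continuous (is_derive_cutoff1 k). Qed.

Lemma continuous_cutoff2 k : continuous (cutoff2 k).
Proof. by rewrite /cutoff2; continuity. Qed.

End Cutoff.

(** * The localized energy identity *)

Section Slices.
Variable R : realType.
Local Notation mu := (@lebesgue_measure R).

Definition continuous2 (f : R -> R -> R) := continuous (fun x : R * R => f x.1 x.2).

(* The data of a solution at a fixed time, extended to all r in R: g, its
   derivatives, the velocity (a, b) and h = d_t g. *)
Record slice (nu C : R) (g gr gz grr gzz a ar b bz h : R -> R -> R) : Prop := Slice {
  slice_gr : forall r z : R, is_derive r 1 (fun r => g r z) (gr r z);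
  slice_gz : forall r z : R, is_derive z 1 (g r) (gz r z);
  slice_grr : forall r z : R, is_derive r 1 (fun r => gr r z) (grr r z);
  slice_gzz : forall r z : R, is_derive z 1 (gz r) (gzz r z);
  slice_ar : forall r z : R, is_derive r 1 (fun r => a r z) (ar r z);
  slice_bz : forall r z : R, is_derive z 1 (b r) (bz r z);
  slice_cg : continuous2 g;
  slice_cgr : continuous2 gr;
  slice_cgz : continuous2 gz;
  slice_cgrr : continuous2 grr;
  slice_cgzz : continuous2 gzz;
  slice_ca : continuous2 a;
  slice_car : continuous2 ar;
  slice_cb : continuous2 b;
  slice_cbz : continuous2 bz;
  slice_ch : continuous2 h;
  slice_pde : forall r z : R, 0 < r ->
    h r z + (a r z * gr r z + b r z * gz r z) =
    nu * (grr r z + 3 / r * gr r z + gzz r z);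
  slice_div : forall r z : R, 0 < r -> a r z + r * ar r z + r * bz r z = 0;
  slice_decay : forall r z : R, 0 < r ->
    (1 + `|a r z| + `|b r z|) * `|g r z| + `|h r z| <= C / (1 + r ^+ 2 + z ^+ 2) ^+ 2
}.

Section Energy.
Variables (nu C : R) (g gr gz grr gzz a ar b bz h : R -> R -> R).
Hypothesis S : slice nu C g gr gz grr gzz a ar b bz h.
Variables beta beta1 beta2 : R -> R.
Hypothesis beta_d : forall s : R, is_derive s 1 beta (beta1 s).
Hypothesis beta1_d : forall s : R, is_derive s 1 beta1 (beta2 s).
Hypothesis beta2_c : continuous beta2.

Definition dissipation_term k (r z : R) : R :=
  nu * beta2 (g r z) * (gr r z ^+ 2 + gz r z ^+ 2) * (cutoff k r * cutoff k z) * r.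

(** All derivatives of g have been integrated away, so only g, h and the velocity appear, which are
    the quantities whose decay is assumed. *)
Definition balance_term k (r z : R) : R :=
  - (beta1 (g r z) * h r z * (cutoff k r * cutoff k z) * r)
  + nu * beta (g r z) * (r * cutoff2 k r * cutoff k z + r * cutoff k r * cutoff2 k z
                          - cutoff1 k r * cutoff k z)
  + beta (g r z) * r * (a r z * (cutoff1 k r * cutoff k z)
                         + b r z * (cutoff k r * cutoff1 k z)).

Let B r z := beta (g r z).
Let B1 r z := beta1 (g r z).
Let B2 r z := beta2 (g r z).

(* Multiplying r times the equation by beta1 g times the cutoff and collecting
   divergences gives dissipation = balance + d_r P + d_z Q; on the axis P reduces
   to 2 nu times the cutoff of beta g, the source of the boundary term. *)
Let P k r z : R :=
  nu * r * B1 r z * gr r z * cutoff k r * cutoff k z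
  - nu * r * B r z * cutoff1 k r * cutoff k z
  + 2 * nu * cutoff k r * cutoff k z * B r z
  - cutoff k r * cutoff k z * r * a r z * B r z.
Let Q k r z : R :=
  nu * r * B1 r z * gz r z * cutoff k r * cutoff k z
  - nu * r * B r z * cutoff k r * cutoff1 k z
  - cutoff k r * cutoff k z * r * b r z * B r z.
Let P' k r z : R :=
  nu * (B1 r z * gr r z * cutoff k r + r * (B2 r z * gr r z) * gr r z * cutoff k r
        + r * B1 r z * grr r z * cutoff k r + r * B1 r z * gr r z * cutoff1 k r)
     * cutoff k z
  - nu * (B r z * cutoff1 k r + r * (B1 r z * gr r z) * cutoff1 k r
          + r * B r z * cutoff2 k r) * cutoff k z
  + 2 * nu * cutoff k z * (cutoff1 k r * B r z + cutoff k r * (B1 r z * gr r z))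
  - cutoff k z * (cutoff1 k r * r * a r z * B r z
                  + cutoff k r * (a r z + r * ar r z) * B r z
                  + cutoff k r * r * a r z * (B1 r z * gr r z)).
Let Q' k r z : R :=
  nu * r * cutoff k r * (B2 r z * gz r z * gz r z * cutoff k z
                         + B1 r z * gzz r z * cutoff k z + B1 r z * gz r z * cutoff1 k z)
  - nu * r * cutoff k r * (B1 r z * gz r z * cutoff1 k z + B r z * cutoff2 k z)
  - cutoff k r * r * (cutoff1 k z * b r z * B r z + cutoff k z * bz r z * B r z
                      + cutoff k z * b r z * (B1 r z * gz r z)).

Let dBr (r z : R) : is_derive r 1 (fun r => B r z) (B1 r z * gr r z).
Proof. by have := slice_gr S r z; exact: is_derive_compose. Qed.
Let dBz (r z : R) : is_derive z 1 (B r) (B1 r z * gz r z).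
Proof. by have := slice_gz S r z; exact: is_derive_compose. Qed.
Let dB1r (r z : R) : is_derive r 1 (fun r => B1 r z) (B2 r z * gr r z).
Proof. by have := slice_gr S r z; exact: is_derive_compose. Qed.
Let dB1z (r z : R) : is_derive z 1 (B1 r) (B2 r z * gz r z).
Proof. by have := slice_gz S r z; exact: is_derive_compose. Qed.

Let dP k (r z : R) : is_derive r 1 (fun r => P k r z) (P' k r z).
Proof.
have := slice_grr S r z; have := slice_ar S r z; have := dBr r z; have := dB1r r z.
have := is_derive_cutoff k r; have := is_derive_cutoff1 k r.
by move=> *; rewrite /P; differentiate; rewrite /P' /=; ring.
Qed.

Let dQ k (r z : R) : is_derive z 1 (Q k r) (Q' k r z).
Proof.
have := slice_gzz S r z; have := slice_bz S r z; have := dBz r z; have := dB1z r z.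
have := is_derive_cutoff k z; have := is_derive_cutoff1 k z.
by move=> *; rewrite /Q; differentiate; rewrite /Q' /=; ring.
Qed.

Let cB : continuous2 B.
Proof. by apply: continuous_compose (slice_cg S); exact: is_derive_continuous beta_d. Qed.
Let cB1 : continuous2 B1.
Proof. by apply: continuous_compose (slice_cg S); exact: is_derive_continuous beta1_d. Qed.
Let cB2 : continuous2 B2.
Proof. by apply: continuous_compose (slice_cg S). Qed.

Lemma slice_continuity k :
  [/\ continuous2 (dissipation_term k), continuous2 (balance_term k),
      continuous2 (P' k) & continuous2 (Q' k)].
Proof.
have c1 (f : R -> R) : continuous f -> continuous (fun x : R * R => f x.1).
  by move=> cf; apply: continuous_compose cf _; exact: continuous_fst_real.
have c2 (f : R -> R) : continuous f -> continuous (fun x : R * R => f x.2).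
  by move=> cf; apply: continuous_compose cf _; exact: continuous_snd_real.
have := c1 _ (continuous_cutoff (k := k)); have := c2 _ (continuous_cutoff (k := k)).
have := c1 _ (continuous_cutoff1 (k := k)); have := c2 _ (continuous_cutoff1 (k := k)).
have := c1 _ (continuous_cutoff2 (k := k)); have := c2 _ (continuous_cutoff2 (k := k)).
have [_ _ _ _ _ _] := S; move: cB cB1 cB2.
rewrite /dissipation_term /balance_term /P' /Q' /B /B1 /B2 /continuous2.
by move=> *; split; continuity.
Qed.

Lemma slice_pointwise k r z : 0 < r ->
  dissipation_term k r z = balance_term k r z + P' k r z + Q' k r z.
Proof.
move=> r0; have pde := slice_pde S z r0; have div := slice_div S z r0.
(* Multiplication by r clears the singular coefficient 3 / r and leaves a polynomial relation. *)
have pder : r * h r z = nu * (r * grr r z + 3 * gr r z + r * gzz r z)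
    - r * (a r z * gr r z + b r z * gz r z).
  rewrite (_ : h r z = nu * (grr r z + 3 / r * gr r z + gzz r z)
     - (a r z * gr r z + b r z * gz r z)); last by rewrite -pde; ring.
  by field; rewrite gt_eqF.
(* The two brackets are the residuals of the equation and of the divergence constraint; modulo them
   the claim is a polynomial identity. *)
have E : balance_term k r z + P' k r z + Q' k r z - dissipation_term k r z =
   - (r * h r z - (nu * (r * grr r z + 3 * gr r z + r * gzz r z)
    - r * (a r z * gr r z + b r z * gz r z))) * B1 r z * (cutoff k r * cutoff k z)
   - (a r z + r * ar r z + r * bz r z) * B r z * (cutoff k r * cutoff k z).
  by rewrite /dissipation_term /balance_term /P' /Q' /B /B1 /B2; ring.
by apply/eqP; rewrite eq_sym -subr_eq0 E pder div; apply/eqP; ring.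
Qed.

(** With [k = n ^- 2] the cutoff and its first derivative vanish on the three outer sides of the
    box. On the axis the cutoff in r equals 1 and P reduces to 2 nu times cutoff times beta g, which
    enters with a minus sign as the lower end point. *)
Lemma box_identity n : 0 < n ->
  \int[area R]_(x in box n) dissipation_term (n ^- 2) x.1 x.2 =
  \int[area R]_(x in box n) balance_term (n ^- 2) x.1 x.2
  - 2 * nu * \int[mu]_(z in `[- n, n]) (cutoff (n ^- 2) z * beta (g 0 z)).
Proof.
move=> n0; set k := n ^- 2.
have kn : 1 - k * n ^+ 2 = 0 by rewrite /k mulVf ?subrr // expf_neq0 // gt_eqF.
have kNn : 1 - k * (- n) ^+ 2 = 0 by rewrite sqrrN.
have [cD cR cP cQ] := slice_continuity k.
have intP := integral_box_d1 (ltW n0) (dP k) cP.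
have intQ : \int[area R]_(x in box n) Q' k x.1 x.2 = 0.
  apply: (integral_box_d2_eq0 (ltW n0) (dQ k) cQ) => r.
    by rewrite /Q /cutoff /cutoff1 kn; ring.
  by rewrite /Q /cutoff /cutoff1 kNn; ring.
have mB := @measurable_box R n.
transitivity (\int[area R]_(x in box n) (balance_term k x.1 x.2 + P' k x.1 x.2 + Q' k x.1 x.2)).
  apply: eq_Rintegral => -[r z] /set_mem[/=]; rewrite in_itv /= => /andP[r0 _] _.
  exact: slice_pointwise.
rewrite RintegralD //; [|exact: integrable_box (continuous_add _ _)|exact: integrable_box].
rewrite RintegralD //; [|exact: integrable_box..].
rewrite intQ addr0 intP; congr (_ + _); rewrite -mulNr -RintegralZl //; last first.
  apply: continuous_itv_integrable; apply: continuous_mul; first exact: continuous_cutoff.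
  exact: (@continuous_slice2 _ (fun x => B x.1 x.2) 0 cB).
apply: eq_Rintegral => z _; rewrite /P /cutoff /cutoff1 kn /B; ring.
Qed.

End Energy.
End Slices.

(** * The decay weight and the exhaustion of the half plane *)

Section Weights.
Variable R : realType.
Local Notation mu := (@lebesgue_measure R).
Local Notation plane := (measurableTypeR R * measurableTypeR R)%type.
Implicit Types f : R * R -> R.

Lemma halfplaneE : @halfplane R = `]0, +oo[ `*` setT.
Proof.
by apply/seteqP; split=> [[r z] /= r0|[r z] [/= + _]]; rewrite in_itv /= andbT.
Qed.

Lemma measurable_halfplane : measurable (@halfplane R : set plane).
Proof. by rewrite halfplaneE; apply: measurableX => //; exact: measurable_itv. Qed.

Lemma box_halfplane n : box n `<=` @halfplane R.
Proof. by move=> [r z] [/=]; rewrite in_itv /= => /andP[]. Qed.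

Lemma integral_patch_box n f : continuous f ->
  (\int[area R]_(x in @halfplane R) ((EFin \o f) \_ (box n)) x =
   (\int[area R]_(x in box n) f x)%:E)%E.
Proof.
move=> cf; rewrite -integral_mkcondr setIidr; last exact: box_halfplane.
by rewrite fineK //; apply: integrable_fin_num; [exact: measurable_box|exact: integrable_box].
Qed.

Lemma measurable_patch_box n f : continuous f ->
  measurable_fun (@halfplane R : set plane) ((EFin \o f) \_ (box n)).
Proof.
move=> cf; apply: measurable_funTS.
apply/(measurable_restrictT _ _).1; first exact: measurable_box.
apply/measurable_EFinP; apply: (@measurable_funTS _ _ plane).
exact: continuous_measurable_plane.
Qed.

Lemma integrable_inv_oneDsqr : mu.-integrable setT (fun z => ((1 + z ^+ 2)^-1)%:E).
Proof.
have E : (fun z : R => (1 + z ^+ 2)^-1) = (fun z => (oneDsqr z)^-1) by [].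
have c : continuous (fun z : R => (1 + z ^+ 2)^-1).
  by rewrite E; exact: continuous_oneDsqrV.
have p (z : R) : 0 <= (1 + z ^+ 2)^-1 by rewrite invr_ge0 addr_ge0 // sqr_ge0.
apply/integrableP; split; first exact: continuous_measurable_line.
under eq_integral do rewrite gee0_abs ?lee_fin //.
rewrite ge0_symfun_integralT //; last by move=> z /=; rewrite sqrrN.
by rewrite -set_itvcy integral0y_oneDsqr -EFinM ltry.
Qed.

(** The assumed decay rate times the density r of the measure: up to constants, the majorant in the
    dominated convergence arguments for the balance terms, the time derivatives and the passage to p
    = 1. *)
Definition weight (r z : R) : R := r / (1 + r ^+ 2 + z ^+ 2) ^+ 2.

Lemma oneDsqr2_gt0 (r z : R) : 0 < 1 + r ^+ 2 + z ^+ 2.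
Proof. by rewrite -addrA ltr_pwDl // addr_ge0 ?sqr_ge0. Qed.

Lemma continuous_weight : continuous (fun x : R * R => weight x.1 x.2).
Proof.
apply: continuous_mul; first exact: continuous_fst_real.
move=> x; apply: (@continuousV _ _ (fun x : R * R => (1 + x.1 ^+ 2 + x.2 ^+ 2) ^+ 2)).
  by rewrite expf_neq0 // gt_eqF // oneDsqr2_gt0.
move: x; change (continuous (fun x : R * R => (1 + x.1 ^+ 2 + x.2 ^+ 2) ^+ 2)).
by continuity.
Qed.

(** In r the weight has the primitive -1/2 (1 + r^2 + z^2)^-1; what remains is integrable in z, so
    Tonelli gives [integrable_weight]. *)
Lemma integral_weight_r (z : R) :
  (\int[mu]_(r in `]0%R, +oo[) (weight r z)%:E = (2^-1 * (1 + z ^+ 2)^-1)%:E)%E.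
Proof.
have z0 : 0 < 1 + z ^+ 2 by rewrite ltr_pwDl ?sqr_ge0.
have cw := @continuous_slice1 _ _ z continuous_weight.
rewrite integral_itv_obnd_cbnd; last exact: continuous_measurable_line.
pose F (r : R) := - 2^-1 * (1 + r ^+ 2 + z ^+ 2)^-1.
have dF (r : R) : is_derive r 1 F (weight r z).
  have nz : 1 + r ^+ 2 + z ^+ 2 != 0 by rewrite gt_eqF // oneDsqr2_gt0.
  have dD : is_derive r 1 (fun r => 1 + r ^+ 2 + z ^+ 2) (2 * r).
    by differentiate; rewrite /=; ring.
  have dV := @is_derive_inv _ (fun r => 1 + r ^+ 2 + z ^+ 2) _ _ nz dD.
  rewrite /F; differentiate; rewrite /weight /=; field.
  by [].
rewrite (@ge0_continuous_FTC2y _ _ F 0 0) //.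
- by rewrite /F expr0n addr0 sub0e -EFinN mulNr opprK.
- by move=> r r0; rewrite /weight divr_ge0 ?sqr_ge0.
- exact: continuous_subspaceT.
- rewrite /F -(mulr0 (- 2^-1)); apply: cvgM; first exact: cvg_cst.
  apply/gtr0_cvgV0.
    by exists 0; split => [|r _]; [exact: num_real|exact: oneDsqr2_gt0].
  apply: (@ger_cvgy _ _ _ _ (fun r : R => r)); last exact: cvg_id.
  exists 1; split => [|r /= r1]; first exact: num_real.
  by have := sqr_ge0 z; nra.
- by apply: cvg_at_right_filter; exact: (is_derive_continuous dF).
- by move=> r _; rewrite derive1E; exact: derive_val.
Qed.

Lemma integrable_weight :
  (area R).-integrable (@halfplane R) (fun x => (weight x.1 x.2)%:E).
Proof.
have mH := measurable_halfplane.
apply/(integrable_mkcond _ mH); apply/integrable21ltyP.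
  apply/(measurable_restrictT _ mH); apply/measurable_EFinP.
  by apply: (@measurable_funTS _ _ plane); exact: (continuous_measurable_plane continuous_weight).
have -> : (\int[mu]_y \int[mu]_x
    `|((fun x : R * R => (weight x.1 x.2)%:E) \_ (@halfplane R)) (x, y)|)%E =
  (\int[mu]_y (2^-1%:E * ((1 + y ^+ 2)^-1)%:E))%E.
  apply: eq_integral => z _; rewrite -EFinM -integral_weight_r [RHS]integral_mkcond.
  apply: eq_integral => r _; rewrite !patchE.
  rewrite (_ : ((r, z) \in @halfplane R) = (r \in `]0%R, +oo[%classic)).
    case: ifP => [/set_mem/=|]; last by rewrite abse0.
    rewrite in_itv /= andbT => r0; rewrite ger0_norm //.
    by rewrite /weight divr_ge0 ?sqr_ge0 ?ltW.
  by rewrite halfplaneE; apply/idP/idP => [/set_mem[]|/set_mem ?]; move=> *; apply/mem_set.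
have /integrableP[_] := integrableZl measurableT 2^-1 integrable_inv_oneDsqr.
apply: le_lt_trans; apply: ge0_le_integral => //.
- by move=> z _; rewrite -EFinM lee_fin mulr_ge0 ?invr_ge0 // addr_ge0 ?sqr_ge0.
- by apply: emeasurable_funM => //; case/integrableP: integrable_inv_oneDsqr.
- apply: measurableT_comp => //.
  by apply: emeasurable_funM => //; case/integrableP: integrable_inv_oneDsqr.
- by move=> z _; exact: lee_abs.
Qed.

End Weights.

Section Exhaustion.
Variable R : realType.
Local Notation mu := (@lebesgue_measure R).
Local Notation plane := (measurableTypeR R * measurableTypeR R)%type.
Local Notation N n := (n.+1%:R : R).

Lemma near_box (x : R * R) : halfplane x -> \forall n \near \oo, box (N n) x.
Proof.
move=> x0; pose M := Num.max x.1 `|x.2|.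
have M0 : 0 <= M by rewrite le_max normr_ge0 orbT.
near=> n.
have : M <= N n.
  apply: (le_trans (ltW (truncnS_gt M))); rewrite ler_nat ltnS.
  by near: n; exact: nbhs_infty_ge.
rewrite ge_max ler_norml => /andP[h1 h2]; split => //=; rewrite in_itv /= ?h1 ?andbT //.
Unshelve. all: end_near. Qed.

(** Extension by zero outside the boxes puts all integrals on one fixed domain. A given point lies
    in all large boxes, so pointwise limits are unaffected. *)
Lemma cvg_patch_box (f_ : nat -> R -> R -> R) (l : R) (x : R * R) : halfplane x ->
  f_ n x.1 x.2 @[n --> \oo] --> l ->
  ((fun x => (f_ n x.1 x.2)%:E) \_ (box (N n))) x @[n --> \oo] --> l%:E.
Proof.
move=> x0 fl; apply: cvg_trans (cvg_EFin (f := fun n => (f_ n x.1 x.2)%:E) _ fl) => //.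
  apply: near_eq_cvg; near=> n; rewrite patchE mem_set //.
  by near: n; exact: near_box.
by apply: nearW.
Unshelve. all: end_near. Qed.

Section Limits.
Variables (f_ : nat -> R -> R -> R) (f : R -> R -> R).
Hypothesis cf_ : forall n, continuous2 (f_ n).
Hypothesis f_f : forall r z, 0 < r -> f_ n r z @[n --> \oo] --> f r z.

Let F_ n := (fun x : R * R => (f_ n x.1 x.2)%:E) \_ (box (N n)).

Let mF_ n : measurable_fun (@halfplane R : set plane) (F_ n).
Proof. exact: (@measurable_patch_box R (N n) (fun x => f_ n x.1 x.2) (@cf_ n)). Qed.

Let F_f x : @halfplane R x -> F_ n x @[n --> \oo] --> (f x.1 x.2)%:E.
Proof. by move=> x0; apply: cvg_patch_box => //; exact: f_f. Qed.

Lemma measurable_box_limit :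
  measurable_fun (@halfplane R : set plane) (fun x => (f x.1 x.2)%:E).
Proof. exact: emeasurable_fun_cvg mF_ F_f. Qed.

Lemma dominated_box (W : R * R -> \bar R) :
  (area R).-integrable (@halfplane R) W ->
  (forall n r z, box (N n) (r, z) -> (`|f_ n r z|%:E <= W (r, z))%E) ->
  (forall x, @halfplane R x -> (0 <= W x)%E) ->
  (area R).-integrable (@halfplane R) (fun x => (f x.1 x.2)%:E) /\
  \int[area R]_(x in box (N n)) f_ n x.1 x.2 @[n --> \oo] -->
  \int[area R]_(x in @halfplane R) f x.1 x.2.
Proof.
move=> iW fW W0.
have [|||||i _ c] := @dominated_convergence _ plane R (area R) (@halfplane R)
  (@measurable_halfplane R) F_ (fun x => (f x.1 x.2)%:E) W.
- exact: mF_.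
- exact: measurable_box_limit.
- by apply: aeW => x; exact: F_f.
- exact: iW.
- apply: aeW => -[r z] n x0; rewrite /F_ patchE; case: ifP => [/set_mem|_].
    exact: fW.
  by rewrite abse0; exact: W0.
split => //; move: c => /=; rewrite -[X in _ --> X]fineK; last first.
  by apply: integrable_fin_num => //; exact: measurable_halfplane.
move=> /fine_cvgP[_]; apply: cvg_trans; apply: near_eq_cvg; near=> n => /=.
by rewrite (integral_patch_box _ (@cf_ n)).
Unshelve. all: end_near. Qed.

(** Here no majorant is available. Convergence of the integrals of nonnegative functions yields
    integrability of the limit, though not the value of its integral. *)
Lemma fatou_box (L : R) :
  (forall n r z, box (N n) (r, z) -> 0 <= f_ n r z) ->
  \int[area R]_(x in box (N n)) f_ n x.1 x.2 @[n --> \oo] --> L ->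
  (area R).-integrable (@halfplane R) (fun x => (f x.1 x.2)%:E).
Proof.
move=> f0 fL; apply/integrableP; split; first exact: measurable_box_limit.
have F0 n x : @halfplane R x -> (0 <= F_ n x)%E.
  case: x => r z _; rewrite /F_ patchE; case: ifP => [/set_mem|_ //].
  exact: f0.
have := @fatou _ plane R (area R) (@halfplane R) (@measurable_halfplane R) F_ mF_ F0.
have E x : @halfplane R x -> limn_einf (F_ ^~ x) = (f x.1 x.2)%:E.
  by move=> x0; rewrite (cvg_limn_einf_sup (F_f x0)).1.
rewrite (_ : (\int[area R]_(x in @halfplane R) limn_einf (F_ ^~ x))%E =
   (\int[area R]_(x in @halfplane R) `|(f x.1 x.2)%:E|)%E); last first.
  apply: eq_integral => x /set_mem x0; rewrite E // gee0_abs //.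
  rewrite -(E x x0) (cvg_limn_einf_sup (F_f x0)).1.
  apply: cvge_to_ge (F_f x0) _; apply: nearW => n; exact: F0.
move=> /le_lt_trans; apply.
rewrite (_ : limn_einf _ = L%:E) ?ltry //.
apply: (fun c => (cvg_limn_einf_sup c).1).
under eq_fun do rewrite (integral_patch_box _ (@cf_ _)).
by apply: cvg_EFin => //; apply: nearW.
Qed.

End Limits.

Lemma ge0_at0 (F : R -> R) : continuous F -> (forall r, 0 < r -> 0 <= F r) -> 0 <= F 0.
Proof.
move=> cF F0; apply: (@cvgr_to_ge _ (0^'+ : set_system R) _ _ F).
  by apply: cvg_at_right_filter; exact: cF.
by near=> r; apply: F0; near: r; exact: nbhs_right_gt.
Unshelve. all: end_near. Qed.

End Exhaustion.

Section LimitRules.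
Variables (R : realType) (I : Type) (F : set_system I).
Context {FF : Filter F}.
Implicit Types (u v : I -> R) (l m : R).

Lemma limit_add u v l m : u @ F --> l -> v @ F --> m -> (fun i => u i + v i) @ F --> l + m.
Proof. exact: cvgD. Qed.

Lemma limit_opp u l : u @ F --> l -> (fun i => - u i) @ F --> - l.
Proof. exact: cvgN. Qed.

Lemma limit_mul u v l m : u @ F --> l -> v @ F --> m -> (fun i => u i * v i) @ F --> l * m.
Proof. exact: cvgM. Qed.

Lemma limit_norm u l : u @ F --> l -> (fun i => `|u i|) @ F --> `|l|.
Proof. exact: cvg_norm. Qed.

End LimitRules.

Ltac limits := repeat first
  [ match goal with H : cvg_to ?F _ |- cvg_to ?F _ => exact H end
  | lazymatch goal with
    | |- cvg_to (nbhs (fmap (fun n => @?f n + @?g n) _)) _ =>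
        refine (@limit_add _ _ _ _ f g _ _ _ _)
    | |- cvg_to (nbhs (fmap (fun n => - @?f n) _)) _ => refine (@limit_opp _ _ _ _ f _ _)
    | |- cvg_to (nbhs (fmap (fun n => `|@?f n|) _)) _ => refine (@limit_norm _ _ _ _ f _ _)
    | |- cvg_to (nbhs (fmap (fun _ => ?c) _)) _ => exact: cvg_cst
    | |- cvg_to (nbhs (fmap (fun n => @?f n * @?g n) _)) _ =>
        refine (@limit_mul _ _ _ _ f g _ _ _ _)
    end ].

(** * The energy balance of a time slice *)

Section EnergyBalance.
Variable R : realType.
Local Notation mu := (@lebesgue_measure R).
Local Notation N n := (n.+1%:R : R).
Variables (nu C : R) (g gr gz grr gzz a ar b bz h : R -> R -> R).
Hypothesis S : slice nu C g gr gz grr gzz a ar b bz h.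
Hypothesis nu0 : 0 < nu.

Lemma slice_C_ge0 : 0 <= C.
Proof.
have := slice_decay S 0 ltr01; rewrite expr0n /= addr0 => H.
have : 0 <= C / (1 + 1 ^+ 2) ^+ 2.
  by apply: le_trans H; rewrite addr_ge0 // mulr_ge0 // !addr_ge0.
by rewrite pmulr_lge0 // invr_gt0 exprn_gt0 // addr_gt0.
Qed.

Lemma slice_bounds r z : 0 < r ->
  [/\ `|g r z| * r <= C * weight r z, `|h r z| * r <= C * weight r z
    & (`|a r z| + `|b r z|) * `|g r z| * r <= C * weight r z].
Proof.
move=> r0; have := slice_decay S z r0.
rewrite -(ler_pM2r r0) /weight mulrAC -mulrA => H.
have [? [? [? ?]]] : 0 <= `|a r z| * `|g r z| * r /\ 0 <= `|b r z| * `|g r z| * r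
    /\ 0 <= `|g r z| * r /\ 0 <= `|h r z| * r.
  by rewrite !mulr_ge0 // ltW.
by split; nra.
Qed.

Lemma slice_g_le r z : 0 < r -> `|g r z| <= C.
Proof.
move=> r0; have C0 := slice_C_ge0.
have : `|g r z| <= C / (1 + r ^+ 2 + z ^+ 2) ^+ 2.
  apply: le_trans (slice_decay S z r0).
  rewrite -[leLHS]mul1r -[leLHS]addr0 lerD // ler_wpM2r // -addrA lerDl addr_ge0 //.
move=> /le_trans; apply; rewrite ler_pdivrMr ?exprn_gt0 ?oneDsqr2_gt0 //.
by rewrite ler_peMr // exprn_ege1 // -addrA lerDl addr_ge0 ?sqr_ge0.
Qed.

(** The decay bound is given off the axis and continuity carries it there; one power of 1 + z^2 is
    kept, whose inverse is integrable on the line. *)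
Lemma slice_axis_le z : `|g 0 z| <= C / (1 + z ^+ 2).
Proof.
have C0 := slice_C_ge0.
have cg : continuous (fun r => g r z) := @continuous_slice1 _ (fun x => g x.1 x.2) z (slice_cg S).
rewrite -subr_ge0.
apply: (@ge0_at0 R (fun r => C / (1 + z ^+ 2) - `|g r z|)) => [|r r0].
  apply: continuous_add; first exact: continuous_const.
  apply: continuous_opp => r; apply: (@continuous_comp _ _ _ (fun r => g r z) (@Num.norm R R)).
    exact: cg.
  exact: norm_continuous.
rewrite subr_ge0.
apply: le_trans (_ : C / (1 + r ^+ 2 + z ^+ 2) ^+ 2 <= _).
  apply: le_trans (slice_decay S z r0).
  by rewrite -[leLHS]mul1r -[leLHS]addr0 lerD // ler_wpM2r // -addrA lerDl addr_ge0.
rewrite ler_wpM2l // lef_pV2 ?posrE ?exprn_gt0 ?oneDsqr2_gt0 ?ltr_pwDl ?sqr_ge0 //.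
have := sqr_ge0 r; have := sqr_ge0 z; nra.
Qed.

(** Requirements on approximations of |s|^p. [beta_K] is linear in s so that terms in beta g inherit
    the decay of g and of b g; [beta1_K] leaves the decay of the time term to h; [beta2_ge0] permits
    Fatou; [beta2_K] bounds beta2 by a multiple of its own limit, which is what later dominates the
    dissipation. *)
Variables (p K K2 : R) (beta beta1 beta2 : nat -> R -> R).
Hypothesis p1 : 1 < p.
Hypothesis beta_d : forall n (s : R), is_derive s 1 (beta n) (beta1 n s).
Hypothesis beta1_d : forall n (s : R), is_derive s 1 (beta1 n) (beta2 n s).
Hypothesis beta2_c : forall n, continuous (beta2 n).
Hypothesis beta_K : forall n s, `|s| <= C -> `|beta n s| <= K * `|s|.
Hypothesis beta1_K : forall n s, `|s| <= C -> `|beta1 n s| <= K.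
Hypothesis beta2_ge0 : forall n s, 0 <= beta2 n s.
Hypothesis beta2_K : forall n s, beta2 n s <= K2 * `|s| `^ (p - 2).
Hypothesis beta_lim : forall s, beta n s @[n --> \oo] --> `|s| `^ p.
Hypothesis beta1_lim : forall s, beta1 n s @[n --> \oo] --> p * (`|s| `^ (p - 2) * s).
Hypothesis beta2_lim : forall s, beta2 n s @[n --> \oo] --> p * (p - 1) * `|s| `^ (p - 2).

Let k n : R := N n ^- 2.

(** The second bound on [cutoff1] is for the term of [balance_term] in which the derivative of the
    cutoff in r comes without the factor r: it restores that factor. All bounds are uniform in n
    because k n <= 1 and 0 <= k n x^2 <= 1. *)
Lemma cutoff_scale_bounds (n : nat) (x : R) : - N n <= x <= N n ->
  [/\ 0 <= cutoff (k n) x <= 1, `|cutoff1 (k n) x| <= 6, `|cutoff1 (k n) x| <= 6 * `|x|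
    & `|cutoff2 (k n) x| <= 30].
Proof.
rewrite -ler_norml => xN.
have N1 : 1 <= N n by rewrite ler1n.
have k0 : 0 <= k n by rewrite invr_ge0 exprn_ge0.
have k1 : k n <= 1 by rewrite invf_le1 ?exprn_gt0 // exprn_ege1.
have kx : k n * x ^+ 2 <= 1.
  rewrite mulrC ler_pdivrMr ?exprn_gt0 // mul1r -(real_normK (num_real x)).
  by rewrite lerXn2r ?nnegrE.
have kx0 : 0 <= k n * x ^+ 2 by rewrite mulr_ge0 ?sqr_ge0.
have kax : k n * `|x| <= 1.
  have : (k n * `|x|) ^+ 2 <= 1 ^+ 2.
    by rewrite exprMn real_normK ?num_real // expr1n expr2 -mulrA; nra.
  by rewrite ler_pXn2r ?nnegrE ?mulr_ge0.
rewrite /cutoff /cutoff1 /cutoff2; set y := k n * x ^+ 2 in kx kx0 *.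
have y01 : 0 <= (1 - y) ^+ 2 <= 1.
  by rewrite sqr_ge0 expr_le1 // ?subr_ge0 // lerBlDr lerDl.
have E1 : `|- 6 * k n * x * (1 - y) ^+ 2| = 6 * (k n * `|x|) * (1 - y) ^+ 2.
  by rewrite normrM (ger0_norm (sqr_ge0 (1 - y))) !normrM normrN (ger0_norm k0) normr_nat; ring.
have ax : 0 <= `|x| := normr_ge0 x.
have kax0 : 0 <= k n * `|x| by rewrite mulr_ge0.
have kaxx : k n * `|x| <= `|x| by rewrite ler_piMl.
case/andP: y01 => y0 y1; split.
- by apply/andP; split; [rewrite exprn_ge0|rewrite expr_le1] => //; lra.
- by rewrite E1; nra.
- by rewrite E1; nra.
rewrite (_ : _ + _ = k n * (- 6 * (1 - y) ^+ 2 + 24 * y * (1 - y))); last by rewrite /y; ring.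
by rewrite normrM (ger0_norm k0) -[leRHS]mul1r ler_pM // ler_norml; apply/andP; split; nra.
Qed.

(** The summands 1, 66 nu and 6 belong to the time derivative, the diffusion and the transport; 66 =
    30 + 30 + 6 collects the two second derivatives and the first derivative of the cutoff. *)
Lemma balance_term_bound n r z : box (N n) (r, z) ->
  `|balance_term nu g a b h (beta n) (beta1 n) (k n) r z|
    <= K * (1 + 66 * nu + 6) * C * weight r z.
Proof.
move=> [/=]; rewrite !in_itv /= => /andP[r0 rN] zN.
have /cutoff_scale_bounds[cr01 cr1 cr1' cr2] : - N n <= r <= N n.
  by rewrite rN andbT; apply: le_trans (ltW r0); rewrite oppr_le0.
have [cz01 cz1 cz1' cz2] := cutoff_scale_bounds zN.
have gC := slice_g_le z r0.
have B1 := beta1_K n gC; have B0 := beta_K n gC.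
have K0 : 0 <= K by apply: le_trans B1.
have [bg bh bab] := slice_bounds z r0.
rewrite /balance_term.
set cr := cutoff _ r in cr01 *; set cz := cutoff _ z in cz01 *.
set cr' := cutoff1 _ r in cr1 cr1' *; set cz' := cutoff1 _ z in cz1 cz1' *.
set cr'' := cutoff2 _ r in cr2 *; set cz'' := cutoff2 _ z in cz2 *.
clearbody cr cz cr' cz' cr'' cz''.
rewrite (gtr0_norm r0) in cr1'.
have {}cr01 : `|cr| <= 1 by case/andP: cr01 => ? ?; rewrite ger0_norm.
have {}cz01 : `|cz| <= 1 by case/andP: cz01 => ? ?; rewrite ger0_norm.
have t1 : `|beta1 n (g r z) * h r z * (cr * cz) * r| <= K * (C * weight r z).
  rewrite !normrM (gtr0_norm r0).
  apply: le_trans (_ : K * `|h r z| * (1 * 1) * r <= _); last first.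
    by rewrite !mulr1 -mulrA ler_wpM2l.
  by rewrite ler_wpM2r ?(ltW r0) //; do ?[apply: ler_pM; rewrite ?mulr_ge0 //].
have t2 : `|nu * beta n (g r z) * (r * cr'' * cz + r * cr * cz'' - cr' * cz)|
    <= nu * K * 66 * (C * weight r z).
  apply: le_trans (_ : nu * (K * `|g r z|) * (r * 30 * 1 + r * 1 * 30 + 6 * r * 1) <= _).
    rewrite !normrM (gtr0_norm nu0); apply: ler_pM => //; rewrite ?mulr_ge0 ?(ltW nu0) //.
      by rewrite ler_wpM2l // (ltW nu0).
    apply: le_trans (ler_normB _ _) _; apply: lerD.
      apply: le_trans (ler_normD _ _) _; apply: lerD; rewrite !normrM (gtr0_norm r0).
        by do ?[apply: ler_pM; rewrite ?mulr_ge0 ?(ltW r0) //].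
      by do ?[apply: ler_pM; rewrite ?mulr_ge0 ?(ltW r0) //].
    by rewrite normrM ler_pM.
  rewrite (_ : _ * _ = nu * K * 66 * (`|g r z| * r)); last by ring.
  by rewrite ler_wpM2l // !mulr_ge0 // (ltW nu0).
have t3 : `|beta n (g r z) * r * (a r z * (cr' * cz) + b r z * (cr * cz'))|
    <= K * 6 * (C * weight r z).
  apply: le_trans (_ : K * `|g r z| * r * (`|a r z| * (6 * 1) + `|b r z| * (1 * 6)) <= _).
    rewrite !normrM (gtr0_norm r0); apply: ler_pM => //; rewrite ?mulr_ge0 ?(ltW r0) //.
      by rewrite ler_wpM2r // (ltW r0).
    apply: le_trans (ler_normD _ _) _; apply: lerD; rewrite !normrM.
      by rewrite ler_wpM2l // ler_pM.
    by rewrite ler_wpM2l // ler_pM.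
  rewrite (_ : _ * _ = K * 6 * ((`|a r z| + `|b r z|) * `|g r z| * r)); last by ring.
  by rewrite ler_wpM2l // mulr_ge0.
apply: le_trans (ler_normD _ _) _; apply: le_trans (lerD (ler_normD _ _) (lexx _)) _.
rewrite normrN; apply: le_trans (lerD (lerD t1 t2) t3) _.
by rewrite le_eqVlt; apply/orP; left; apply/eqP; ring.
Qed.

Lemma cvg_scale : k n @[n --> \oo] --> 0.
Proof.
have c : (fun n => (harmonic n : R) * harmonic n) @ \oo --> (0 * 0 : R).
  by apply: cvgM; exact: cvg_harmonic.
rewrite mul0r in c; apply: cvg_trans c; apply: near_eq_cvg; apply: nearW => n.
by rewrite /k /harmonic /= -expr2 exprVn.
Qed.

(** At fixed x the cutoff is a polynomial in k, so its limit, like those of its derivatives, is the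
    value at k = 0. *)
Lemma cvg_cutoff x : cutoff (k n) x @[n --> \oo] --> (1 : R).
Proof.
have -> : (1 : R) = cutoff 0 x by rewrite /cutoff mul0r subr0 expr1n.
have c : continuous (fun k => cutoff k x) by rewrite /cutoff; continuity.
exact: (cvg_comp _ _ cvg_scale (c 0)).
Qed.

Lemma cvg_cutoff1 x : cutoff1 (k n) x @[n --> \oo] --> (0 : R).
Proof.
have -> : (0 : R) = cutoff1 0 x by rewrite /cutoff1; ring.
have c : continuous (fun k => cutoff1 k x) by rewrite /cutoff1; continuity.
exact: (cvg_comp _ _ cvg_scale (c 0)).
Qed.

Lemma cvg_cutoff2 x : cutoff2 (k n) x @[n --> \oo] --> (0 : R).
Proof.
have -> : (0 : R) = cutoff2 0 x by rewrite /cutoff2; ring.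
have c : continuous (fun k => cutoff2 k x) by rewrite /cutoff2; continuity.
exact: (cvg_comp _ _ cvg_scale (c 0)).
Qed.

Lemma cvg_balance_term r z :
  balance_term nu g a b h (beta n) (beta1 n) (k n) r z @[n --> \oo] -->
  - (p * (`|g r z| `^ (p - 2) * g r z) * h r z * r).
Proof.
set l := p * _.
(* The limit is rewritten in the shape of [balance_term], with the limits 1, 0, 0 of the cutoff and
   its derivatives in place, so that [limits] can match it term by term. *)
have -> : - (l * h r z * r) = - (l * h r z * (1 * 1) * r)
   + nu * `|g r z| `^ p * (r * 0 * 1 + r * 1 * 0 - 0 * 1)
   + `|g r z| `^ p * r * (a r z * (0 * 1) + b r z * (1 * 0)) by ring.
have := @cvg_cutoff r; have := @cvg_cutoff z; have := @cvg_cutoff1 r; have := @cvg_cutoff1 z.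
have := @cvg_cutoff2 r; have := @cvg_cutoff2 z.
have := @beta_lim (g r z); have := @beta1_lim (g r z); rewrite -/l.
by move=> *; rewrite /balance_term; limits.
Qed.

Lemma cvg_dissipation_term r z :
  dissipation_term nu g gr gz (beta2 n) (k n) r z @[n --> \oo] -->
  nu * (p * (p - 1) * `|g r z| `^ (p - 2)) * (gr r z ^+ 2 + gz r z ^+ 2) * r.
Proof.
rewrite -[X in _ --> X * r]mulr1 -[X in _ --> _ * X * r](mulr1 1).
have := @cvg_cutoff r; have := @cvg_cutoff z; have := @beta2_lim (g r z).
by move=> *; rewrite /dissipation_term; limits.
Qed.

Lemma axis_limit :
  mu.-integrable setT (fun z => (`|g 0 z| `^ p)%:E) /\
  \int[mu]_(z in `[- N n, N n]) (cutoff (k n) z * beta n (g 0 z)) @[n --> \oo] -->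
  \int[mu]_z `|g 0 z| `^ p.
Proof.
have C0 := slice_C_ge0.
pose f n z : R := cutoff (k n) z * beta n (g 0 z).
pose F n := (EFin \o f n) \_ `[- N n, N n].
have cf n : continuous (f n).
  apply: continuous_mul; first exact: continuous_cutoff.
  apply: continuous_compose; first exact: is_derive_continuous (beta_d n).
  exact: (@continuous_slice2 _ (fun x => g x.1 x.2) 0 (slice_cg S)).
have mf n : measurable_fun setT (F n).
  apply/(measurable_restrictT _ _).1; first exact: measurable_itv.
  exact: continuous_measurable_line.
have g0C z : `|g 0 z| <= C.
  apply: le_trans (slice_axis_le z) _; rewrite ler_pdivrMr ?ltr_pwDl ?sqr_ge0 //.
  by rewrite ler_peMr // lerDl sqr_ge0.
have fF z : F n z @[n --> \oo] --> (`|g 0 z| `^ p)%:E.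
  have c : f n z @[n --> \oo] --> `|g 0 z| `^ p.
    by rewrite -[X in _ --> X]mul1r; apply: cvgM; [exact: cvg_cutoff|exact: beta_lim].
  apply: cvg_trans (cvg_EFin (f := fun n => (f n z)%:E) _ c) => //; last exact: nearW.
  apply: near_eq_cvg; near=> n; rewrite /F patchE mem_set //=.
  have [_ ] : box (N n) (1, z) by near: n; apply: near_box; exact: ltr01.
  by [].
have iW : mu.-integrable setT (fun z => (K * C)%:E * ((1 + z ^+ 2)^-1)%:E)%E.
  by apply: integrableZl => //; exact: integrable_inv_oneDsqr.
have K0 : 0 <= K by apply: le_trans (beta1_K 0 (g0C 0)).
have [|||||i _ c] := @dominated_convergence _ (measurableTypeR R) R mu setT measurableT
  F (fun z => (`|g 0 z| `^ p)%:E) (fun z => (K * C)%:E * ((1 + z ^+ 2)^-1)%:E)%E.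
- exact: mf.
- by apply: emeasurable_fun_cvg mf _ => z _; exact: fF.
- by apply: aeW => z _; exact: fF.
- exact: iW.
- apply: aeW => z n _; rewrite /F patchE; case: ifP => [/set_mem /=|_]; last first.
    by rewrite abse0 -EFinM lee_fin !mulr_ge0 ?invr_ge0 ?addr_ge0 ?sqr_ge0.
  rewrite in_itv /= => zN; rewrite lee_fin normrM -mulrA -[leRHS]mul1r.
  have [/andP[c0 c1] _ _ _] := cutoff_scale_bounds zN.
  apply: ler_pM => //; first by rewrite ger0_norm.
  apply: le_trans (beta_K n (g0C z)) _; rewrite ler_wpM2l //; exact: slice_axis_le.
split => //; move: c => /=; rewrite -[X in _ --> X]fineK; last first.
  exact: integrable_fin_num.
move=> /fine_cvgP[_]; apply: cvg_trans; apply: near_eq_cvg; near=> n => /=.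
by rewrite /F -integral_mkcond.
Unshelve. all: end_near. Qed.

(** The limit of the dissipation is taken twice. The box identity shows that its integrals converge,
    and Fatou deduces integrability of the limit; only then is a majorant available that identifies
    the limit of the integrals. *)
Theorem energy_balance :
  [/\ (area R).-integrable (@halfplane R) (fun x =>
        (`|g x.1 x.2| `^ (p - 2) * (gr x.1 x.2 ^+ 2 + gz x.1 x.2 ^+ 2) * x.1)%:E),
      mu.-integrable setT (fun z => (`|g 0 z| `^ p)%:E)
    & \int[area R]_(x in @halfplane R)
        (p * (`|g x.1 x.2| `^ (p - 2) * g x.1 x.2) * h x.1 x.2 * x.1)
      + nu * p * (p - 1) * \int[area R]_(x in @halfplane R)
        (`|g x.1 x.2| `^ (p - 2) * (gr x.1 x.2 ^+ 2 + gz x.1 x.2 ^+ 2) * x.1)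
      + 2 * nu * \int[mu]_z `|g 0 z| `^ p = 0 ].
Proof.
have [axI axL] := axis_limit; have C0 := slice_C_ge0.
have mH := @measurable_halfplane R.
have cont n := slice_continuity S (beta_d n) (beta1_d n) (@beta2_c n) (k n).
have K0 : 0 <= K by apply: le_trans (beta1_K 0 (slice_g_le 0 ltr01)).
have c66 : 0 <= K * (1 + 66 * nu + 6) * C.
  by rewrite !mulr_ge0 // !addr_ge0 // mulr_ge0 // ltW.
have iW : (area R).-integrable (@halfplane R)
    (fun x => (K * (1 + 66 * nu + 6) * C)%:E * (weight x.1 x.2)%:E)%E.
  by apply: integrableZl => //; exact: integrable_weight.
have W0 (x : R * R) : halfplane x -> 0 <= weight x.1 x.2.
  by move=> x0; rewrite /weight divr_ge0 ?sqr_ge0 // ltW.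
have [] := dominated_box (fun n => let: And4 _ c _ _ := cont n in c)
  (fun r z _ => @cvg_balance_term r z) iW.
- by move=> n r z rz; rewrite -EFinM lee_fin; exact: balance_term_bound.
- by move=> x x0; rewrite -EFinM lee_fin mulr_ge0 // W0.
move=> iB cB.
have cD : \int[area R]_(x in box (N n))
      dissipation_term nu g gr gz (beta2 n) (k n) x.1 x.2 @[n --> \oo] -->
    \int[area R]_(x in @halfplane R)
       - (p * (`|g x.1 x.2| `^ (p - 2) * g x.1 x.2) * h x.1 x.2 * x.1)
    - 2 * nu * \int[mu]_z `|g 0 z| `^ p.
  have E n := box_identity S (beta_d n) (beta1_d n) (@beta2_c n) (ltr0Sn R n).
  under eq_fun do rewrite E.
  by apply: cvgB; [exact: cB|apply: cvgM; [exact: cvg_cst|exact: axL]].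
have p0 : 0 < p * (p - 1) by rewrite mulr_gt0 ?subr_gt0 // (lt_trans ltr01).
have D0 n r z : box (N n) (r, z) -> 0 <= dissipation_term nu g gr gz (beta2 n) (k n) r z.
  move=> [/=]; rewrite !in_itv /= => /andP[r0 rN] zN.
  have /cutoff_scale_bounds[/andP[cr0 _] _ _ _] : - N n <= r <= N n.
    by rewrite rN andbT; apply: le_trans (ltW r0); rewrite oppr_le0.
  have [/andP[cz0 _] _ _ _] := cutoff_scale_bounds zN.
  have b0 := beta2_ge0 n (g r z); have r0' := ltW r0; have nu0' := ltW nu0.
  exact: mulr_ge0 (mulr_ge0 (mulr_ge0 (mulr_ge0 nu0' b0)
    (addr_ge0 (sqr_ge0 _) (sqr_ge0 _))) (mulr_ge0 cr0 cz0)) r0'.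
have iD := fatou_box (fun n => let: And4 c _ _ _ := cont n in c)
  (fun r z _ => @cvg_dissipation_term r z) D0 cD.
pose c1 := nu * (p * (p - 1)).
have c10 : 0 < c1 by rewrite mulr_gt0.
pose d (x : R * R) := `|g x.1 x.2| `^ (p - 2) * (gr x.1 x.2 ^+ 2 + gz x.1 x.2 ^+ 2) * x.1.
have d0 x : halfplane x -> 0 <= d x.
  move=> x0; apply: mulr_ge0 (mulr_ge0 _ (addr_ge0 (sqr_ge0 _) (sqr_ge0 _))) (ltW x0).
  exact: powR_ge0.
have id : (area R).-integrable (@halfplane R) (fun x => (d x)%:E).
  have := integrableZl mH c1^-1 iD; apply: eq_integrable => // x _.
  have pn : p != 0 by rewrite gt_eqF // (lt_trans ltr01).
  have qn : p - 1 != 0 by rewrite gt_eqF // subr_gt0.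
  have nn : nu != 0 by rewrite gt_eqF.
  by rewrite -EFinM /d /c1; congr EFin; field; rewrite ?pn ?qn ?nn.
have iW2 : (area R).-integrable (@halfplane R) (fun x => (nu * K2)%:E * (d x)%:E)%E.
  exact: integrableZl.
(* The majorant is the limiting dissipation density itself, up to the constant nu K2: [beta2_K]
   together with cutoff values in [0, 1]. *)
have [||_ cD'] := dominated_box (fun n => let: And4 c _ _ _ := cont n in c)
  (fun r z _ => @cvg_dissipation_term r z) iW2.
- move=> n r z rz; rewrite -EFinM lee_fin ger0_norm; last exact: D0.
  case: rz => [/=]; rewrite !in_itv /= => /andP[r0 rN] zN.
  have /cutoff_scale_bounds[/andP[cr0 cr1] _ _ _] : - N n <= r <= N n.
    by rewrite rN andbT; apply: le_trans (ltW r0); rewrite oppr_le0.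
  have [/andP[cz0 cz1] _ _ _] := cutoff_scale_bounds zN.
  have nu0' := ltW nu0; have b0 := beta2_ge0 n (g r z).
  have G0 : 0 <= gr r z ^+ 2 + gz r z ^+ 2 by rewrite addr_ge0 ?sqr_ge0.
  rewrite /dissipation_term /d /=; set W := `|g r z| `^ (p - 2).
  rewrite (_ : nu * K2 * _ = nu * (K2 * W) * (gr r z ^+ 2 + gz r z ^+ 2) * (1 * 1) * r);
    last by ring.
  apply: (ler_wpM2r (ltW r0)); apply: ler_pM.
  + exact: mulr_ge0 (mulr_ge0 nu0' b0) G0.
  + exact: mulr_ge0.
  + by apply: (ler_wpM2r G0); apply: ler_wpM2l => //; exact: beta2_K.
  + exact: ler_pM.
- move=> x x0; rewrite -EFinM lee_fin.
  have K20 : 0 <= K2 * `|1 : R| `^ (p - 2) := le_trans (beta2_ge0 0 1) (beta2_K 0 1).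
  rewrite normr1 powR1 mulr1 in K20.
  exact: mulr_ge0 (mulr_ge0 (ltW nu0) K20) (d0 x x0).
have EL := cvg_unique (@Rhausdorff R) cD cD'; split => //.
have <- : \int[area R]_(x in @halfplane R) (c1 * d x) =
    nu * p * (p - 1) * \int[area R]_(x in @halfplane R) d x.
  by rewrite RintegralZl // /c1; ring.
have -> : \int[area R]_(x in @halfplane R) (c1 * d x) = 
   \int[area R]_(x in @halfplane R) (nu * (p * (p - 1) * `|g x.1 x.2| `^ (p - 2)) * 
     (gr x.1 x.2 ^+ 2 + gz x.1 x.2 ^+ 2) * x.1).
  by apply: eq_Rintegral => x _; rewrite /d /c1; ring.
rewrite -EL.
set I1 := \int[area R]_(x in @halfplane R) (- _).
have -> : \int[area R]_(x in @halfplane R)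
    (p * (`|g x.1 x.2| `^ (p - 2) * g x.1 x.2) * h x.1 x.2 * x.1) = - 1 * I1.
  by rewrite -RintegralZl //; apply: eq_Rintegral => x _; rewrite mulN1r opprK.
by ring.
Qed.

End EnergyBalance.

(** * Smooth approximation of powers *)

Section AbsolutePowers.
Variable R : realType.
Implicit Types (p q e s : R).

Lemma cvg_abs_powR0 e : 0 < e -> `|s| `^ e @[s --> (0 : R)] --> (0 : R).
Proof.
move=> e0; apply/cvgrPdist_lt => eps eps0.
have d0 : 0 < eps `^ e^-1 by rewrite powR_gt0.
near=> s.
have sd : `|s| < eps `^ e^-1.
  by near: s; apply/nbhs_ballP; exists (eps `^ e^-1) => //= s; rewrite /ball /= sub0r normrN.
rewrite sub0r normrN ger0_norm ?powR_ge0 //.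
have := gt0_ltr_powR e0 (normr_ge0 s) (ltW d0) sd.
by rewrite -powRrM mulVf ?gt_eqF // powRr1 // ltW.
Unshelve. all: end_near. Qed.

Lemma continuous_abs_powR e : 0 <= e -> continuous (fun s : R => `|s| `^ e).
Proof.
rewrite le_eqVlt => /predU1P[<-|e0] s.
  by under eq_fun do rewrite powRr0; exact: cvg_cst.
have [->|s0] := eqVneq s 0.
  rewrite /continuous_at normr0 powR0 ?gt_eqF //; exact: cvg_abs_powR0.
apply: (@continuous_comp _ _ _ (@Num.norm R R) (fun s => s `^ e)).
  exact: norm_continuous.
have ns : 0 < `|s| by rewrite normr_gt0.
have d := is_derive1_powR e ns.
by apply: differentiable_continuous; apply/derivable1_diffP; case: d.
Qed.

(** Serves the point 0, where the chain rule through the absolute value fails: the difference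
    quotient is at most w in absolute value. *)
Lemma is_derive0_of_bound (f w : R -> R) : f 0 = 0 ->
  (forall h, h != 0 -> `|f h| <= `|h| * w h) -> w h @[h --> (0 : R)] --> (0 : R) ->
  is_derive (0 : R) 1 f 0.
Proof.
move=> f0 fw w0.
have c : h^-1 *: (f (h *: (1 : R) + 0) - f 0) @[h --> (0 : R)^'] --> (0 : R).
  apply/norm_cvg0P; apply: (@squeeze_cvgr _ _ _ _ (cst 0) w).
  - near=> h; have h0 : h != 0 by near: h; exact: nbhs_dnbhs_neq.
    rewrite normr_ge0 /= f0 subr0 addr0 /GRing.scale /= mulr1 normrM normfV.
    by rewrite mulrC ler_pdivrMr ?normr_gt0 // mulrC fw.
  - exact: cvg_cst.
  - by apply: cvg_trans w0; apply: cvg_app; exact: nbhs_dnbhs.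
apply: DeriveDef; first by apply/cvg_ex; exists 0; exact: c.
by rewrite /derive; apply/cvg_lim.
Unshelve. all: end_near. Qed.

Lemma powR_mul_sqr e s : s != 0 -> `|s| `^ (e + 2) = `|s| `^ e * s ^+ 2.
Proof.
move=> s0; rewrite powRD; last by rewrite normr_eq0 s0 implybT.
by rewrite (@powR_mulrn _ `|s| 2) // real_normK ?num_real.
Qed.

(** Off 0 the sign of s is locally constant; at 0 the quotient is of size |h|^(q - 1), which tends
    to 0. The factor s makes the formula correct at 0 whatever value the power of 0 takes. *)
Lemma is_derive_abs_powR q s : 1 < q ->
  is_derive s 1 (fun s => `|s| `^ q) (q * (`|s| `^ (q - 2) * s)).
Proof.
move=> q1; have q0 : 0 < q by exact: lt_trans ltr01 q1.
have [s0|s0|->] := ltgtP s 0.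
- have d : is_derive s 1 (fun s : R => (- s) `^ q) (q * (- s) `^ (q - 1) * - 1).
    apply: (@is_derive_compose _ (fun y => y `^ q) (fun s => - s)).
    by apply: is_derive1_powR; rewrite oppr_gt0.
  apply: (is_derive_eq (@near_eq_is_derive _ _ _ _ _ _ _ _ _ d)).
    by near=> x; rewrite ltr0_norm //; near: x; exact: lt_nbhsl.
  have s0' : 0 < - s by rewrite oppr_gt0.
  rewrite ltr0_norm // mulrN1 -mulrN; congr (_ * _).
  rewrite (_ : q - 1 = q - 2 + 1); last by ring.
  by rewrite powRD ?(gt_eqF s0') ?implybT // powRr1 ?ltW //; ring.
- have d := is_derive1_powR q s0.
  apply: (is_derive_eq (@near_eq_is_derive _ _ _ _ _ _ _ _ _ d)).
    by near=> x; rewrite gtr0_norm //; near: x; exact: lt_nbhsr.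
  rewrite gtr0_norm //; congr (_ * _).
  rewrite (_ : q - 1 = q - 2 + 1); last by ring.
  by rewrite powRD ?(gt_eqF s0) ?implybT // powRr1 ?ltW.
rewrite !mulr0; apply: (@is_derive0_of_bound _ (fun h => `|h| `^ (q - 1))).
- by rewrite normr0 powR0 // gt_eqF.
- by move=> h h0; rewrite mulr_powRB1 // ger0_norm ?powR_ge0.
- by apply: cvg_abs_powR0; rewrite subr_gt0.
Unshelve. all: end_near. Qed.

Lemma is_derive_abs_powR_mul e s : 0 <= e ->
  is_derive s 1 (fun s => `|s| `^ e * s) ((e + 1) * `|s| `^ e).
Proof.
rewrite le_eqVlt => /predU1P[<-|e0].
  under eq_fun do rewrite powRr0 mul1r.
  by rewrite powRr0 add0r mulr1; exact: is_derive_id.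
have [->|s0] := eqVneq s 0.
  rewrite normr0 powR0 ?gt_eqF // mulr0.
  apply: (@is_derive0_of_bound _ (fun h => `|h| `^ e)).
  - by rewrite mulr0.
  - by move=> h _; rewrite normrM ger0_norm ?powR_ge0 // mulrC.
  - exact: cvg_abs_powR0.
(* |s|^e s = |s|^(e+2) / s away from 0 *)
have d2 : is_derive s 1 (fun s => `|s| `^ (e + 2)) ((e + 2) * (`|s| `^ (e + 2 - 2) * s)).
  by apply: is_derive_abs_powR; rewrite -[ltLHS]add0r ltrD // ltr1n.
have di : is_derive s 1 (fun s : R => s^-1) (- 1 / s ^+ 2).
  by apply: is_derive_inv => //; exact: is_derive_id.
have d := is_derive_mul d2 di.
apply: (is_derive_eq (@near_eq_is_derive _ _ _ _ _ _ _ _ _ d)).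
  near=> x; have x0 : x != 0.
    by near: x; apply: cvgr_neq0 s0; exact: cvg_id.
  by rewrite powR_mul_sqr //; field.
by rewrite powR_mul_sqr // addrK; field.
Unshelve. all: end_near. Qed.

Record power_approximation p (C K K2 : R) (beta beta1 beta2 : nat -> R -> R) : Prop := {
  approx_d : forall n s, is_derive s 1 (beta n) (beta1 n s);
  approx_d1 : forall n s, is_derive s 1 (beta1 n) (beta2 n s);
  approx_c2 : forall n, continuous (beta2 n);
  approx_K : forall n s, `|s| <= C -> `|beta n s| <= K * `|s|;
  approx_K1 : forall n s, `|s| <= C -> `|beta1 n s| <= K;
  approx_ge0 : forall n s, 0 <= beta2 n s;
  approx_K2 : forall n s, beta2 n s <= K2 * `|s| `^ (p - 2);
  approx_lim : forall s, beta n s @[n --> \oo] --> `|s| `^ p;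
  approx_lim1 : forall s, beta1 n s @[n --> \oo] --> p * (`|s| `^ (p - 2) * s);
  approx_lim2 : forall s, beta2 n s @[n --> \oo] --> p * (p - 1) * `|s| `^ (p - 2)
}.

Lemma le_MVT0 (f f' : R -> R) C K s : (forall s, is_derive s 1 f (f' s)) -> f 0 = 0 ->
  (forall s, `|s| <= C -> `|f' s| <= K) -> `|s| <= C -> `|f s| <= K * `|s|.
Proof.
move=> fd f0 f'K sC; have cf := is_derive_continuous fd.
have [s0|s0] := leP 0 s.
  have [|c] := @MVT_segment R f f' 0 s s0 (fun x _ => fd x); first exact: continuous_subspaceT.
  rewrite in_itv /= f0 !subr0 => /andP[c0 cs] ->; rewrite normrM ler_wpM2r //.
  by apply: f'K; rewrite ger0_norm // (le_trans cs) // -(ger0_norm s0).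
have [|c] := @MVT_segment R f f' s 0 (ltW s0) (fun x _ => fd x); first exact: continuous_subspaceT.
rewrite in_itv /= f0 !sub0r => /andP[c0 cs] fE; rewrite -normrN fE normrM normrN ler_wpM2r //.
apply: f'K; rewrite ler0_norm // (le_trans _ sC) // ltr0_norm //.
by rewrite lerN2.
Qed.

Lemma abs_powR_mul_le p C s : 1 < p -> `|s| <= C ->
  `|p * (`|s| `^ (p - 2) * s)| <= p * C `^ (p - 1).
Proof.
move=> p1 sC; have C0 : 0 <= C by apply: le_trans sC.
have p0 : 0 < p by exact: lt_trans ltr01 p1.
rewrite normrM gtr0_norm // ler_wpM2l ?(ltW p0) // normrM ger0_norm ?powR_ge0 //.
have [->|s0] := eqVneq s 0; first by rewrite normr0 mulr0 powR_ge0.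
rewrite mulrC -[X in X * _]powRr1 // -powRD; last by rewrite normr_eq0 s0 implybT.
rewrite (_ : 1 + (p - 2) = p - 1); last by ring.
by apply: ge0_ler_powR; rewrite ?nnegrE // subr_ge0 ltW.
Qed.

(** For such p the power is already C^2 and the constant sequence serves. *)
Lemma power_approximation_ge2 p C : 2 <= p ->
  power_approximation p C (p * C `^ (p - 1)) (p * (p - 1))
    (fun _ s => `|s| `^ p) (fun _ s => p * (`|s| `^ (p - 2) * s))
    (fun _ s => p * (p - 1) * `|s| `^ (p - 2)).
Proof.
move=> p2; have p1 : 1 < p by apply: lt_le_trans p2; rewrite ltr1n.
have p20 : 0 <= p - 2 by rewrite subr_ge0.
have d (s : R) : is_derive s 1 (fun s => `|s| `^ p) (p * (`|s| `^ (p - 2) * s)).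
  exact: is_derive_abs_powR.
split => [_ s|_ s|_|_ s sC|_ s sC|_ s|_ s|s|s|s]; try exact: cvg_cst.
- exact: d.
- have dm := is_derive_abs_powR_mul s p20.
  have dc := is_derive_cst p s 1.
  apply: (is_derive_eq (is_derive_mul dc dm)); rewrite /=.
  by rewrite mul0r add0r mulrA; congr (_ * _ * _); ring.
- apply: continuous_mul; first exact: continuous_const.
  exact: continuous_abs_powR.
- apply: (le_MVT0 d _ _ sC); first by rewrite normr0 powR0 // gt_eqF // (lt_trans ltr01).
  by move=> t; exact: abs_powR_mul_le.
- exact: abs_powR_mul_le.
- by rewrite !mulr_ge0 ?powR_ge0 ?subr_ge0 ?ltW // (lt_trans ltr01).
- by [].
Qed.

Section RegularizedPowers.
Variables (p C : R).
Hypotheses (p1 : 1 < p) (p2 : p < 2).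
Let p0 : 0 < p. Proof. exact: lt_trans ltr01 p1. Qed.

Let e (n : nat) : R := harmonic n.
Let A n s : R := s ^+ 4 + e n ^+ 4.

Let e4_gt0 n : 0 < e n ^+ 4.
Proof. by rewrite exprn_gt0 // invr_gt0. Qed.

Let A_gt0 n s : 0 < A n s.
Proof. by rewrite ltr_wpDl // (_ : s ^+ 4 = (s ^+ 2) ^+ 2) ?sqr_ge0 // -exprM. Qed.

Let s4_gt0 s : s != 0 -> 0 < s ^+ 4.
Proof. by move=> s0; rewrite lt_def expf_neq0 //= (_ : s ^+ 4 = (s ^+ 2) ^+ 2) ?sqr_ge0 // -exprM. Qed.

Let dA n s : is_derive s 1 (A n) (4 * s ^+ 3).
Proof. by rewrite /A; differentiate; rewrite /=; ring. Qed.

Let dApow n y s : is_derive s 1 (fun s => A n s `^ y) (y * A n s `^ (y - 1) * (4 * s ^+ 3)).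
Proof.
apply: (@is_derive_compose _ (fun t => t `^ y) (A n)); last exact: dA.
exact: is_derive1_powR.
Qed.

(* The exponent 4 makes b2 vanish at 0, which agrees with the convention
   0 `^ (p - 2) = 0 on the set where the solution vanishes. *)
Let b n s := A n s `^ (p / 4) - (e n ^+ 4) `^ (p / 4).
Let b1 n s := p * (s ^+ 3 * A n s `^ (p / 4 - 1)).
Let b2 n s := p * s ^+ 2 * A n s `^ (p / 4 - 2) * (3 * e n ^+ 4 + (p - 1) * s ^+ 4).

Let powR_A n s y : A n s `^ (y + 1) = A n s `^ y * A n s.
Proof.
rewrite powRD; first by rewrite powRr1 // ltW.
by rewrite (gt_eqF (A_gt0 n s)) implybT.
Qed.

Let pow4 s y : s != 0 -> (s ^+ 4) `^ y = `|s| `^ (4 * y).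
Proof.
move=> s0; rewrite powRrM (@powR_mulrn _ `|s| 4) // -normrX ger0_norm //.
exact: ltW (s4_gt0 s0).
Qed.

Let A_le n s y : s != 0 -> y <= 0 -> A n s `^ y <= `|s| `^ (4 * y).
Proof.
move=> s0 y0; rewrite -pow4 // -(opprK y) !(powRN _ (- y)) lef_pV2 ?posrE ?powR_gt0 ?s4_gt0 //.
apply: ge0_ler_powR; rewrite ?nnegrE ?oppr_ge0 // ?ltW ?s4_gt0 //.
by rewrite /A ltrDl.
Qed.

Let cvg_A s : A n s @[n --> \oo] --> s ^+ 4.
Proof.
rewrite -[X in _ --> X]addr0 -[X in _ --> _ + X](expr0n _ 4); apply: cvgD; first exact: cvg_cst.
by apply: (cvg_comp e (fun x => x ^+ 4) cvg_harmonic); exact: exprn_continuous.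
Qed.

Let cvg_Apow s y : s != 0 -> A n s `^ y @[n --> \oo] --> `|s| `^ (4 * y).
Proof.
move=> s0; rewrite -pow4 //; apply: (cvg_comp (fun n => A n s) (fun x => x `^ y) (@cvg_A s)).
have d := is_derive1_powR y (s4_gt0 s0).
have c : {for s ^+ 4, continuous (fun x => x `^ y)}.
  by apply: differentiable_continuous; apply/derivable1_diffP; case: d.
exact: c.
Qed.

(** The regularization is (s^4 + e^4)^(p/4) - e^p with e tending to 0. Its bounds come from s^4 +
    e^4 >= s^4 raised to nonpositive powers; K2 = 3 p because 3 e^4 + (p - 1) s^4 <= 3 (s^4 +
    e^4). *)
Lemma power_approximation_lt2 :
  power_approximation p C (p * C `^ (p - 1)) (3 * p) b b1 b2.
Proof.
have db n (s : R) : is_derive s 1 (b n) (b1 n s).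
  have d := dApow n (p / 4) s; rewrite /b; differentiate.
  by rewrite /b1 addr0; field.
have q0 : p / 4 - 1 <= 0.
  by rewrite subr_le0 ler_pdivrMr // mul1r (le_trans (ltW p2)) // ler_nat.
have b1K n s : `|s| <= C -> `|b1 n s| <= p * C `^ (p - 1).
  move=> sC; have [->|s0] := eqVneq s 0.
    by rewrite /b1 expr0n mul0r mulr0 normr0 mulr_ge0 ?powR_ge0 ?(ltW p0).
  apply: le_trans (abs_powR_mul_le p1 sC).
  rewrite /b1 !(normrM p) ler_wpM2l // (normrM (s ^+ 3)) (normrM (_ `^ _) s) (ger0_norm (powR_ge0 _ _)) (ger0_norm (powR_ge0 `|s| _)).
  apply: le_trans (_ : `|s ^+ 3| * `|s| `^ (4 * (p / 4 - 1)) <= _).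
    by rewrite ler_wpM2l // A_le.
  rewrite (_ : p - 2 = 4 * (p / 4 - 1) + 2); last by field.
  by rewrite powR_mul_sqr // normrX -(real_normK (num_real s)) le_eqVlt; apply/orP; left; apply/eqP; ring.
have b2K n s : b2 n s <= 3 * p * `|s| `^ (p - 2).
  have [->|s0] := eqVneq s 0.
    by rewrite /b2 expr0n mulr0 !mul0r !mulr_ge0 ?powR_ge0 ?(ltW p0).
  rewrite /b2; apply: le_trans (_ : p * s ^+ 2 * A n s `^ (p / 4 - 2) * (3 * A n s) <= _).
    apply: (ler_wpM2l (mulr_ge0 (mulr_ge0 (ltW p0) (sqr_ge0 s)) (powR_ge0 _ _))).
    rewrite /A mulrDr addrC lerD2r ler_wpM2r ?(ltW (s4_gt0 s0)) // lerBlDr.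
    by apply: le_trans (ltW p2) _; lra.
  rewrite (_ : _ * _ = 3 * p * s ^+ 2 * (A n s `^ (p / 4 - 2) * A n s)); last by ring.
  rewrite -powR_A (_ : p / 4 - 2 + 1 = p / 4 - 1); last by ring.
  rewrite (_ : p - 2 = 4 * (p / 4 - 1) + 2); last by field.
  rewrite powR_mul_sqr // [leRHS]mulrCA [leRHS]mulrC.
  by apply: (ler_wpM2l (mulr_ge0 (mulr_ge0 (ler0n _ 3) (ltW p0)) (sqr_ge0 s))); exact: A_le.
split => [//|n s|n|n s sC|//|n s|//|s|s|s].
- have d := dApow n (p / 4 - 1) s; rewrite /b1; differentiate.
  rewrite /b2 /= !(mul0r, add0r) (_ : p / 4 - 1 - 1 = p / 4 - 2); last by ring.
  rewrite (_ : p / 4 - 1 = p / 4 - 2 + 1) ?powR_A; last by ring.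
  by rewrite /A; field.
- have c y : continuous (fun s => A n s `^ y) := is_derive_continuous (dApow n y).
  by have := c (p / 4 - 2); rewrite /b2 => ?; continuity.
- apply: (le_MVT0 (db n) _ (b1K n) sC).
  by rewrite /b /A expr0n add0r subrr.
- apply: (mulr_ge0 (mulr_ge0 (mulr_ge0 (ltW p0) (sqr_ge0 s)) (powR_ge0 _ _))).
  apply: addr_ge0; first exact: mulr_ge0 (ler0n _ _) (ltW (e4_gt0 n)).
  by apply: mulr_ge0; rewrite ?subr_ge0 ?(ltW p1) // (_ : s ^+ 4 = (s ^+ 2) ^+ 2) ?sqr_ge0 // -exprM.
- have [->|s0] := eqVneq s 0.
    rewrite normr0 powR0 ?gt_eqF //.
    rewrite (_ : (fun n => b n 0) = cst 0); first exact: cvg_cst.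
    by apply/funext => n; rewrite /b /A expr0n add0r subrr.
  rewrite -[X in _ --> X]subr0; apply: cvgB.
    have -> : `|s| `^ p = `|s| `^ (4 * (p / 4)) by congr powR; field.
    exact: cvg_Apow.
  have E n : (e n ^+ 4) `^ (p / 4) = `|e n| `^ p.
    by rewrite pow4; [congr powR; field|rewrite gt_eqF // invr_gt0].
  under eq_fun do rewrite E.
  by apply: (cvg_comp e (fun x => `|x| `^ p) cvg_harmonic); exact: cvg_abs_powR0.
- have [->|s0] := eqVneq s 0.
    rewrite !mulr0 (_ : (fun n => b1 n 0) = cst 0); first exact: cvg_cst.
    by apply/funext => n; rewrite /b1 expr0n mul0r mulr0.
  have -> : p * (`|s| `^ (p - 2) * s) = p * (s ^+ 3 * `|s| `^ (4 * (p / 4 - 1))).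
    rewrite (_ : p - 2 = 4 * (p / 4 - 1) + 2); last by field.
    by rewrite powR_mul_sqr //; ring.
  apply: limit_mul; first exact: cvg_cst.
  by apply: limit_mul; [exact: cvg_cst|exact: cvg_Apow].
- have [->|s0] := eqVneq s 0.
    rewrite normr0 powR0 ?mulr0; last by rewrite subr_eq0 lt_eqF.
    rewrite (_ : (fun n => b2 n 0) = cst 0); first exact: cvg_cst.
    by apply/funext => n; rewrite /b2 expr0n mulr0 !mul0r.
  have -> : p * (p - 1) * `|s| `^ (p - 2) =
      p * s ^+ 2 * `|s| `^ (4 * (p / 4 - 2)) * (3 * 0 ^+ 4 + (p - 1) * s ^+ 4).
    rewrite (_ : p - 2 = 4 * (p / 4 - 2) + 2 + 2 + 2); last by field.
    by rewrite !powR_mul_sqr //; ring.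
  apply: limit_mul; first by apply: limit_mul; [exact: cvg_cst|exact: cvg_Apow].
  apply: limit_add; last exact: cvg_cst.
  apply: limit_mul; first exact: cvg_cst.
  by apply: (cvg_comp e (fun x => x ^+ 4) cvg_harmonic); exact: exprn_continuous.
Qed.

End RegularizedPowers.

Lemma power_approximation_exists p C : 1 < p ->
  exists K K2 beta beta1 beta2, power_approximation p C K K2 beta beta1 beta2.
Proof.
move=> p1; have [p2|p2] := leP 2 p; do 5 eexists.
  exact: power_approximation_ge2.
exact: power_approximation_lt2.
Qed.

End AbsolutePowers.

(** * Time slices of a solution *)

Section Extension.
Variable R : realType.
Local Notation V := (R * R * R * R)%type.
Implicit Types (O : set V) (G : V -> R) (r z t : R).

(** Along an affine line of direction v the difference quotients in one variable are those of the
    directional derivative. *)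
Lemma is_derive_line (f : V -> R) (c : R -> V) (v : V) (x : R) :
  (forall h : R, c (h + x) = h *: v + c x) -> differentiable f (c x) ->
  is_derive x 1 (fun y => f (c y)) ('D_v f (c x)).
Proof.
move=> cv fd; have dv : derivable f (c x) v by exact: diff_derivable.
have E : (fun h : R => h^-1 *: ((fun y => f (c y)) (h *: (1 : R) + x) - f (c x))) =
         (fun h : R => h^-1 *: (f (h *: v + c x) - f (c x))).
  by apply/funext => h; rewrite /GRing.scale /= mulr1 cv.
by apply: DeriveDef; rewrite /derivable /derive E.
Qed.

(** A point of the plane x2 = 0. Allowing r < 0 makes the profiles functions on all of R^2, smooth
    across the axis. *)
Definition axial_point r z t : V := (r, 0, z, t).
Definition dir_r : V := (1, 0, 0, 0).
Definition dir_z : V := (0, 0, 1, 0).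
Definition dir_t : V := (0, 0, 0, 1).
Definition iterated G (vs : seq V) : V -> R := foldr (fun v H => 'D_v H : V -> R) G vs.

Variables (T : \bar R) (O : set V) (G : V -> R).
Hypothesis openO : open O.
Hypothesis subO : spacetime T `<=` O.
Hypothesis smoothG : forall vs x, O x -> differentiable (iterated G vs) x.

Let inO r z t : lifespan T t -> O (axial_point r z t).
Proof. by move=> tT; apply: subO. Qed.

Lemma iterated_d_r vs r z t : lifespan T t ->
  is_derive r 1 (fun r => iterated G vs (axial_point r z t))
    (iterated G (dir_r :: vs) (axial_point r z t)).
Proof.
move=> tT; apply: (@is_derive_line _ (fun r => axial_point r z t)).
  by move=> h; congr (_, _, _, _); rewrite /= ?scaler0 ?add0r // /GRing.scale /= mulr1.
exact/smoothG/inO.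
Qed.

Lemma iterated_d_z vs r z t : lifespan T t ->
  is_derive z 1 (fun z => iterated G vs (axial_point r z t))
    (iterated G (dir_z :: vs) (axial_point r z t)).
Proof.
move=> tT; apply: (@is_derive_line _ (fun z => axial_point r z t)).
  by move=> h; congr (_, _, _, _); rewrite /= ?scaler0 ?add0r // /GRing.scale /= mulr1.
exact/smoothG/inO.
Qed.

Lemma iterated_d_t vs r z t : lifespan T t ->
  is_derive t 1 (fun t => iterated G vs (axial_point r z t))
    (iterated G (dir_t :: vs) (axial_point r z t)).
Proof.
move=> tT; apply: (@is_derive_line _ (fun t => axial_point r z t)).
  by move=> h; congr (_, _, _, _); rewrite /= ?scaler0 ?add0r // /GRing.scale /= mulr1.
exact/smoothG/inO.
Qed.

Lemma iterated_continuous2 vs t : lifespan T t ->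
  continuous2 (fun r z => iterated G vs (axial_point r z t)).
Proof.
move=> tT x; apply: (@continuous_comp _ _ _ (fun x : R * R => axial_point x.1 x.2 t)).
  apply: continuous_pair; last exact: continuous_const.
  apply: continuous_pair; last exact: continuous_snd_real.
  by apply: continuous_pair; [exact: continuous_fst_real|exact: continuous_const].
by apply: differentiable_continuous; exact/smoothG/inO.
Qed.

Lemma iterated_continuous_t vs r z t : lifespan T t ->
  {for t, continuous (fun t => iterated G vs (axial_point r z t))}.
Proof.
move=> tT; apply: differentiable_continuous; apply/derivable1_diffP.
by case: (iterated_d_t vs r z tT).
Qed.

End Extension.

(** * Slices of a solution up to the initial time *)

Section Slicing.
Variable R : realType.
Local Notation V := (R * R * R * R)%type.

Lemma ge0_limit0 (F : R -> R) : {for 0, continuous F} ->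
  (\forall t \near (0 : R)^'+, 0 <= F t) -> 0 <= F 0.
Proof.
move=> cF F0; apply: (@cvgr_to_ge _ (0^'+ : set_system R) _ _ F) => //.
exact: cvg_at_right_filter.
Qed.

Lemma lifespan_near (T : \bar R) (t : R) : 0 < t -> lifespan T t ->
  \forall s \near t, 0 < s /\ lifespan T s.
Proof.
move=> t0 [_ tT]; near=> s.
have s0 : 0 < s by near: s; exact: lt_nbhsr.
split => //; split; first exact: ltW.
near: s; case: T tT => [u| |] //=; last by move=> _; apply: nearW => s; rewrite ltry.
rewrite lte_fin => tu; near=> s; rewrite lte_fin; near: s; exact: lt_nbhsl.
Unshelve. all: end_near. Qed.

Lemma lifespan_ltW (T : \bar R) (s t : R) : 0 <= s <= t -> lifespan T t -> lifespan T s.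
Proof. by move=> /andP[s0 st] [_ tT]; split => //; apply: le_lt_trans tT; rewrite lee_fin. Qed.

Lemma derive1_near (f g : R -> R) (x d : R) : is_derive x 1 g d ->
  (\forall y \near x, g y = f y) -> derive1 f x = d.
Proof.
move=> gd fg; rewrite derive1E.
by have d' := @near_eq_is_derive _ _ _ g f x 1 d fg gd; exact: derive_val.
Qed.

Variables (nu : R) (T : \bar R) (ur uz g : R -> R -> R -> R).
Hypothesis sol : decaying_smooth_solution nu T ur uz g.

(** The profiles are restrictions of the Cartesian extensions to the plane x2 = 0. The equation and
    the decay are known for t > 0; both involve finitely many iterated derivatives, continuous at t
    = 0, so they persist there. The decay constant is common to all of [0, tau]. *)
Lemma solution_slices : exists ge gr gz grr gzz a ar b bz h : R -> R -> R -> R,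
  [/\ forall t r z, lifespan T t -> 0 <= r -> g t r z = ge t r z,
      forall t r z, lifespan T t -> 0 < r ->
        d_r (g t) r z = gr t r z /\ d_z (g t) r z = gz t r z,
      forall t r z, lifespan T t -> is_derive t 1 (fun s => ge s r z) (h t r z)
    & forall tau, 0 < tau -> lifespan T tau -> exists C, forall t, 0 <= t <= tau ->
        slice nu C (ge t) (gr t) (gz t) (grr t) (gzz t) (a t) (ar t) (b t) (bz t) (h t)].
Proof.
have [[smr _ smz] dv smg pde dec] := sol.
have [U1 [G [oO sO GE dG]]] := smg.
have [U2 [A [oO2 sO2 AE dA]]] := smr.
have [U3 [B [oO3 sO3 BE dB]]] := smz.
pose P t r z := axial_point r z t : V.
pose it F vs t r z := iterated F vs (P t r z).
have sq (r : R) : 0 <= r -> Num.sqrt (r ^+ 2 + 0 ^+ 2) = r.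
  by move=> r0; rewrite expr0n addr0 sqrtr_sqr ger0_norm.
have gE t r z : lifespan T t -> 0 <= r -> g t r z = it G [::] t r z.
  by move=> tT r0; rewrite /it /= -GE // /axial_point /= sq.
have uzE t r z : lifespan T t -> 0 <= r -> uz t r z = it B [::] t r z.
  by move=> tT r0; rewrite /it /= -BE // /axial_point /= sq.
(* The comparison stops at r > 0: on the axis x1 / r is 0 by convention. *)
have urE t r z : lifespan T t -> 0 < r -> ur t r z = it A [::] t r z.
  by move=> tT r0; rewrite /it /= -AE // /axial_point /= sq ?(ltW r0) // divff ?mul1r // gt_eqF.
have near_pos (r : R) : 0 < r -> \forall y \near r, 0 < y by move=> r0; exact: lt_nbhsr.
have Dr t r z : lifespan T t -> 0 < r -> d_r (g t) r z = it G [:: dir_r R] t r z.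
  move=> tT r0; apply: (derive1_near (iterated_d_r sO dG [::] r z tT)).
  by near=> y; rewrite gE // ltW //; near: y; exact: near_pos.
have Dz t r z : lifespan T t -> 0 < r -> d_z (g t) r z = it G [:: dir_z R] t r z.
  move=> tT r0; apply: (derive1_near (iterated_d_z sO dG [::] r z tT)).
  by near=> y; rewrite gE // ltW.
have Drr t r z : lifespan T t -> 0 < r ->
    d_r (d_r (g t)) r z = it G [:: dir_r R; dir_r R] t r z.
  move=> tT r0; apply: (derive1_near (iterated_d_r sO dG [:: dir_r R] r z tT)).
  by near=> y; rewrite Dr //; near: y; exact: near_pos.
have Dzz t r z : lifespan T t -> 0 < r ->
    d_z (d_z (g t)) r z = it G [:: dir_z R; dir_z R] t r z.
  move=> tT r0; apply: (derive1_near (iterated_d_z sO dG [:: dir_z R] r z tT)).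
  by near=> y; rewrite Dz.
have Dt t r z : 0 < t -> lifespan T t -> 0 < r -> d_t g t r z = it G [:: dir_t R] t r z.
  move=> t0 tT r0; apply: (derive1_near (iterated_d_t sO dG [::] r z tT)).
  near=> s; rewrite gE //; last exact: ltW.
  by have [] : 0 < s /\ lifespan T s by near: s; exact: lifespan_near.
exists (it G [::]), (it G [:: dir_r R]), (it G [:: dir_z R]),
  (it G [:: dir_r R; dir_r R]), (it G [:: dir_z R; dir_z R]),
  (it A [::]), (it A [:: dir_r R]), (it B [::]), (it B [:: dir_z R]), (it G [:: dir_t R]).
split => [//|t r z tT r0|t r z tT|tau tau0 tauT]; first by rewrite Dr // Dz.
  exact: (iterated_d_t sO dG [::] r z tT).
have [C HC] := dec _ tauT; exists C => t t_tau.
have tT : lifespan T t := lifespan_ltW t_tau tauT.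
have T_0 : lifespan T 0 by apply: lifespan_ltW tauT; rewrite lexx ltW.
have cts F OF vs r z (sOF : spacetime T `<=` OF)
    (dF : forall vs x, OF x -> differentiable (iterated F vs) x) :
    it F vs s r z @[s --> (0 : R)] --> it F vs 0 r z.
  exact: (iterated_continuous_t sOF dF).
have near0 : \forall s \near (0 : R)^'+, 0 < s /\ s <= tau.
  near=> s; split; first by near: s; exact: nbhs_right_gt.
  by near: s; exact: nbhs_right_le.
split => [r z|r z|r z|r z|r z|r z| | | | | | | | | | |r z r0|r z r0|r z r0].
- exact: (iterated_d_r sO dG [::]).
- exact: (iterated_d_z sO dG [::]).
- exact: (iterated_d_r sO dG [:: dir_r R]).
- exact: (iterated_d_z sO dG [:: dir_z R]).
- exact: (iterated_d_r sO2 dA [::]).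
- exact: (iterated_d_z sO3 dB [::]).
- exact: (iterated_continuous2 sO dG).
- exact: (iterated_continuous2 sO dG).
- exact: (iterated_continuous2 sO dG).
- exact: (iterated_continuous2 sO dG).
- exact: (iterated_continuous2 sO dG).
- exact: (iterated_continuous2 sO2 dA).
- exact: (iterated_continuous2 sO2 dA).
- exact: (iterated_continuous2 sO3 dB).
- exact: (iterated_continuous2 sO3 dB).
- exact: (iterated_continuous2 sO dG).
(* E is the residual of the equation; it vanishes at positive times and is continuous at 0. *)
- pose E s := nu * (it G [:: dir_r R; dir_r R] s r z + 3 / r * it G [:: dir_r R] s r z
      + it G [:: dir_z R; dir_z R] s r z)
    - (it G [:: dir_t R] s r z + (it A [::] s r z * it G [:: dir_r R] s r z
                                  + it B [::] s r z * it G [:: dir_z R] s r z)).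
  have Epos s : 0 < s -> s <= tau -> E s = 0.
    move=> s0 st; have sT : lifespan T s by apply: lifespan_ltW tauT; rewrite st ltW.
    have := pde s r z s0 sT.2 r0; rewrite /laplace5 Dt // Dr // Dz // Drr // Dzz //.
    by rewrite urE // uzE ?(ltW r0) // /E => ->; rewrite subrr.
  suff : E t = 0 by rewrite /E => /eqP; rewrite subr_eq0 => /eqP ->.
  have [t0|t0] := leP t 0; last by case/andP: t_tau => _; exact: Epos.
  have -> : t = 0 by apply/eqP; rewrite eq_le t0; case/andP: t_tau.
  have cE : {for 0, continuous E}.
    have c1 := cts G U1 [:: dir_r R; dir_r R] r z sO dG.
    have c2 := cts G U1 [:: dir_r R] r z sO dG.
    have c3 := cts G U1 [:: dir_z R; dir_z R] r z sO dG.
    have c4 := cts G U1 [:: dir_t R] r z sO dG.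
    have c5 := cts A U2 [::] r z sO2 dA.
    have c6 := cts G U1 [:: dir_z R] r z sO dG.
    have c7 := cts B U3 [::] r z sO3 dB.
    by rewrite /prop_for /continuous_at /E; cbv beta; clearbody it; limits.
  apply/eqP; rewrite eq_le; apply/andP; split.
    rewrite -oppr_ge0; apply: (@ge0_limit0 (fun s => - E s)); first exact: cvgN.
    by near=> s; rewrite Epos ?oppr0 //; have [] : 0 < s /\ s <= tau by near: s.
  apply: ge0_limit0 => //.
  by near=> s; rewrite Epos //; have [] : 0 < s /\ s <= tau by near: s.
- have := dv t r z tT r0; rewrite /d_r /d_z.
  have d1 : derive1 (fun r' => r' * ur t r' z) r =
      1 * it A [::] t r z + r * it A [:: dir_r R] t r z.
    have dd := is_derive_mul (is_derive_id r 1) (iterated_d_r sO2 dA [::] r z tT).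
    apply: (derive1_near dd).
    by near=> y; rewrite urE //; near: y; exact: near_pos.
  have d2 : derive1 (fun z' => r * uz t r z') z = 0 * it B [::] t r z + r * it B [:: dir_z R] t r z.
    have dd := is_derive_mul (is_derive_cst r z 1) (iterated_d_z sO3 dB [::] r z tT).
    by apply: (derive1_near dd); near=> y; rewrite uzE // ltW.
  by rewrite d1 d2 mul1r mul0r add0r.
(* E is now the margin in the decay bound, nonnegative at positive times and continuous at 0. *)
pose E s := C / (1 + r ^+ 2 + z ^+ 2) ^+ 2 - ((1 + `|it A [::] s r z| + `|it B [::] s r z|)
    * `|it G [::] s r z| + `|it G [:: dir_t R] s r z|).
rewrite -subr_ge0 -/(E t).
have Epos s : 0 < s -> s <= tau -> 0 <= E s.
  move=> s0 st; have sT : lifespan T s by apply: lifespan_ltW tauT; rewrite st ltW.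
  by have := HC s r z s0 st r0; rewrite urE // uzE ?(ltW r0) // gE ?(ltW r0) // Dt // /E subr_ge0.
have [t0|t0] := leP t 0; last by case/andP: t_tau => _; exact: Epos.
have -> : t = 0 by apply/eqP; rewrite eq_le t0; case/andP: t_tau.
apply: ge0_limit0; last first.
  by near=> s; apply: Epos; have [] : 0 < s /\ s <= tau by near: s.
have c1 := cts A U2 [::] r z sO2 dA.
have c2 := cts B U3 [::] r z sO3 dB.
have c3 := cts G U1 [::] r z sO dG.
have c4 := cts G U1 [:: dir_t R] r z sO dG.
by rewrite /prop_for /continuous_at /E; cbv beta; clearbody it; limits.
Unshelve. all: end_near. Qed.

End Slicing.

(** * Evolution of the energies and contraction *)

Section TimeDerivative.
Variable R : realType.
Local Notation mu := (@lebesgue_measure R).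
Local Notation plane := (measurableTypeR R * measurableTypeR R)%type.

Lemma integrable_le_weight (f : R -> R -> R) (K : R) : continuous2 f ->
  (forall r z, 0 < r -> `|f r z| <= K * weight r z) ->
  (area R).-integrable (@halfplane R) (fun x => (f x.1 x.2)%:E).
Proof.
move=> cf fK; have mH := @measurable_halfplane R.
apply: (le_integrable mH _ _ (integrableZl mH K (@integrable_weight R))).
  apply/measurable_EFinP; apply: (@measurable_funTS _ _ plane).
  exact: continuous_measurable_plane cf.
move=> [r z] r0 /=; rewrite lee_fin; apply: le_trans (fK r z r0) _; exact: ler_norm.
Qed.

(** Dominated convergence speaks of sequences, so the limit along a filter is reduced to sequences.
    They may be kept within delta of t, where the decay constant is uniform. *)
Lemma cvg_within_seq (D : set R) (t l delta : R) (F : R -> R) : 0 < delta ->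
  (forall u : nat -> R, (forall n, D (u n)) -> (forall n, `|u n - t| < delta) ->
     u n @[n --> \oo] --> t -> F (u n) @[n --> \oo] --> l) ->
  F @ within D (nbhs t) --> l.
Proof.
move=> d0 H; apply/cvgrPdist_lt => e e0; apply: contrapT => nnear.
have ex n : exists s : R, [/\ D s, `|s - t| < delta, `|s - t| < n.+1%:R^-1
    & e <= `|l - F s|].
  apply: contrapT => nex; apply: nnear; rewrite near_withinE.
  apply/nbhs_ballP; exists (Num.min delta n.+1%:R^-1).
    by rewrite /= lt_min d0 invr_gt0 ltr0n.
  move=> s; rewrite /ball /= lt_min distrC => /andP[sd sn] Ds.
  by rewrite ltNge; apply/negP => ?; apply: nex; exists s.
have [u Hu] := choice ex.
have ut : u n @[n --> \oo] --> t.
  apply/cvgrPdist_lt => e' e'0; near=> n; rewrite distrC.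
  have [_ _ un _] := Hu n; apply: lt_trans un _.
  rewrite invf_plt ?posrE //; near: n; exists (Num.truncn e'^-1) => // n /= nn.
  by apply: lt_le_trans (truncnS_gt _) _; rewrite ler_nat ltnS.
have := H u (fun n => let: And4 a _ _ _ := Hu n in a) (fun n => let: And4 _ a _ _ := Hu n in a) ut.
move=> /cvgrPdist_lt /(_ e e0) [n _ /(_ n (leqnn n))] /=.
by have [_ _ _] := Hu n; rewrite leNgt => /negP.
Unshelve. all: end_near. Qed.

Lemma difference_quotient_le (f f' : R -> R) (x y K : R) : x != y ->
  (forall s, Num.min x y <= s <= Num.max x y -> is_derive s 1 f (f' s) /\ `|f' s| <= K) ->
  `|(f y - f x) / (y - x)| <= K.
Proof.
wlog xy : x y / x < y => [H|] xNy fK.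
  have [?|?|xy] := ltgtP x y; [exact: H|  |by rewrite xy eqxx in xNy].
  rewrite -(opprB (f x)) -(opprB x) invrN mulrNN; apply: H => //; first by rewrite eq_sym.
  by move=> s; rewrite minC maxC; exact: fK.
have fd s : x <= s <= y -> is_derive s 1 f (f' s).
  by move=> xsy; apply: (fK s _).1; rewrite min_l ?max_r // ltW.
have [||c cxy ->] := @MVT R f f' x y xy.
- by move=> s; rewrite in_itv /= => /andP[? ?]; apply: fd; rewrite !ltW.
- apply: continuous_in_subspaceT => s /set_mem /=; rewrite in_itv /= => /fd d.
  by apply: differentiable_continuous; apply/derivable1_diffP; case: d.
rewrite mulfK ?subr_eq0 1?eq_sym //; apply: (fK c _).2.
move: cxy; rewrite in_itv /= min_l ?max_r ?(ltW xy) // => /andP[? ?].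
by rewrite !ltW.
Qed.

Lemma cvg_difference_quotient (f : R -> R) (t l : R) (u : nat -> R) :
  is_derive t 1 f l -> (forall n, u n != t) -> u n @[n --> \oo] --> t ->
  (f (u n) - f t) / (u n - t) @[n --> \oo] --> l.
Proof.
move=> [fd fl] unt ut.
have c : h^-1 *: (f (h *: (1 : R) + t) - f t) @[h --> (0 : R)^'] --> l by rewrite -fl.
have v : (fun n => u n - t) @ \oo --> (0 : R)^'.
  move=> A /= /nbhs_ballP[e /= e0 eA].
  have := (cvgrPdist_lt _ _).1 ut e e0 => near_e.
  change (\forall n \near \oo, A (u n - t)); near=> n.
  apply: (eA (u n - t)); last by rewrite /= subr_eq0.
  by rewrite /ball /= sub0r normrN distrC; near: n; exact: near_e.
have := cvg_comp _ _ v c; apply: cvg_trans; apply: near_eq_cvg; apply: nearW => n /=.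
by rewrite /GRing.scale /= mulr1 subrK mulrC.
Unshelve. all: end_near. Qed.

End TimeDerivative.

Section EnergyEvolution.
Variable R : realType.
Local Notation mu := (@lebesgue_measure R).
Local Notation plane := (measurableTypeR R * measurableTypeR R)%type.

Section SliceEnergy.
Variables (nu C : R) (g gr gz grr gzz a ar b bz h : R -> R -> R).
Hypothesis S : slice nu C g gr gz grr gzz a ar b bz h.
Variable p : R.
Hypothesis p1 : 1 < p.

Lemma slice_abs_powR_continuous2 : continuous2 (fun r z => `|g r z| `^ p).
Proof.
apply: (@continuous_compose _ _ (fun s => `|s| `^ p) (fun x => g x.1 x.2)); last exact: slice_cg S.
apply: continuous_abs_powR.
by rewrite ltW // (lt_trans ltr01).
Qed.

Lemma slice_abs_powR_le r z : 0 < r -> `|g r z| `^ p <= C `^ (p - 1) * `|g r z|.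
Proof.
move=> r0; rewrite -(mulr_powRB1 (normr_ge0 _) (lt_trans ltr01 p1)) mulrC ler_wpM2r //.
apply: ge0_ler_powR; rewrite ?nnegrE ?subr_ge0 ?(ltW p1) //.
  exact: slice_C_ge0 S.
exact: (slice_g_le S z r0).
Qed.

Lemma slice_energy_integrable :
  (area R).-integrable (@halfplane R) (fun x => (`|g x.1 x.2| `^ p * x.1)%:E).
Proof.
apply: (@integrable_le_weight R (fun r z => `|g r z| `^ p * r) (C `^ (p - 1) * C)).
  by apply: continuous_mul slice_abs_powR_continuous2 _; exact: continuous_fst_real.
move=> r z r0; rewrite normrM (gtr0_norm r0) ger0_norm ?powR_ge0 //.
have [bg _ _] := slice_bounds S z r0; rewrite -mulrA.
apply: le_trans (ler_wpM2l (powR_ge0 _ _) bg); rewrite mulrA ler_wpM2r ?(ltW r0) //.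
exact: slice_abs_powR_le.
Qed.

End SliceEnergy.

Variables (nu : R) (T : \bar R) (ge gr gz grr gzz a ar b bz h : R -> R -> R -> R).
Hypothesis ge_t : forall t r z, lifespan T t -> is_derive t 1 (fun s => ge s r z) (h t r z).
Hypothesis slices : forall tau, 0 < tau -> lifespan T tau -> exists C, forall t, 0 <= t <= tau ->
  slice nu C (ge t) (gr t) (gz t) (grr t) (gzz t) (a t) (ar t) (b t) (bz t) (h t).


(** The lifespan is open on the right, so t lies in some [0, t + delta] with delta > 0; this gives a
    decay constant valid also slightly after t, including at t = 0. *)
Lemma lifespan_room t : lifespan T t -> exists2 delta, 0 < delta & lifespan T (t + delta).
Proof.
move=> [t0]; case: T => [u| |] //=; last by exists 1 => //; split; rewrite ?addr_ge0 // ltry.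
rewrite lte_fin => tu; exists ((u - t) / 2); first by rewrite divr_gt0 ?subr_gt0.
split; first by rewrite addr_ge0 // divr_ge0 // subr_ge0 ltW.
by rewrite lte_fin -ltrBrDl ltr_pdivrMr // mulr_natr mulr2n ltrDl subr_gt0.
Qed.

(** Differentiation under the integral: the mean value theorem in time bounds the difference
    quotients by p C^(p - 1) |h| r, and the decay of h = d_t g makes this integrable uniformly in
    time. *)
Lemma energy_derivative p t : 1 < p -> lifespan T t ->
  derivative_on_lifespan T
      (fun s => \int[area R]_(x in @halfplane R) (`|ge s x.1 x.2| `^ p * x.1)) t
    (\int[area R]_(x in @halfplane R)
      (p * (`|ge t x.1 x.2| `^ (p - 2) * ge t x.1 x.2) * h t x.1 x.2 * x.1)).
Proof.
move=> p1 tT; have [delta d0 dT] := lifespan_room tT.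
have tau0 : 0 < t + delta by apply: ltr_wpDl d0; case: tT.
have [C S] := slices tau0 dT.
have St : 0 <= t <= t + delta by rewrite tT.1 lerDl ltW.
have C0 := slice_C_ge0 (S t St).
have inT s : 0 <= s <= t + delta -> lifespan T s by move=> ?; exact: lifespan_ltW dT.
have mH := @measurable_halfplane R.
apply: (cvg_within_seq d0) => u uD ud ut.
have uS n : 0 <= u n <= t + delta.
  have [[u0 _] _] := uD n; rewrite u0 /=; have := ud n; rewrite ltr_norml => /andP[_ ?].
  by rewrite addrC -lerBlDr ltW.
have uNt n : u n != t by have [] := uD n.
pose phi (t r z : R) := p * (`|ge t r z| `^ (p - 2) * ge t r z) * h t r z.
have dphi s (r z : R) : lifespan T s -> is_derive s 1 (fun s => `|ge s r z| `^ p) (phi s r z).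
  move=> sT; apply: (@is_derive_compose _ (fun x => `|x| `^ p) (fun s => ge s r z)).
    exact: is_derive_abs_powR.
  exact: ge_t.
pose q n r z := (`|ge (u n) r z| `^ p - `|ge t r z| `^ p) / (u n - t) * r.
have cq n : continuous2 (q n).
  have c1 := slice_abs_powR_continuous2 (S _ (uS n)) p1.
  have c2 := slice_abs_powR_continuous2 (S _ St) p1.
  apply: continuous_mul; last exact: continuous_fst_real.
  apply: continuous_mul; last exact: continuous_const.
  by apply: continuous_add c1 _; exact: continuous_opp.
pose K := p * C `^ (p - 1).
have qK n r z : 0 < r -> `|q n r z| <= K * C * weight r z.
  move=> r0; rewrite /q normrM (gtr0_norm r0) -(ler_pdivlMr _ _ r0).
  apply: (@difference_quotient_le R (fun s => `|ge s r z| `^ p) (fun s => phi s r z)).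
    by rewrite eq_sym.
  move=> s /andP[s1 s2].
  have s0 : 0 <= s <= t + delta.
    have /andP[u1 u2] := uS n; have /andP[t1 t2] := St.
    apply/andP; split; first by apply: le_trans s1; rewrite le_min t1.
    by apply: le_trans s2 _; rewrite ge_max t2.
  split; first exact/dphi/inT.
  rewrite ler_pdivlMr // /phi normrM -[leLHS]mulrA -[leRHS]mulrA; apply: ler_pM => //.
  - by rewrite mulr_ge0 // ltW.
  - by apply: abs_powR_mul_le p1 _; exact: (slice_g_le (S s s0) z r0).
  - by have [] := slice_bounds (S s s0) z r0.
have iW : (area R).-integrable (@halfplane R) (fun x => (K * C)%:E * (weight x.1 x.2)%:E)%E.
  exact: integrableZl (@integrable_weight R).
have mq n : measurable_fun (@halfplane R : set plane) (fun x => (q n x.1 x.2)%:E).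
  apply/measurable_EFinP; apply: (@measurable_funTS _ _ plane).
  exact: continuous_measurable_plane (cq n).
have q_lim (x : R * R) : @halfplane R x ->
    (q n x.1 x.2)%:E @[n --> \oo] --> (phi t x.1 x.2 * x.1)%:E.
  move=> x0; apply: cvg_EFin; first exact: nearW.
  apply: limit_mul; last exact: cvg_cst.
  exact: (@cvg_difference_quotient R (fun s => `|ge s x.1 x.2| `^ p) t _ u (dphi _ _ _ tT)).
have [|||||i _ c] := @dominated_convergence _ plane R (area R) (@halfplane R) mH
  (fun n x => (q n x.1 x.2)%:E) (fun x => (phi t x.1 x.2 * x.1)%:E)
  (fun x => (K * C)%:E * (weight x.1 x.2)%:E)%E.
- exact: mq.
- by apply: emeasurable_fun_cvg mq _ => x x0; exact: q_lim.
- by apply: aeW => x; exact: q_lim.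
- exact: iW.
- by apply: aeW => -[r z] n r0; rewrite -EFinM lee_fin; exact: qK.
move: c => /=; rewrite -[X in _ --> X]fineK; last exact: integrable_fin_num.
move=> /fine_cvgP[_]; apply: cvg_trans; apply: near_eq_cvg; near=> n => /=.
have i1 := slice_energy_integrable (S _ (uS n)) p1.
have i2 := slice_energy_integrable (S _ St) p1.
rewrite -RintegralB // mulrC -RintegralZl //; last exact: (integrableB mH i1 i2).
by apply: eq_Rintegral => x _; rewrite /q; ring.
Unshelve. all: end_near. Qed.

End EnergyEvolution.

Section DerivativeOnLifespan.
Variable R : realType.
Implicit Types (T : \bar R) (F : R -> R) (t l : R).

Lemma derivative_on_lifespan_continuous T F t l : derivative_on_lifespan T F t l ->
  F @ within (lifespan T) (nbhs t) --> F t.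
Proof.
move=> /cvgrPdist_lt /(_ 1 ltr01); rewrite near_withinE => dF.
apply/cvgrPdist_lt => e e0; rewrite near_withinE; near=> s => sT.
have [->|st] := eqVneq s t; first by rewrite subrr normr0.
have q1 : lifespan T s /\ s != t -> `|l - (F s - F t) / (s - t)| < 1 by near: s; exact: dF.
have {}q1 := q1 (conj sT st); have st0 : 0 < `|s - t| by rewrite normr_gt0 subr_eq0.
have qb : `|(F s - F t) / (s - t)| < `|l| + 1.
  rewrite -ltrBlDl; apply: le_lt_trans q1; rewrite distrC; exact: lerB_dist.
rewrite distrC -(divfK (_ : s - t != 0) (F s - F t)) ?subr_eq0 // normrM.
apply: lt_trans (_ : (`|l| + 1) * `|s - t| < _); first by rewrite ltr_pM2r.
rewrite -ltr_pdivlMl; last by rewrite ltr_wpDl.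
rewrite distrC; near: s; apply/nbhs_ballP; exists ((`|l| + 1)^-1 * e) => //=.
by rewrite mulr_gt0 // invr_gt0 ltr_wpDl.
Unshelve. all: end_near. Qed.

(** Around a positive time the lifespan is a full neighbourhood, so the restriction in the limit
    disappears. *)
Lemma derivative_on_lifespan_is_derive T F t l : 0 < t -> lifespan T t ->
  derivative_on_lifespan T F t l -> is_derive t 1 F l.
Proof.
move=> t0 tT dF.
have c : h^-1 *: (F (h *: (1 : R) + t) - F t) @[h --> (0 : R)^'] --> l.
  have v : (fun h : R => h + t) @ (0 : R)^' --> within [set s | lifespan T s /\ s != t] (nbhs t).
    move=> A; rewrite /within /= => nA.
    have nA' : \forall h \near (0 : R), lifespan T (h + t) /\ h + t != t -> A (h + t).
      have ct : (fun h : R => h + t) @ (0 : R) --> t.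
        rewrite -[X in _ --> X]add0r; apply: limit_add; [exact: cvg_id|exact: cvg_cst].
      exact: ct nA.
    have lT : \forall h \near (0 : R), lifespan T (h + t).
      have ct : (fun h : R => h + t) @ (0 : R) --> t.
        rewrite -[X in _ --> X]add0r; apply: limit_add; [exact: cvg_id|exact: cvg_cst].
      have n2 : \forall s \near t, lifespan T s.
        by apply: filterS (lifespan_near t0 tT) => s [].
      exact: ct n2.
    change (\forall h \near (0 : R)^', A (h + t)); near=> h.
    have h0 : h != 0 by near: h; exact: nbhs_dnbhs_neq.
    have hT : lifespan T (h + t) by near: h; exact: nbhs_dnbhs.
    have : lifespan T (h + t) /\ h + t != t -> A (h + t) by near: h; exact: nbhs_dnbhs.
    by apply; split => //; rewrite -subr_eq0 addrK.
  have := cvg_comp _ _ v dF; apply: cvg_trans; apply: near_eq_cvg; near=> h => /=.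
  by rewrite /GRing.scale /= mulr1 addrK mulrC.
apply: DeriveDef; first by apply/cvg_ex; exists l; exact: c.
by rewrite /derive; apply/cvg_lim.
Unshelve. all: end_near. Qed.

(** The sign of the derivative is used on the open interval; at the end point 0 the one-sided
    derivative contributes continuity. *)
Lemma derivative_on_lifespan_nonincreasing T F dF t : lifespan T t ->
  (forall s, lifespan T s -> derivative_on_lifespan T F s (dF s)) ->
  (forall s, lifespan T s -> dF s <= 0) -> F t <= F 0.
Proof.
move=> tT FdF dF0; have [t0 _] := tT.
have inT s : 0 <= s <= t -> lifespan T s by move=> ?; exact: lifespan_ltW tT.
have d s : s \in `]0, t[ -> is_derive s 1 F (dF s).
  rewrite in_itv /= => /andP[s0 st]; have sT : lifespan T s by apply: inT; rewrite !ltW.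
  exact: derivative_on_lifespan_is_derive (FdF s sT).
apply: (@ler0_derive1_nincr R F 0 t) => //.
- by move=> s /d [].
- by move=> s sI; have ds := d s sI; rewrite derive1E derive_val dF0 //; apply: inT;
    move: sI; rewrite in_itv /= => /andP[? ?]; rewrite !ltW.
apply/subspace_continuousP => s /=; rewrite in_itv /= => st.
apply: cvg_trans (derivative_on_lifespan_continuous (FdF s (inT s st))).
apply: cvg_app; apply: within_subset => r /=; rewrite in_itv /=; exact: inT.
Qed.

End DerivativeOnLifespan.

(** * Norms recovered from energies *)

Section PowerLimits.
Variable R : realType.

(** Dividing by m^n leaves K (M / m)^n, which tends to 0. This is how a supremum is read off from
    the growth of the energies. *)
Lemma geometric_domination (m M c K : R) : 0 <= M -> M < m ->
  (forall n, c * m ^+ n <= K * M ^+ n) -> c <= 0.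
Proof.
move=> M0 Mm H; have m0 : 0 < m by exact: le_lt_trans Mm.
have x0 : 0 <= M / m by rewrite divr_ge0 // ltW.
have x1 : `|M / m| < 1 by rewrite ger0_norm // ltr_pdivrMr // mul1r.
apply: (@ler_cvg_to _ \oo _ _ (fun _ => c) (fun n => K * (M / m) ^+ n)).
- exact: cvg_cst.
- by rewrite -(mulr0 K); apply: limit_mul; [exact: cvg_cst|exact: cvg_expr].
- by apply: nearW => n; rewrite expr_div_n mulrA ler_pdivlMr ?exprn_gt0.
Qed.

Lemma cvg_powR_exponent1 (x : R) : 0 <= x ->
  x `^ (1 + harmonic n) @[n --> \oo] --> x.
Proof.
rewrite le_eqVlt => /predU1P[<-|x0].
  rewrite (_ : (fun _ => _) = cst 0); first exact: cvg_cst.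
  by apply/funext => n; rewrite powR0 // gt_eqF // ltr_pwDl // invr_ge0.
rewrite -[X in _ --> X](lnK (x := x)) ?posrE // -[X in expR X]mul1r -[X in X * _]addr0.
rewrite (_ : (fun _ => _) = (fun n => expR ((1 + harmonic n) * ln x))); last first.
  by apply/funext => n; rewrite /powR gt_eqF.
apply: (cvg_comp (fun n => (1 + harmonic n) * ln x) expR _ (@continuous_expR R _)).
apply: limit_mul; last exact: cvg_cst.
by apply: limit_add; [exact: cvg_cst|exact: cvg_harmonic].
Qed.

End PowerLimits.

Section SliceNorms.
Variable R : realType.
Local Notation mu := (@lebesgue_measure R).
Local Notation plane := (measurableTypeR R * measurableTypeR R)%type.
Variables (nu C : R) (g gr gz grr gzz a ar b bz h : R -> R -> R).
Hypothesis S : slice nu C g gr gz grr gzz a ar b bz h.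

Lemma slice_abs_continuous2 : continuous2 (fun r z => `|g r z|).
Proof.
move=> x; apply: (@continuous_comp _ _ _ (fun x => g x.1 x.2) (@Num.norm R R)).
  exact: slice_cg S x.
exact: norm_continuous.
Qed.

Lemma slice_norm1_integrable :
  (area R).-integrable (@halfplane R) (fun x => (`|g x.1 x.2| * x.1)%:E).
Proof.
apply: (@integrable_le_weight R (fun r z => `|g r z| * r) C).
  by apply: continuous_mul slice_abs_continuous2 _; exact: continuous_fst_real.
move=> r z r0; rewrite normrM normr_id (gtr0_norm r0).
by have [] := slice_bounds S z r0.
Qed.

(** The exponents 1 + 1/(n + 1) decrease to 1 while staying above 1, where the energy identity is
    available. *)
Lemma cvg_energy_norm1 :
  \int[area R]_(x in @halfplane R) (`|g x.1 x.2| `^ (1 + harmonic n) * x.1) @[n --> \oo] -->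
  \int[area R]_(x in @halfplane R) (`|g x.1 x.2| * x.1).
Proof.
have C0 := slice_C_ge0 S; have mH := @measurable_halfplane R.
have p1 n : 1 < 1 + harmonic n :> R by rewrite ltrDl invr_gt0 ltr0n.
have iW : (area R).-integrable (@halfplane R)
    (fun x => ((1 + C) * C)%:E * (weight x.1 x.2)%:E)%E.
  exact: integrableZl (@integrable_weight R).
pose q n (x : R * R) := `|g x.1 x.2| `^ (1 + harmonic n) * x.1.
have mq n : measurable_fun (@halfplane R : set plane) (fun x => (q n x)%:E).
  by have /integrableP[] := slice_energy_integrable S (p1 n).
have q_lim (x : R * R) : @halfplane R x -> (q n x)%:E @[n --> \oo] --> (`|g x.1 x.2| * x.1)%:E.
  move=> x0; apply: cvg_EFin; first exact: nearW.
  by apply: limit_mul; [exact: cvg_powR_exponent1|exact: cvg_cst].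
have [|||||i _ c] := @dominated_convergence _ plane R (area R) (@halfplane R) mH
  (fun n x => (q n x)%:E) (fun x => (`|g x.1 x.2| * x.1)%:E)
  (fun x => ((1 + C) * C)%:E * (weight x.1 x.2)%:E)%E.
- exact: mq.
- by have /integrableP[] := slice_norm1_integrable.
- by apply: aeW => x; exact: q_lim.
- exact: iW.
- apply: aeW => -[r z] n r0; rewrite -EFinM lee_fin /q /=.
  have [bg _ _] := slice_bounds S z r0.
  rewrite ger0_norm ?mulr_ge0 ?powR_ge0 ?(ltW r0) //.
  apply: le_trans (_ : C `^ (1 + harmonic n - 1) * (`|g r z| * r) <= _).
    rewrite mulrA ler_wpM2r ?(ltW r0) //; exact: (slice_abs_powR_le S (p1 n) z r0).
  rewrite -mulrA; apply: ler_pM => //; rewrite ?powR_ge0 ?mulr_ge0 ?(ltW r0) //.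
  (* The exponent is now p - 1 in (0, 1], so C^(p - 1) is at most C or at most 1, hence at most 1 +
     C. *)
  rewrite addrAC subrr add0r; have [C1|C1] := leP 1 C.
    apply: le_trans (ler1_powR C1 _) _; last by rewrite lerDr.
    by rewrite invf_le1 ?ltr0n // ler1n.
  apply: le_trans (_ : 1 <= _); last by rewrite lerDl.
  have := @ge0_ler_powR R (harmonic n) (ltW (harmonic_gt0 n)) C 1.
  by rewrite powR1 !nnegrE; apply => //; exact: ltW.
move: c => /=; rewrite -[X in _ --> X]fineK; last exact: integrable_fin_num.
by move=> /fine_cvgP[_].
Qed.

(** Integer exponents n + 2 stay above 1 and turn the comparison of energies into one of geometric
    sequences. *)
Lemma energy_le_sup (M : R) n : (forall r z, 0 < r -> `|g r z| <= M) ->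
  \int[area R]_(x in @halfplane R) (`|g x.1 x.2| `^ n.+2%:R * x.1) <=
  M ^+ n.+1 * \int[area R]_(x in @halfplane R) (`|g x.1 x.2| * x.1).
Proof.
move=> gM; have mH := @measurable_halfplane R.
have p1 : 1 < n.+2%:R :> R by rewrite ltr1n.
rewrite -RintegralZl //; last exact: slice_norm1_integrable.
apply: le_Rintegral => //.
- exact: (slice_energy_integrable S p1).
- have := integrableZl mH (M ^+ n.+1) slice_norm1_integrable.
  by apply: eq_integrable.
move=> [r z] r0 /=; rewrite powR_mulrn // exprSr -mulrA.
by apply: ler_wpM2r; rewrite ?mulr_ge0 ?(ltW r0) // lerXn2r ?nnegrE ?gM // (le_trans _ (gM r z r0)).
Qed.

(* A value above m on a neighbourhood of (r0, z0) makes the energies grow like m^p. *)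
Lemma energy_ge_local (m r0 z0 : R) : 0 < r0 -> 0 <= m -> m < `|g r0 z0| ->
  exists2 c, 0 < c & forall n, c * m ^+ n.+2 <=
    \int[area R]_(x in @halfplane R) (`|g x.1 x.2| `^ n.+2%:R * x.1).
Proof.
move=> r00 m0 mg; have mH := @measurable_halfplane R.
have cg : `|g x.1 x.2| @[x --> (r0, z0)] --> `|g r0 z0| := @slice_abs_continuous2 (r0, z0).
have near_m : \forall x \near (r0, z0), m < `|g x.1 x.2|.
  move/cvgrPdist_lt : cg => /(_ (`|g r0 z0| - m)); rewrite subr_gt0 => /(_ mg).
  by apply: filterS => x; rewrite ltr_norml => /andP[_]; rewrite ltrD2l ltrN2.
have /nbhs_ballP[e /= e0 eB] := near_m.
(* The first bound keeps the square inside the neighbourhood, the second keeps r >= r0 / 2 on it. *)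
pose d := Num.min (e / 2) (r0 / 2).
have d0 : 0 < d by rewrite lt_min !divr_gt0.
have dr : d <= r0 / 2 by rewrite ge_min lexx orbT.
have de : d < e by rewrite gt_min ltr_pdivrMr // mulr_natr mulr2n ltrDl e0.
pose Q : set plane := `[r0 - d, r0 + d] `*` `[z0 - d, z0 + d].
have mQ : measurable Q by apply: measurableX; exact: measurable_itv.
have QH : Q `<=` @halfplane R.
  by move=> [r z] [/= + _]; rewrite in_itv /= => /andP[? _]; rewrite /halfplane /=; lra.
have Qm r z : Q (r, z) -> r0 / 2 <= r /\ m <= `|g r z|.
  move=> [/=]; rewrite !in_itv /= => /andP[? ?] /andP[? ?]; split; first by lra.
  apply/ltW/(eB (r, z)); split; rewrite /ball /= ltr_norml; apply/andP; split; lra.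
have aQ : (area R) Q = (4 * d ^+ 2)%:E.
  rewrite /Q; change ((mu \x mu) (`[(r0 - d)%R, (r0 + d)%R] `*` `[(z0 - d)%R, (z0 + d)%R]) = (4 * d ^+ 2)%:E)%E.
  rewrite product_measure1E /=; [|exact: measurable_itv..].
  rewrite !lebesgue_measure_itv /= !lte_fin !ifT -?EFinD -?EFinM; [|lra..].
  by congr EFin; ring.
exists (r0 / 2 * (4 * d ^+ 2)); first by rewrite !mulr_gt0 ?invr_gt0 ?exprn_gt0.
move=> n; have p1 : 1 < n.+2%:R :> R by rewrite ltr1n.
have iE := slice_energy_integrable S p1.
rewrite -lee_fin -[leRHS]/((fine _)%:E) fineK; last exact: integrable_fin_num.
apply: (@le_trans _ _ (\int[area R]_(x in Q) (`|g x.1 x.2| `^ n.+2%:R * x.1)%:E)%E); last first.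
  apply: ge0_subset_integral => //; first by case/integrableP: iE.
  by move=> x x0; rewrite lee_fin mulr_ge0 ?powR_ge0 // ltW.
rewrite mulrAC EFinM -aQ.
rewrite -integral_cst //; apply: ge0_le_integral => //.
- by move=> x _; rewrite lee_fin mulr_ge0 ?exprn_ge0 // divr_ge0 // ltW.
- by case/integrableP: iE => + _; apply: measurable_funS.
move=> [r z] rz; have [rr gm] := Qm r z rz; rewrite lee_fin /= mulrC powR_mulrn //.
apply: ler_pM => //; rewrite ?exprn_ge0 ?divr_ge0 ?(ltW r00) //.
by rewrite lerXn2r ?nnegrE.
Qed.

End SliceNorms.

(** * The Biot-Savart bound *)

Section TrigonometricBounds.
Variable R : realType.
Implicit Types x : R.

(** Applied three times starting from cos <= 1, it gives the Taylor bounds below. *)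
Lemma nonneg_of_derive (f f' : R -> R) : (forall x : R, is_derive x 1 f (f' x)) -> f 0 = 0 ->
  (forall x, 0 <= x -> 0 <= f' x) -> forall x, 0 <= x -> 0 <= f x.
Proof.
move=> fd f0 f'0 x x0; have cf := is_derive_continuous fd.
have [|c] := @MVT_segment R f f' 0 x x0 (fun x _ => fd x); first exact: continuous_subspaceT.
by rewrite in_itv /= f0 !subr0 => /andP[c0 _] ->; rewrite mulr_ge0 // f'0.
Qed.

Lemma sin_le x : 0 <= x -> 0 <= x - sin x.
Proof.
have d (y : R) : is_derive y 1 (fun y => y - sin y) (1 - cos y).
  by have := is_derive_sin y => ?; differentiate.
apply: (nonneg_of_derive d); first by rewrite sin0 subr0.
by move=> y _; rewrite subr_ge0 cos_le1.
Qed.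

Lemma cos_ge x : 0 <= x -> 0 <= cos x - 1 + x ^+ 2 / 2.
Proof.
have d (y : R) : is_derive y 1 (fun y => cos y - 1 + y ^+ 2 / 2) (y - sin y).
  by have := is_derive_cos y => ?; differentiate; rewrite /=; field.
apply: (nonneg_of_derive d); first by rewrite cos0 expr0n mul0r addr0 subrr.
exact: sin_le.
Qed.

Lemma sin_ge x : 0 <= x -> 0 <= sin x - x + x ^+ 3 / 6.
Proof.
have d (y : R) : is_derive y 1 (fun y => sin y - y + y ^+ 3 / 6) (cos y - 1 + y ^+ 2 / 2).
  by have := is_derive_sin y => ?; differentiate; rewrite /=; field.
apply: (nonneg_of_derive d); first by rewrite sin0 expr0n mul0r addr0 subrr.
exact: cos_ge.
Qed.

(** With y = x / 2 <= pi / 2 < 2 one has sin y >= y - y^3 / 6 >= y / 3, and 1 - cos x = 2 sin^2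
    y. *)
Lemma one_sub_cos_ge x : 0 <= x <= pi -> x ^+ 2 / 18 <= 1 - cos x.
Proof.
case/andP=> x0 xpi; pose y := x / 2.
have y0 : 0 <= y by rewrite divr_ge0.
have y2 : y <= 2.
  by apply: le_trans (ltW (pihalf_lt2 R)); rewrite ler_pM2r ?invr_gt0.
have sy : y / 3 <= sin y.
  have := sin_ge y0; have : 0 <= y * (4 - y ^+ 2) by rewrite mulr_ge0 //; nra.
  by rewrite (exprS y 2) !expr2 => *; nra.
have -> : cos x = 1 - 2 * sin y ^+ 2.
  have -> : x = y *+ 2 by rewrite /y -mulr_natr divfK.
  have -> : sin y ^+ 2 = 1 - cos y ^+ 2 by rewrite -(cos2Dsin2 y); ring.
  by rewrite cos_mulr2n; ring.
have -> : x = 2 * y by rewrite /y mulrC divfK.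
have : (y / 3) ^+ 2 <= sin y ^+ 2 by rewrite lerXn2r ?nnegrE ?divr_ge0 // (le_trans _ sy) ?divr_ge0.
by rewrite !expr2; nra.
Qed.

End TrigonometricBounds.

(** * The angular integral of the kernel *)

Section AngularKernel.
Variable R : realType.
Local Notation mu := (@lebesgue_measure R).
Variables (r rho s : R).
Hypotheses (r0 : 0 < r) (rho0 : 0 < rho) (s0 : s != 0).

(** Here s stands for z - zeta; q is the squared distance in R^3, D the distance, and sigma its
    value at theta = 0, the distance in the half plane. *)
Let q (theta : R) := r ^+ 2 + rho ^+ 2 - 2 * r * rho * cos theta + s ^+ 2.
Let D theta := Num.sqrt (q theta).
Let sigma := Num.sqrt ((r - rho) ^+ 2 + s ^+ 2).

Let sigma2 : sigma ^+ 2 = (r - rho) ^+ 2 + s ^+ 2.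
Proof. by rewrite sqr_sqrtr // addr_ge0 ?sqr_ge0. Qed.

Let sigma_gt0 : 0 < sigma.
Proof. by rewrite sqrtr_gt0 ltr_wpDl ?sqr_ge0 // exprn_even_gt0. Qed.

Let rrho0 : 0 < r * rho. Proof. exact: mulr_gt0. Qed.

Let qE theta : q theta = sigma ^+ 2 + 2 * (r * rho) * (1 - cos theta).
Proof. by rewrite sigma2 /q; ring. Qed.

Let q_gt0 theta : 0 < q theta.
Proof.
rewrite qE ltr_pwDl ?exprn_gt0 // mulr_ge0 ?subr_ge0 ?cos_le1 //.
by rewrite mulr_ge0 // ltW.
Qed.

Let D_gt0 theta : 0 < D theta. Proof. by rewrite sqrtr_gt0. Qed.
Let D_neq0 theta : D theta != 0. Proof. by rewrite gt_eqF. Qed.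
Let D2 theta : D theta ^+ 2 = q theta. Proof. by rewrite sqr_sqrtr // ltW. Qed.

Let dD (theta : R) : is_derive theta 1 D (r * rho * sin theta / D theta).
Proof.
have dq : is_derive theta 1 q (2 * r * rho * sin theta).
  by have := is_derive_cos theta => ?; rewrite /q; differentiate; rewrite /=; ring.
have dd := is_derive_compose (is_derive1_sqrt (q_gt0 theta)) dq.
apply: (is_derive_eq dd); rewrite -[Num.sqrt (q theta)]/(D theta).
by field; rewrite D_neq0.
Qed.

Let cD : continuous D. Proof. exact: is_derive_continuous dD. Qed.
Let ccos : continuous (@cos R). Proof. exact: continuous_cos. Qed.
Let csin : continuous (@sin R). Proof. exact: continuous_sin. Qed.

Let cDinv n : continuous (fun theta => (D theta ^+ n)^-1).
Proof.
apply: continuous_inv; first by move=> x; rewrite expf_neq0.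
exact: continuous_exp.
Qed.

Let pi2_ge0 : 0 <= 2 * pi :> R. Proof. by rewrite mulr_ge0 // pi_ge0. Qed.

(** The difference of the integrands is the derivative of sin theta / D^3, which is periodic. The
    gain is the explicit factor r rho, in which r compensates the division in U_g. *)
Let int_cos : \int[mu]_(theta in `[0, 2 * pi]) (cos theta / D theta ^+ 3) =
  \int[mu]_(theta in `[0, 2 * pi]) (3 * (r * rho) * (sin theta ^+ 2 / D theta ^+ 5)).
Proof.
have c3 := @cDinv 3; have c5 := @cDinv 5.
have cA : continuous (fun theta => cos theta / D theta ^+ 3) by continuity.
have cB : continuous (fun theta => 3 * (r * rho) * (sin theta ^+ 2 / D theta ^+ 5)).
  by continuity.
apply/eqP; rewrite -subr_eq0 -RintegralB //; [|exact: continuous_itv_integrable..].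
have dI (theta : R) : is_derive theta 1 (fun theta => sin theta / D theta ^+ 3)
    (cos theta / D theta ^+ 3 - 3 * (r * rho) * (sin theta ^+ 2 / D theta ^+ 5)).
  have dd := dD theta; have ds := is_derive_sin theta.
  have dD3 : is_derive theta 1 (fun theta => D theta ^+ 3)
      (3 * D theta ^+ 2 * (r * rho * sin theta / D theta)) by differentiate.
  have di := @is_derive_inv _ (fun theta => D theta ^+ 3) _ _ (expf_neq0 3 (D_neq0 theta)) dD3.
  have dm := is_derive_mul ds di.
  by apply: (is_derive_eq dm); rewrite /=; field; rewrite D_neq0.
have cI := continuous_add cA (continuous_opp cB).
rewrite (Rintegral_derive pi2_ge0 dI cI).
have -> : 2 * pi = pi *+ 2 :> R by rewrite mulr_natl.
by rewrite sin2pi sin0 !mul0r subrr.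
Qed.

(* The two factors used are rho |sin theta| <= D and |s| <= D. *)
Lemma angular_cos_bound :
  rho ^+ 2 * `|s| * \int[mu]_(theta in `[0, 2 * pi]) (sin theta ^+ 2 / D theta ^+ 5) <=
  \int[mu]_(theta in `[0, 2 * pi]) (D theta ^+ 2)^-1.
Proof.
have c2 := @cDinv 2; have c5 := @cDinv 5.
have cS : continuous (fun theta => sin theta ^+ 2 / D theta ^+ 5) by continuity.
have cS' : continuous (fun theta => rho ^+ 2 * `|s| * (sin theta ^+ 2 / D theta ^+ 5)).
  by continuity.
rewrite -RintegralZl //; last exact: continuous_itv_integrable.
apply: le_Rintegral => //; [exact: continuous_itv_integrable..|].
move=> theta _; have Dn := D_neq0 theta; have Dg := D_gt0 theta.
have -> : rho ^+ 2 * `|s| * (sin theta ^+ 2 / D theta ^+ 5) =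
   (rho ^+ 2 * sin theta ^+ 2 / D theta ^+ 2) * (`|s| / D theta) * (D theta ^+ 2)^-1.
  by field.
have D20 : 0 < D theta ^+ 2 by rewrite exprn_gt0.
apply: ler_piMl; first by rewrite invr_ge0 ltW.
apply: mulr_ile1.
- by apply: divr_ge0 (ltW D20); exact: mulr_ge0 (sqr_ge0 _) (sqr_ge0 _).
- by rewrite divr_ge0 // ltW.
(* This is q = (r - rho cos theta)^2 + rho^2 sin^2 theta + s^2. *)
- rewrite ler_pdivrMr // mul1r D2 /q.
  have -> : sin theta ^+ 2 = 1 - cos theta ^+ 2 by rewrite -(cos2Dsin2 theta); ring.
  have := sqr_ge0 (r - rho * cos theta); have := sqr_ge0 s.
  by rewrite !expr2; nra.
rewrite ler_pdivrMr // mul1r -(ger0_norm (ltW Dg)) -ler_sqr ?nnegrE //.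
rewrite !real_normK ?num_real // D2 qE sigma2.
rewrite -addrA addrCA lerDl addr_ge0 ?sqr_ge0 // mulr_ge0 ?subr_ge0 ?cos_le1 //.
by rewrite mulr_ge0 // ltW.
Qed.

(** Chosen so that [one_sub_cos_ge] reads 2 r rho (1 - cos x) >= (kappa x)^2, since 2 / 18 = 1 /
    9. *)
Let kappa := Num.sqrt (r * rho) / 3.

Let kappa_ge0 : 0 <= kappa. Proof. by rewrite divr_ge0 // sqrtr_ge0. Qed.

Let kappa2 : kappa ^+ 2 = r * rho / 9.
Proof. by rewrite expr_div_n sqr_sqrtr ?ltW //; congr (_ / _); ring. Qed.

(* 1 / (x^2 + y^2) <= 2 / (x + y)^2 has an elementary primitive. *)
Let inv_q_le x theta : 0 <= x <= pi -> cos theta = cos x ->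
  (D theta ^+ 2)^-1 <= 2 / (sigma + kappa * x) ^+ 2.
Proof.
move=> xpi cx; have /andP[x0 _] := xpi; have kx : 0 <= kappa * x by rewrite mulr_ge0.
have sk : 0 < sigma + kappa * x by rewrite ltr_pwDl.
rewrite D2 -[leRHS]invrK invf_div lef_pV2 ?posrE ?divr_gt0 ?exprn_gt0 //.
rewrite qE cx ler_pdivrMr //; have := one_sub_cos_ge xpi.
have K2 : (kappa * x) ^+ 2 = r * rho * (x ^+ 2 / 9) by rewrite exprMn kappa2; field.
move=> H; have H' : 2 * (r * rho) * (x ^+ 2 / 18) <= 2 * (r * rho) * (1 - cos x).
  by rewrite ler_wpM2l // mulr_ge0 // ltW.
have {H'} : (kappa * x) ^+ 2 <= 2 * (r * rho) * (1 - cos x).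
  by rewrite K2; apply: le_trans H'; rewrite le_eqVlt; apply/orP; left; apply/eqP; field.
have := sqr_ge0 (sigma - kappa * x); rewrite !expr2; nra.
Qed.

(** B is the primitive of (sigma + kappa x)^-2 that vanishes at 0. The relevant angle is x up to pi
    and 2 pi - x beyond; W adds the two nonnegative majorants, so the period need not be split. Its
    integral is 4 B (2 pi). *)
Lemma angular_integral_bound :
  \int[mu]_(theta in `[0, 2 * pi]) (D theta ^+ 2)^-1 <=
  8 * pi / (sigma * (sigma + kappa * (2 * pi))).
Proof.
pose B (x : R) := x / (sigma * (sigma + kappa * x)).
pose W x : R := 2 / (sigma + kappa * x) ^+ 2 + 2 / (sigma + kappa * (2 * pi - x)) ^+ 2.
have sk x : 0 <= x -> 0 < sigma + kappa * x by move=> x0; rewrite ltr_pwDl // mulr_ge0.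
have dB (x : R) : 0 <= x -> is_derive x 1 B ((sigma + kappa * x) ^+ 2)^-1.
  move=> x0; have nz : sigma * (sigma + kappa * x) != 0 by rewrite gt_eqF // mulr_gt0 ?sk.
  have dl : is_derive x 1 (fun x => sigma * (sigma + kappa * x)) (sigma * kappa).
    by differentiate; rewrite /=; ring.
  have di := @is_derive_inv _ (fun x => sigma * (sigma + kappa * x)) _ _ nz dl.
  apply: (is_derive_eq (is_derive_mul (is_derive_id x 1) di)).
  by field; rewrite !gt_eqF ?sk.
have dBW (x : R) : 0 <= x <= 2 * pi ->
    is_derive x 1 (fun x => 2 * B x - 2 * B (2 * pi - x)) (W x).
  case/andP=> x0 x2; have d1 := dB x x0.
  have y0 : 0 <= 2 * pi - x by rewrite subr_ge0.
  have dl : is_derive x 1 (fun x => 2 * pi - x) (-1) by differentiate; rewrite /= add0r.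
  have d2 := @is_derive_compose _ B (fun x => 2 * pi - x) x _ _ (dB _ y0) dl.
  by differentiate; rewrite /W /=; ring.
have cW : {within `[0, 2 * pi], continuous W}.
  apply: continuous_in_subspaceT => x /set_mem /=; rewrite in_itv /= => /andP[x0 x2].
  have y0 : 0 <= 2 * pi - x by rewrite subr_ge0.
  have c (l : R -> R) : continuous l -> l x != 0 -> {for x, continuous (fun x => 2 / l x ^+ 2)}.
    move=> cl l0; apply: continuousM; first exact: cvg_cst.
    apply: continuousV; first by rewrite expf_neq0.
    exact: (continuous_exp cl).
  have c1 : {for x, continuous (fun x => 2 / (sigma + kappa * x) ^+ 2)}.
    by apply: (c (fun x => sigma + kappa * x)); [continuity|rewrite gt_eqF ?sk].
  have c2' : {for x, continuous (fun x => 2 / (sigma + kappa * (2 * pi - x)) ^+ 2)}.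
    by apply: (c (fun x => sigma + kappa * (2 * pi - x))); [continuity|rewrite gt_eqF ?sk].
  exact: (continuousD c1 c2').
apply: le_trans (_ : \int[mu]_(theta in `[0, 2 * pi]) W theta <= _).
  apply: le_Rintegral => //.
  - by apply: continuous_itv_integrable; exact: cDinv.
  - by apply: continuous_compact_integrable => //; exact: segment_compact.
  move=> x; rewrite /= in_itv /= => /andP[x0 x2]; rewrite /W.
  have p1 y : 0 <= 2 / (sigma + kappa * y) ^+ 2 by rewrite divr_ge0 ?sqr_ge0.
  have [xpi|pix] := leP x pi.
    apply: le_trans (inv_q_le (x := x) _ erefl) _; first by rewrite x0.
    by rewrite lerDl.
  apply: le_trans (inv_q_le (x := 2 * pi - x) _ _) _.
  - by rewrite subr_ge0 x2 lerBlDr mulr_natl mulr2n lerD2l ltW.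
  - by rewrite mulr_natl addrC cosD2pi cosN.
  by rewrite lerDr.
rewrite (Rintegral_derive_on pi2_ge0 dBW cW) /B subrr !subr0 !mul0r.
set w := (sigma * (sigma + kappa * (2 * pi)))^-1.
by rewrite le_eqVlt; apply/orP; left; apply/eqP; ring.
Qed.

Lemma angular_kernel_eq : \int[mu]_(theta in `[0, 2 * pi]) (cos theta * s / D theta ^+ 3) =
  s * (3 * (r * rho)) * \int[mu]_(theta in `[0, 2 * pi]) (sin theta ^+ 2 / D theta ^+ 5).
Proof.
have c3 := @cDinv 3; have c5 := @cDinv 5.
have cA : continuous (fun theta => cos theta / D theta ^+ 3) by continuity.
have cS : continuous (fun theta => sin theta ^+ 2 / D theta ^+ 5) by continuity.
have -> : \int[mu]_(theta in `[0, 2 * pi]) (cos theta * s / D theta ^+ 3) =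
   \int[mu]_(theta in `[0, 2 * pi]) (s * (cos theta / D theta ^+ 3)).
  by apply: eq_Rintegral => x _; ring.
rewrite RintegralZl //; last exact: continuous_itv_integrable.
by rewrite int_cos RintegralZl ?mulrA //; exact: continuous_itv_integrable.
Qed.

(** One factor rho from the measure and one from the integration by parts form the rho^2 of
    [angular_cos_bound]; the constant is 3 / (4 pi) times 8 pi. *)
Lemma angular_kernel_bound :
  rho / (4 * pi) * `|\int[mu]_(theta in `[0, 2 * pi]) (cos theta * s / D theta ^+ 3)|
    <= 6 * r / (sigma * (sigma + kappa * (2 * pi))).
Proof.
have pi0 := pi_gt0 R.
set J := \int[mu]_(theta in `[0, 2 * pi]) (sin theta ^+ 2 / D theta ^+ 5).
have J0 : 0 <= J.
  by apply: Rintegral_ge0 => x _; rewrite divr_ge0 ?sqr_ge0 // exprn_ge0 // ltW.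
rewrite angular_kernel_eq -/J !normrM (ger0_norm J0) (gtr0_norm r0) (gtr0_norm rho0) normr_nat.
have -> : rho / (4 * pi) * (`|s| * (3 * (r * rho)) * J) =
   3 * r / (4 * pi) * (rho ^+ 2 * `|s| * J) by ring.
apply: le_trans (_ : 3 * r / (4 * pi) * (8 * pi / (sigma * (sigma + kappa * (2 * pi)))) <= _).
  rewrite ler_wpM2l ?divr_ge0 ?mulr_ge0 ?(ltW r0) ?(ltW pi0) //.
  exact: le_trans angular_cos_bound angular_integral_bound.
rewrite le_eqVlt; apply/orP; left; apply/eqP.
set w := (sigma * _)^-1; have : pi != 0 :> R by rewrite gt_eqF.
by move: w (pi : R) => w P P0; field.
Qed.

(** Either rho <= 2 sigma, or |r - rho| <= sigma < rho / 2 forces rho <= 2 r, so that rho is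
    controlled by the geometric mean of r and rho, itself at most 2 pi kappa. *)
Lemma angular_denominator_bounds :
  sigma <= sigma + kappa * (2 * pi) /\ rho <= 2 * (sigma + kappa * (2 * pi)).
Proof.
have k0 : 0 <= kappa * (2 * pi) by rewrite mulr_ge0.
split; first by rewrite lerDl.
have K : Num.sqrt (r * rho) <= kappa * (2 * pi).
  rewrite /kappa -mulrA ler_peMr ?sqrtr_ge0 //.
  by have := pi_ge2 R; move: (pi : R) => P P2; lra.
have [h|h] := leP rho (2 * sigma); first by apply: le_trans h _; lra.
have : rho <= 2 * Num.sqrt (r * rho); last by have := sigma_gt0; lra.
have S1 : `|r - rho| <= sigma.
  by rewrite -ler_sqr ?nnegrE ?(ltW sigma_gt0) // real_normK ?num_real // sigma2 lerDl sqr_ge0.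
have rr : rho <= 2 * r by move: S1; rewrite ler_norml => /andP[? ?]; lra.
rewrite -ler_sqr ?nnegrE ?(ltW rho0) ?mulr_ge0 ?sqrtr_ge0 // exprMn sqr_sqrtr ?(ltW rrho0) //.
have h1 : rho * rho <= 2 * r * rho by rewrite ler_wpM2r ?(ltW rho0).
by rewrite !expr2; have h2 := rrho0; lra.
Qed.

End AngularKernel.

(** * Majorants for integrands of unspecified measurability *)

Section NonmeasurableBound.
Local Open Scope ereal_scope.
Context d (T : measurableType d) (R : realType).
Variable mu : {measure set T -> \bar R}.
Implicit Types (D : set T) (f W : T -> \bar R).

(** The integral of a nonnegative function is a supremum over simple functions below it, hence
    monotone as it stands. The kernel is itself a parametrized integral, and this spares a proof of
    its joint measurability. *)
Lemma ge0_le_integral_nonmeasurable D f W : (forall x, D x -> 0 <= f x) ->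
  (forall x, D x -> f x <= W x) -> \int[mu]_(x in D) f x <= \int[mu]_(x in D) W x.
Proof.
move=> f0 fW; rewrite integral_mkcond [leRHS]integral_mkcond.
have g0 x : 0 <= (f \_ D) x by rewrite patchE; case: ifP => // /set_mem; exact: f0.
have gW x : (f \_ D) x <= (W \_ D) x by rewrite !patchE; case: ifP => // /set_mem; exact: fW.
rewrite !ge0_integralTE => // [|x]; last exact: le_trans (g0 x) (gW x).
apply: le_ereal_sup => _ [h hf <-]; exists h => // x; exact: le_trans (hf x) (gW x).
Qed.

(** The positive and the negative part both integrate to a value in [0, K], so their difference has
    absolute value at most K. *)
Lemma abs_Rintegral_le D (f : T -> R) W (K : R) :
  (forall x, D x -> (`|f x|)%:E <= W x) -> \int[mu]_(x in D) W x <= K%:E ->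
  (`|\int[mu]_(x in D) f x| <= K)%R.
Proof.
move=> fW WK; rewrite /Rintegral integralE.
have Ip : \int[mu]_(x in D) (fun x => (f x)%:E)^\+ x <= K%:E.
  apply: le_trans WK; apply: ge0_le_integral_nonmeasurable => x Dx.
    exact: funepos_ge0.
  apply: le_trans (fW x Dx); rewrite funeposE -EFin_max lee_fin ge_max ler_norm /=.
  exact: normr_ge0.
have In : \int[mu]_(x in D) (fun x => (f x)%:E)^\- x <= K%:E.
  apply: le_trans WK; apply: ge0_le_integral_nonmeasurable => x Dx.
    exact: funeneg_ge0.
  apply: le_trans (fW x Dx); rewrite funenegE -EFinN -EFin_max lee_fin ge_max -normrN ler_norm /=.
  exact: normr_ge0.
have Ip0 : 0 <= \int[mu]_(x in D) (fun x => (f x)%:E)^\+ x.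
  by apply: integral_ge0 => x _; exact: funepos_ge0.
have In0 : 0 <= \int[mu]_(x in D) (fun x => (f x)%:E)^\- x.
  by apply: integral_ge0 => x _; exact: funeneg_ge0.
move: Ip In Ip0 In0.
case: (\int[mu]_(x in D) (fun x => (f x)%:E)^\+ x) => [u| |] //.
case: (\int[mu]_(x in D) (fun x => (f x)%:E)^\- x) => [v| |] //.
rewrite !lee_fin => uK vK u0 v0; rewrite /= ler_norml; apply/andP; split; lra.
Qed.

End NonmeasurableBound.

(** * A dyadic majorant of the inverse distance *)

Section SingularIntegral.
Variable R : realType.
Local Notation mu := (@lebesgue_measure R).
Local Notation plane := (measurableTypeR R * measurableTypeR R)%type.
Variables (r z lam : R).
Hypothesis lam0 : 0 < lam.

(** This is lam / 2^j, written so that the integrals below sum as eps / 2^(j + 1). *)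
Let radius (j : nat) : R := 2 * lam / (2 ^ j.+1)%:R.
Let square (j : nat) : set plane :=
  `]r - radius j, r + radius j[ `*` `]z - radius j, z + radius j[.

(* A dyadic majorant of 1 / |(rho, zeta) - (r, z)| on the square of half-side lam
   whose integral is a geometric series. *)
Definition dyadic_inverse_distance (x : R * R) : \bar R :=
  (\sum_(0 <= j <oo) ((2 / radius j) * \1_(square j) x)%:E)%E.

Let pow2_gt0 j : 0 < (2 ^ j.+1)%:R :> R.
Proof. by rewrite ltr0n expn_gt0. Qed.

Let radius_gt0 j : 0 < radius j.
Proof. by rewrite divr_gt0 // mulr_gt0. Qed.

Let term_ge0 j x : (0 <= ((2 / radius j) * \1_(square j) x)%:E)%E.
Proof. by rewrite lee_fin mulr_ge0 // divr_ge0 // ltW. Qed.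

Let radiusS j : radius j = 2 * radius j.+1.
Proof.
rewrite /radius [in RHS]expnS natrM; have := gt_eqF (pow2_gt0 j).
by move: (2 ^ j.+1)%:R => P /negbT P0; field.
Qed.

Let measurable_square j : measurable (square j).
Proof. by apply: measurableX; exact: measurable_itv. Qed.

Lemma dyadic_inverse_distance_ge0 x : (0 <= dyadic_inverse_distance x)%E.
Proof. by apply: nneseries_ge0 => j _ _; exact: term_ge0. Qed.

Let measurable_term j :
  measurable_fun (setT : set plane) (fun x => ((2 / radius j) * \1_(square j) x)%:E).
Proof.
apply/measurable_EFinP; apply: measurable_funM; first exact: measurable_cst.
exact: measurable_indic.
Qed.

Lemma measurable_dyadic_inverse_distance :
  measurable_fun (setT : set plane) dyadic_inverse_distance.
Proof.
apply: ge0_emeasurable_sum => [j x _ _|j _]; first exact: term_ge0.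
exact: measurable_term.
Qed.

(** The term of index j integrates to (2 / radius j) (2 radius j)^2 = 8 radius j = 16 lam / 2^(j +
    1). *)
Lemma integral_dyadic_inverse_distance :
  (\int[area R]_x dyadic_inverse_distance x <= (16 * lam)%:E)%E.
Proof.
rewrite integral_nneseries;
  [|by []|exact: measurable_term|by move=> j x _; exact: term_ge0].
apply: le_trans (epsilon_trick0 xpredT (ltW (_ : 0 < 16 * lam))); last by rewrite mulr_gt0.
apply: lee_nneseries => [j _ _|j _].
  by apply: integral_ge0 => x _; exact: term_ge0.
under eq_integral do rewrite EFinM.
rewrite ge0_integralZl //; last 2 first.
- by apply/measurable_EFinP; exact: measurable_indic.
- by rewrite lee_fin divr_ge0 // ltW.
rewrite integral_indic // setIT.
have areaE : (area R) (square j) = ((2 * radius j) * (2 * radius j))%:E.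
  rewrite /square; change ((mu \x mu) (`](r - radius j)%R, (r + radius j)%R[
    `*` `](z - radius j)%R, (z + radius j)%R[) = ((2 * radius j) * (2 * radius j))%:E)%E.
  rewrite product_measure1E /=; [|exact: measurable_itv..].
  have rj := radius_gt0 j.
  rewrite !lebesgue_measure_itv /= !lte_fin !ifT -?EFinD -?EFinM; [|lra..].
  by congr EFin; ring.
rewrite [X in (_ * X)%E]areaE -EFinM lee_fin le_eqVlt; apply/orP; left; apply/eqP.
have := gt_eqF (radius_gt0 j); rewrite (_ : 16 * lam / _ = 8 * radius j); last by rewrite /radius; ring.
by move: (radius j) => P /negbT P0; field.
Qed.

(** One term suffices: if M is the distance in the maximum norm and radius (j + 1) <= M < radius j,
    the point lies in square j, where 2 / radius j = 1 / radius (j + 1) >= 1 / M. The least index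
    with radius <= M is positive because M < lam = radius 0. *)
Lemma dyadic_inverse_distance_ge rho zeta :
  `|r - rho| < lam -> `|z - zeta| < lam -> 0 < (r - rho) ^+ 2 + (z - zeta) ^+ 2 ->
  (((Num.sqrt ((r - rho) ^+ 2 + (z - zeta) ^+ 2))^-1)%:E <= dyadic_inverse_distance (rho, zeta))%E.
Proof.
move=> rl zl p0; pose M := Num.max `|r - rho| `|z - zeta|.
have M0 : 0 < M.
  rewrite lt_max !normr_gt0 -negb_and; apply/negP => /andP[/eqP a0 /eqP b0].
  by move: p0; rewrite a0 b0 expr0n addr0 ltxx.
have Ml : M < radius 0 by rewrite /radius expn1 mulrAC mulfV // mul1r gt_max rl zl.
have ex : exists n, radius n <= M.
  exists (Num.truncn (M^-1 * (2 * lam))); rewrite /radius ler_pdivrMr // -ler_pdivrMl //.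
  apply: le_trans (ltW (truncnS_gt _)) _; rewrite ler_nat.
  by rewrite ltnW // ltn_expl.
case: (ex_minnP ex) => -[|j] jM minj; first by rewrite leNgt Ml in jM.
have Mj : M < radius j by rewrite ltNge; apply/negP => /minj; rewrite ltnn.
have inj : square j (rho, zeta).
  move: Mj; rewrite gt_max !ltr_norml => /andP[/andP[? ?] /andP[? ?]].
  by split; rewrite /= in_itv /=; apply/andP; split; lra.
apply: le_trans (_ : ((2 / radius j) * \1_(square j) (rho, zeta))%:E <= _)%E.
  rewrite indicE mem_set // mulr1 lee_fin.
  have sM : M <= Num.sqrt ((r - rho) ^+ 2 + (z - zeta) ^+ 2).
    rewrite -ler_sqr ?nnegrE ?sqrtr_ge0 ?(ltW M0) // sqr_sqrtr ?(ltW p0) //.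
    rewrite /M; have [h|h] := leP `|r - rho| `|z - zeta|.
      by rewrite real_normK ?num_real // lerDr sqr_ge0.
    by rewrite real_normK ?num_real // lerDl sqr_ge0.
  apply: le_trans (_ : M^-1 <= _); first by rewrite lef_pV2 ?posrE // (lt_le_trans M0).
  rewrite radiusS invfM mulrA divff // mul1r lef_pV2 ?posrE //.
have := @nneseries_lim_ge R (fun k => ((2 / radius k) * \1_(square k) (rho, zeta))%:E) xpredT
  0%N j.+1 (fun k _ _ => term_ge0 k (rho, zeta)).
apply: le_trans; rewrite big_nat_recr //= leeDr //.
by apply: sume_ge0 => k _; exact: term_ge0.
Qed.

End SingularIntegral.

(** * The bound on U_g *)

Section VelocityBound.
Variable R : realType.
Local Notation mu := (@lebesgue_measure R).
Local Notation plane := (measurableTypeR R * measurableTypeR R)%type.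

(** Covers the line zeta = z, which the angular estimates exclude and which contains the pole: the
    factor z - zeta makes the integrand 0 there. *)
Lemma bs_kernel_r_axis (r z rho : R) : bs_kernel_r r z rho z = 0.
Proof.
rewrite /bs_kernel_r (_ : \int[mu]_(theta in _) _ = 0) ?mulr0 //.
rewrite -[RHS](@Rintegral_set0 _ _ _ mu (cst 0)).
rewrite [RHS]Rintegral_mkcond Rintegral_mkcond; apply: eq_Rintegral => x _.
by rewrite !patchE in_set0 subrr mulr0 mul0r; case: ifP.
Qed.

(** The first bound absorbs the rho of the vorticity rho g and is paired with the supremum of g near
    the pole; the second leaves rho to the measure and is paired with the L^1 norm away from it. *)
Lemma bs_kernel_r_bounds (r z rho zeta : R) : 0 < r -> 0 < rho -> z != zeta ->
  let sigma := Num.sqrt ((r - rho) ^+ 2 + (z - zeta) ^+ 2) in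
  [/\ 0 < sigma, `|bs_kernel_r r z rho zeta| * rho <= 12 * r / sigma
    & `|bs_kernel_r r z rho zeta| <= 6 * r / sigma ^+ 2].
Proof.
move=> r0 rho0 zz sigma; have s0 : z - zeta != 0 by rewrite subr_eq0.
have sg : 0 < sigma by rewrite sqrtr_gt0 ltr_wpDl ?sqr_ge0 // exprn_even_gt0.
have K := angular_kernel_bound r0 rho0 s0.
have [d1 d2] := angular_denominator_bounds r0 rho0 s0.
move: K d1 d2; rewrite -/sigma; set d := sigma + _ => K d1 d2.
have d0 : 0 < d by apply: lt_le_trans d1.
have {}K : `|bs_kernel_r r z rho zeta| <= 6 * r / (sigma * d).
  rewrite /bs_kernel_r normrM [X in X * _]ger0_norm //.
  by rewrite divr_ge0 ?mulr_ge0 ?pi_ge0 // ltW.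
split => //.
  apply: le_trans (ler_wpM2r (ltW rho0) K) _.
  have -> : 6 * r / (sigma * d) * rho = 6 * r / sigma * 2 * (rho / (2 * d)).
    by rewrite !invfM; move: (sigma^-1) (d^-1) => u v; field.
  have -> : 12 * r / sigma = 6 * r / sigma * 2 by ring.
  rewrite ler_piMr ?mulr_ge0 ?invr_ge0 ?(ltW sg) ?(ltW r0) //.
  by rewrite ler_pdivrMr ?mul1r // mulr_gt0.
apply: le_trans K _; rewrite ler_wpM2l ?mulr_ge0 ?(ltW r0) //.
by rewrite lef_pV2 ?posrE ?mulr_gt0 ?exprn_gt0 // expr2 ler_wpM2l // ltW.
Qed.

(** The splitting is along the square of half-side lam, outside which sigma >= lam. The square
    contributes 12 r A times 16 lam, the exterior 6 r N1 / lam^2; division by r concludes. *)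
Lemma U_of_bound (g : R -> R -> R) (A N1 r z lam : R) : 0 < r -> 0 < lam ->
  (forall rho zeta, 0 < rho -> `|g rho zeta| <= A) ->
  (area R).-integrable (@halfplane R) (fun x => (`|g x.1 x.2| * x.1)%:E) ->
  \int[area R]_(x in @halfplane R) (`|g x.1 x.2| * x.1) <= N1 ->
  `|U_of g r z| <= 192 * (lam * A) + 6 * (N1 / lam ^+ 2).
Proof.
move=> r0 lam0 gA ig gN; have mH := @measurable_halfplane R.
have A0 : 0 <= A by apply: le_trans (gA 1 0 ltr01).
pose W := dyadic_inverse_distance r z lam.
pose f (y : R * R) := bs_kernel_r r z y.1 y.2 * (y.1 * g y.1 y.2).
have W0 y : (0 <= W y)%E by exact: dyadic_inverse_distance_ge0.
have fW (y : R * R) : halfplane y ->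
    ((`|f y|)%:E <= (12 * r * A)%:E * W y + (6 * r / lam ^+ 2)%:E * (`|g y.1 y.2| * y.1)%:E)%E.
  case: y => rho zeta rho0; have rho0' : 0 < rho := rho0; rewrite /f /=.
  have t1 : (0 <= (12 * r * A)%:E * W (rho, zeta))%E.
    by rewrite mule_ge0 // lee_fin !mulr_ge0 // ltW.
  have t2 : (0 <= (6 * r / lam ^+ 2)%:E * (`|g rho zeta| * rho)%:E)%E.
    by rewrite -EFinM lee_fin !mulr_ge0 ?invr_ge0 ?sqr_ge0 ?(ltW r0) ?(ltW rho0').
  have [zE|zz] := eqVneq z zeta.
    have -> : bs_kernel_r r z rho zeta = 0 by rewrite -zE bs_kernel_r_axis.
    by rewrite mul0r normr0 adde_ge0.
  have [sg K1 K2] := bs_kernel_r_bounds r0 rho0' zz.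
  set sigma := Num.sqrt _ in sg K1 K2.
  have fE : `|bs_kernel_r r z rho zeta * (rho * g rho zeta)| =
      `|bs_kernel_r r z rho zeta| * (`|g rho zeta| * rho).
    by rewrite !normrM (gtr0_norm rho0'); ring.
  have far : lam <= sigma ->
      (`|bs_kernel_r r z rho zeta * (rho * g rho zeta)|%:E <=
      (12 * r * A)%:E * W (rho, zeta) + (6 * r / lam ^+ 2)%:E * (`|g rho zeta| * rho)%:E)%E.
    move=> ls; rewrite -[leLHS]add0e; apply: leeD => //; rewrite fE -EFinM lee_fin.
    rewrite ler_wpM2r ?mulr_ge0 ?(ltW rho0') //; apply: le_trans K2 _.
    rewrite ler_wpM2l ?mulr_ge0 ?(ltW r0) // lef_pV2 ?posrE ?exprn_gt0 //.
    by rewrite lerXn2r ?nnegrE // ltW.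
  have s2 : sigma ^+ 2 = (r - rho) ^+ 2 + (z - zeta) ^+ 2.
    by rewrite sqr_sqrtr // addr_ge0 ?sqr_ge0.
  have [rl|rl] := leP lam `|r - rho|.
    apply: far; apply: le_trans rl _; rewrite -ler_sqr ?nnegrE ?(ltW sg) //.
    by rewrite real_normK ?num_real // s2 lerDl sqr_ge0.
  have [zl|zl] := leP lam `|z - zeta|.
    apply: far; apply: le_trans zl _; rewrite -ler_sqr ?nnegrE ?(ltW sg) //.
    by rewrite real_normK ?num_real // s2 lerDr sqr_ge0.
  rewrite -[leLHS]adde0; apply: leeD => //.
  have p0 : 0 < (r - rho) ^+ 2 + (z - zeta) ^+ 2 by rewrite -s2 exprn_gt0.
  apply: le_trans (_ : (12 * r * A)%:E * (sigma^-1)%:E <= _)%E; last first.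
    apply: lee_wpmul2l; first by rewrite lee_fin !mulr_ge0 // ltW.
    exact: dyadic_inverse_distance_ge.
  rewrite fE -EFinM lee_fin.
  have -> : 12 * r * A / sigma = 12 * r / sigma * A by ring.
  by rewrite (mulrC `|g _ _|) mulrA ler_pM ?mulr_ge0 ?(ltW rho0') // gA.
have mW : measurable_fun (@halfplane R : set plane) W.
  by apply: (@measurable_funTS _ _ plane); exact: measurable_dyadic_inverse_distance.
have mg : measurable_fun (@halfplane R : set plane) (fun x => (`|g x.1 x.2| * x.1)%:E).
  by case/integrableP: ig.
have g0 (x : R * R) : halfplane x -> (0 <= (`|g x.1 x.2| * x.1)%:E)%E.
  by move=> x0; rewrite lee_fin mulr_ge0 // ltW.
have c1 : (0 <= (12 * r * A)%:E)%E by rewrite lee_fin !mulr_ge0 // ltW.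
have c2 : (0 <= (6 * r / lam ^+ 2)%:E)%E.
  by rewrite lee_fin divr_ge0 ?sqr_ge0 // mulr_ge0 // ltW.
rewrite /U_of /b_of /biot_savart /= normrM normfV (gtr0_norm r0) ler_pdivrMr //.
apply: (@abs_Rintegral_le _ plane R (area R) (@halfplane R) f _ _ fW).
rewrite ge0_integralD //; last 4 first.
- by move=> x _; rewrite mule_ge0.
- by apply: emeasurable_funM => //; exact: measurable_cst.
- by move=> x x0; rewrite mule_ge0 // g0.
- by apply: emeasurable_funM => //; exact: measurable_cst.
rewrite !ge0_integralZl //.
have -> : ((192 * (lam * A) + 6 * (N1 / lam ^+ 2)) * r)%:E =
    ((12 * r * A)%:E * (16 * lam)%:E + (6 * r / lam ^+ 2)%:E * N1%:E)%E.
  by rewrite -!EFinM -EFinD; congr EFin; ring.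
apply: leeD; apply: lee_wpmul2l => //.
  apply: le_trans (integral_dyadic_inverse_distance r z lam0).
  apply: ge0_subset_integral => //; exact: measurable_dyadic_inverse_distance.
rewrite -[leLHS]fineK ?lee_fin //; exact: integrable_fin_num.
Qed.

(** With lam the cube root of N1 / A both terms are multiples of the same product, and 192 + 6 =
    198. When A = 0 the choice degenerates to lam large, when N1 = 0 to lam small. *)
Lemma interpolation_bound (x A N1 : R) : 0 <= A -> 0 <= N1 ->
  (forall lam, 0 < lam -> x <= 192 * (lam * A) + 6 * (N1 / lam ^+ 2)) ->
  x <= 198 * N1 `^ (1 / 3) * A `^ (2 / 3).
Proof.
rewrite le_eqVlt => /predU1P[<-|A0] N10 H.
  have -> : (0 : R) `^ (2 / 3) = 0 by rewrite powR0 // gt_eqF // divr_gt0.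
  rewrite mulr0; apply/ler_addgt0Pr => e e0; rewrite add0r.
  (* From l >= 1 one gets l^2 >= l >= 6 N1 / e, so the remaining term is at most e. *)
  pose l := Num.max 1 (6 * N1 / e).
  have l1 : 1 <= l by rewrite le_max lexx.
  have l0 : 0 < l by apply: lt_le_trans l1.
  have le : 6 * N1 / e <= l by rewrite le_max lexx orbT.
  apply: le_trans (H l l0) _; rewrite !mulr0 add0r mulrA ler_pdivrMr ?exprn_gt0 //.
  have h1 : 6 * N1 <= l * e by rewrite -ler_pdivrMr.
  apply: le_trans h1 _; rewrite mulrC ler_wpM2l ?(ltW e0) // expr2.
  by rewrite ler_peMl // ltW.
move: N10 H; rewrite le_eqVlt => /predU1P[<-|N10] H.
  have -> : (0 : R) `^ (1 / 3) = 0 by rewrite powR0 // gt_eqF // divr_gt0.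
  rewrite mulr0 mul0r; apply/ler_addgt0Pr => e e0; rewrite add0r.
  have l0 : 0 < e / (192 * A) by rewrite divr_gt0 // mulr_gt0.
  apply: le_trans (H _ l0) _; rewrite mul0r mulr0 addr0 le_eqVlt; apply/orP; left; apply/eqP.
  by field; rewrite gt_eqF.
pose a := A `^ (1 / 3); pose n := N1 `^ (1 / 3).
have a0 : 0 < a by rewrite powR_gt0.
have n0 : 0 < n by rewrite powR_gt0.
have cube (y : R) : 0 < y -> y = (y `^ (1 / 3)) ^+ 3.
  move=> y0; rewrite -powR_mulrn ?powR_ge0 // -powRrM -[X in _ `^ X]/(1 / 3 * 3).
  by rewrite divfK ?powRr1 // ltW.
have A23 : A `^ (2 / 3) = a ^+ 2.
  by rewrite /a -powR_mulrn ?powR_ge0 // -powRrM; congr powR; field.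
have N3 := cube N1 N10; have A3 := cube A A0.
have := H (n / a) (divr_gt0 n0 a0); rewrite A23 -/n.
rewrite -/a in A3; rewrite -/n in N3; move: N3 A3; clearbody a n => -> ->.
have -> : 192 * (n / a * a ^+ 3) + 6 * (n ^+ 3 / (n / a) ^+ 2) = 198 * n * a ^+ 2.
  by field; rewrite !gt_eqF.
by [].
Qed.

End VelocityBound.

(** * Monotonicity along the flow *)

Section Flow.
Variable R : realType.
Local Notation mu := (@lebesgue_measure R).
Variables (nu : R) (T : \bar R) (ge gr gz grr gzz a ar b bz h : R -> R -> R -> R).
Hypothesis nu0 : 0 < nu.
Hypothesis ge_t : forall t r z, lifespan T t -> is_derive t 1 (fun s => ge s r z) (h t r z).
Hypothesis slices : forall tau, 0 < tau -> lifespan T tau -> exists C, forall t, 0 <= t <= tau ->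
  slice nu C (ge t) (gr t) (gz t) (grr t) (gzz t) (a t) (ar t) (b t) (bz t) (h t).

Local Notation Ep p s := (\int[area R]_(x in @halfplane R) (`|ge s x.1 x.2| `^ p * x.1)).
Local Notation I1 s := (\int[area R]_(x in @halfplane R) (`|ge s x.1 x.2| * x.1)).

Lemma slice_at t : lifespan T t -> exists C,
  slice nu C (ge t) (gr t) (gz t) (grr t) (gzz t) (a t) (ar t) (b t) (bz t) (h t).
Proof.
move=> tT; have [delta d0 dT] := lifespan_room tT.
have tau0 : 0 < t + delta by apply: ltr_wpDl d0; case: tT.
have [C S] := slices tau0 dT; exists C; apply: S.
by rewrite tT.1 lerDl ltW.
Qed.

Lemma energy_balance_at p t : 1 < p -> lifespan T t ->
  [/\ (area R).-integrable (@halfplane R) (fun x =>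
        (`|ge t x.1 x.2| `^ (p - 2) * (gr t x.1 x.2 ^+ 2 + gz t x.1 x.2 ^+ 2) * x.1)%:E),
      mu.-integrable setT (fun z => (`|ge t 0 z| `^ p)%:E)
    & \int[area R]_(x in @halfplane R)
        (p * (`|ge t x.1 x.2| `^ (p - 2) * ge t x.1 x.2) * h t x.1 x.2 * x.1)
      + nu * p * (p - 1) * \int[area R]_(x in @halfplane R)
        (`|ge t x.1 x.2| `^ (p - 2) * (gr t x.1 x.2 ^+ 2 + gz t x.1 x.2 ^+ 2) * x.1)
      + 2 * nu * \int[mu]_z `|ge t 0 z| `^ p = 0 ].
Proof.
move=> p1 tT; have [C S] := slice_at tT.
have [K [K2 [beta [beta1 [beta2 H]]]]] := power_approximation_exists C p1.
exact: (energy_balance S nu0 p1 (approx_d H) (approx_d1 H) (@approx_c2 _ _ _ _ _ _ _ _ H)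
  (approx_K H) (approx_K1 H) (approx_ge0 H) (approx_K2 H) (@approx_lim _ _ _ _ _ _ _ _ H)
  (@approx_lim1 _ _ _ _ _ _ _ _ H) (@approx_lim2 _ _ _ _ _ _ _ _ H)).
Qed.

Lemma energy_nonincreasing p t : 1 < p -> lifespan T t -> Ep p t <= Ep p 0.
Proof.
move=> p1 tT; apply: (derivative_on_lifespan_nonincreasing (F := fun s => Ep p s) tT) => s sT.
  exact: (energy_derivative ge_t slices p1 sT).
have [_ _] := energy_balance_at p1 sT.
set J := \int[_]_(x in _) (p * _ * _ * _); set D := \int[_]_(x in _) _; set A := \int[_]_z _.
have D0 : 0 <= D.
  apply: Rintegral_ge0 => x x0; apply: mulr_ge0 (ltW x0).
  by apply: mulr_ge0 (powR_ge0 _ _) _; exact: addr_ge0 (sqr_ge0 _) (sqr_ge0 _).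
have A0 : 0 <= A by apply: Rintegral_ge0 => x _; exact: powR_ge0.
have c1 : 0 <= nu * p * (p - 1) * D.
  apply: mulr_ge0 D0; rewrite !mulr_ge0 ?subr_ge0 ?(ltW nu0) ?(ltW p1) //.
  exact: ltW (lt_trans ltr01 p1).
have c2 : 0 <= 2 * nu * A by rewrite !mulr_ge0 // ltW.
by move=> H; rewrite -oppr_ge0; have -> : - J = nu * p * (p - 1) * D + 2 * nu * A;
  [rewrite -[LHS]addr0 -H; ring|exact: addr_ge0].
Qed.

Lemma norm1_nonincreasing t : lifespan T t -> I1 t <= I1 0.
Proof.
move=> tT; have T0 : lifespan T 0 by apply: (lifespan_ltW _ tT); rewrite lexx tT.1.
have [C S] := slice_at tT; have [C' S'] := slice_at T0.
apply: (ler_cvg_to (cvg_energy_norm1 S) (cvg_energy_norm1 S')).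
apply: nearW => n; apply: energy_nonincreasing tT.
by rewrite ltrDl harmonic_gt0.
Qed.

(** A value above M at time t would make the energy of exponent p there at least c m^p for some m >
    M, while the initial energy is at most M^(p - 1) times the L^1 norm; monotonicity of every
    energy rules this out as p grows. *)
Lemma sup_nonincreasing t M : lifespan T t ->
  (forall r z, 0 < r -> `|ge 0 r z| <= M) -> forall r z, 0 < r -> `|ge t r z| <= M.
Proof.
move=> tT gM r z r0; have T0 : lifespan T 0 by apply: (lifespan_ltW _ tT); rewrite lexx tT.1.
have [C S] := slice_at tT; have [C' S'] := slice_at T0.
have M0 : 0 <= M by apply: le_trans (gM r z r0).
rewrite leNgt; apply/negP => Mg; pose m := (M + `|ge t r z|) / 2.
have Mm : M < m by rewrite /m; lra.
have m0 : 0 < m by exact: le_lt_trans Mm.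
have mg : m < `|ge t r z| by rewrite /m; lra.
have [c c0 Hc] := energy_ge_local S r0 (ltW m0) mg.
have : c * m ^+ 2 <= 0.
  apply: (geometric_domination (K := M * I1 0) M0 Mm) => n.
  have -> : c * m ^+ 2 * m ^+ n = c * m ^+ n.+2 by rewrite -mulrA -exprD.
  have -> : M * I1 0 * M ^+ n = M ^+ n.+1 * I1 0 by rewrite exprS; ring.
  apply: le_trans (Hc n) _; apply: le_trans (energy_le_sup S' n gM).
  by apply: energy_nonincreasing; rewrite // ltr1n.
by rewrite leNgt mulr_gt0 // exprn_gt0.
Qed.

End Flow.

(** * From the extended profiles back to solutions *)

Lemma derivative_on_lifespan_eq (R : realType) (T : \bar R) (F G : R -> R) (t l : R) :
  lifespan T t -> (forall s, lifespan T s -> F s = G s) ->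
  derivative_on_lifespan T F t l -> derivative_on_lifespan T G t l.
Proof.
move=> tT FG; apply: cvg_trans; apply: near_eq_cvg; rewrite near_withinE.
by apply: nearW => s [sT _]; rewrite !FG.
Qed.

Section Solutions.
Variable R : realType.
Local Notation mu := (@lebesgue_measure R).
Variables (nu : R) (T : \bar R) (ur uz g : R -> R -> R -> R).
Hypothesis nu0 : 0 < nu.
Hypothesis T0 : (0 < T)%E.
Hypothesis sol : decaying_smooth_solution nu T ur uz g.

Let T_0 : lifespan T 0. Proof. by split. Qed.

Lemma solution_energy (p t : R) : 1 < p -> lifespan T t ->
  [/\ mu3_integrable (energy_density p (g t)),
      mu3_integrable (dissipation_density p (g t)),
      mu.-integrable setT (EFin \o axis_density p (g t))
    & exists2 dE : R,
        derivative_on_lifespan T (fun s => energy p (g s)) t dE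
      & dE + nu * p * (p - 1) * dissipation p (g t) + 2 * nu * axis_energy p (g t) = 0].
Proof.
move=> p1 tT.
have [ge [gr [gz [grr [gzz [a [ar [b [bz [h [gE gD gt S]]]]]]]]]]] := solution_slices sol.
have [iD iA bal] := energy_balance_at nu0 S p1 tT.
have [C St] := slice_at S tT.
have D_eq (x : R * R) : halfplane x -> dissipation_density p (g t) x.1 x.2 * x.1 =
    `|ge t x.1 x.2| `^ (p - 2) * (gr t x.1 x.2 ^+ 2 + gz t x.1 x.2 ^+ 2) * x.1.
  move=> x0; have [dr dz] := gD t x.1 x.2 tT x0.
  by rewrite /dissipation_density /grad_sq dr dz gE // ltW.
have E_eq s (x : R * R) : lifespan T s -> halfplane x ->
    energy_density p (g s) x.1 x.2 * x.1 = `|ge s x.1 x.2| `^ p * x.1.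
  by move=> sT x0; rewrite /energy_density gE // ltW.
have mH := @measurable_halfplane R.
split.
- apply: eq_integrable (slice_energy_integrable St p1) => // x /set_mem x0.
  by rewrite E_eq.
- by apply: eq_integrable iD => // x /set_mem x0; rewrite D_eq.
- by apply: eq_integrable iA => // z _; rewrite /axis_density /= gE.
exists (\int[area R]_(x in @halfplane R)
        (p * (`|ge t x.1 x.2| `^ (p - 2) * ge t x.1 x.2) * h t x.1 x.2 * x.1)).
  have dE := energy_derivative gt S p1 tT.
  apply: (@derivative_on_lifespan_eq R T _ (fun s => energy p (g s)) t _ tT _ dE) => s sT.
  by apply: eq_Rintegral => x /set_mem x0; rewrite E_eq.
rewrite -[RHS]bal; congr (_ + _ * _ + _ * _).
  by apply: eq_Rintegral => x /set_mem x0; exact: D_eq.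
by apply: eq_Rintegral => z _; rewrite /axis_density gE.
Qed.

Lemma solution_norms : exists N1 Noo : R, [/\ 0 <= N1, 0 <= Noo,
  norm1 (g 0) = N1%:E, normoo (g 0) = Noo%:E &
  forall t, lifespan T t -> [/\ (area R).-integrable (@halfplane R)
      (fun x => (`|g t x.1 x.2| * x.1)%:E),
    \int[area R]_(x in @halfplane R) (`|g t x.1 x.2| * x.1) <= N1 &
    forall r z, 0 < r -> `|g t r z| <= Noo]].
Proof.
have [ge [gr [gz [grr [gzz [a [ar [b [bz [h [gE gD gt S]]]]]]]]]]] := solution_slices sol.
have mH := @measurable_halfplane R.
have I_eq s (x : R * R) : lifespan T s -> halfplane x ->
    `|g s x.1 x.2| * x.1 = `|ge s x.1 x.2| * x.1.
  by move=> sT x0; rewrite gE // ltW.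
have int t : lifespan T t -> (area R).-integrable (@halfplane R)
      (fun x => (`|g t x.1 x.2| * x.1)%:E).
  move=> tT; have [C St] := slice_at S tT.
  by apply: eq_integrable (slice_norm1_integrable St) => // x /set_mem x0; rewrite I_eq.
have IE s : lifespan T s -> \int[area R]_(x in @halfplane R) (`|g s x.1 x.2| * x.1) =
    \int[area R]_(x in @halfplane R) (`|ge s x.1 x.2| * x.1).
  by move=> sT; apply: eq_Rintegral => x /set_mem x0; rewrite I_eq.
have [C St] := slice_at S T_0.
have gC r z : 0 < r -> `|g 0 r z| <= C.
  by move=> r0; rewrite gE ?(ltW r0) //; exact: (slice_g_le St z r0).
have oo_fin : normoo (g 0) \is a fin_num.
  have lo : (0 <= normoo (g 0))%E.
    by apply: le_ereal_sup_tmp; exists `|g 0 1 0|%:E; [exists (1, 0) => //; exact: ltr01|rewrite lee_fin].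
  rewrite ge0_fin_numE //; apply: le_lt_trans (ltry C).
  by apply: ge_ereal_sup => _ [[r z] r0 <-]; rewrite lee_fin; exact: gC.
exists (\int[area R]_(x in @halfplane R) (`|g 0 x.1 x.2| * x.1)), (fine (normoo (g 0))).
have sup0 r z : 0 < r -> `|g 0 r z| <= fine (normoo (g 0)).
  move=> r0; rewrite -lee_fin fineK //; apply: ereal_sup_ubound.
  by exists (r, z).
split.
- by apply: Rintegral_ge0 => x x0; rewrite mulr_ge0 // ltW.
- by apply: le_trans (sup0 1 0 ltr01).
- by rewrite fineK //; exact: integrable_fin_num (int 0 T_0).
- by rewrite fineK.
move=> t tT; split => [| |r z r0]; first exact: int.
  by rewrite !IE //; exact: (norm1_nonincreasing nu0 gt S tT).
rewrite gE ?(ltW r0) //; apply: (sup_nonincreasing nu0 gt S tT) r0.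
by move=> r' z' r'0; rewrite -gE ?(ltW r'0) //; exact: sup0.
Qed.

Lemma solution_velocity_bound t : lifespan T t ->
  (normoo (U_of (g t)) <= B_of 198 (g 0))%E.
Proof.
move=> tT; have [N1 [Noo [N10 Noo0 n1E nooE H]]] := solution_norms.
have [it I_le sup_le] := H t tT.
rewrite /B_of n1E nooE !poweR_EFin -!EFinM.
apply: ge_ereal_sup => _ [[r z] r0 <-]; rewrite lee_fin /=.
apply: interpolation_bound => // lam lam0.
exact: U_of_bound r0 lam0 sup_le it I_le.
Qed.

End Solutions.

Theorem theorem7p1 (R : realType) :
  exists2 CBS : R, 0 < CBS &
  (forall (nu : R) (T : \bar R) (ur uz g : R -> R -> R -> R),
     0 < nu -> (0 < T)%E -> decaying_smooth_solution nu T ur uz g ->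
     [/\ forall p t : R, 1 < p -> lifespan T t ->
           [/\ mu3_integrable (energy_density p (g t)),
               mu3_integrable (dissipation_density p (g t)),
               (@lebesgue_measure R).-integrable setT
                 (EFin \o axis_density p (g t))
             & exists2 dE : R,
                 derivative_on_lifespan T (fun s => energy p (g s)) t dE
               & dE + nu * p * (p - 1) * dissipation p (g t)
                    + 2 * nu * axis_energy p (g t) = 0],
         (norm1 (g 0%R) < +oo)%E /\ (normoo (g 0%R) < +oo)%E,
         forall t : R, lifespan T t ->
           (norm1 (g t) <= norm1 (g 0%R))%E /\ (normoo (g t) <= normoo (g 0%R))%E
       & forall t : R, lifespan T t ->
           (normoo (U_of (g t)) <= B_of CBS (g 0%R))%E])
  /\
  (forall kappa nu B : R, 0 < kappa -> 0 < nu ->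
     exists2 R0 : R, 0 < R0 &
     forall (T : \bar R) (ur uz g : R -> R -> R -> R),
       (0 < T)%E -> decaying_smooth_solution nu T ur uz g ->
       B_of CBS (g 0%R) = B%:E ->
       forall rad t : R, 0 < rad -> rad < R0 -> lifespan T t ->
         (normoo (U_of (g t)) < (kappa * nu / rad ^+ 2)%:E)%E).
Proof.
exists 198; first by [].
split => [nu T ur uz g nu0 T0 sol|kappa nu B k0 nu0].
  have [N1 [Noo [N10 Noo0 n1E nooE H]]] := solution_norms nu0 T0 sol.
  split => [p t p1 tT| |t tT|t tT].
  - exact: (solution_energy nu0 sol p1 tT).
  - by rewrite n1E nooE !ltry.
  - have [it I_le sup_le] := H t tT; rewrite n1E nooE; split.
      rewrite /norm1 /mu3_integral -[leLHS]fineK ?lee_fin //.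
      by apply: integrable_fin_num it; exact: measurable_halfplane.
    by apply: ge_ereal_sup => _ [[r z] r0 <-]; rewrite lee_fin; exact: sup_le.
  - exact: (solution_velocity_bound nu0 T0 sol tT).
(* B is an arbitrary real here, so |B| + 1 replaces it: it is positive and bounds B, and R0^2 =
   kappa nu / (|B| + 1) gives B rad^2 < kappa nu for rad < R0. *)
have B1 : 0 < `|B| + 1 by rewrite ltr_wpDl.
have q0 : 0 < kappa * nu / (`|B| + 1) by rewrite divr_gt0 // mulr_gt0.
exists (Num.sqrt (kappa * nu / (`|B| + 1))); first by rewrite sqrtr_gt0.
move=> T ur uz g T0 sol BE rad t rad0 radR tT.
apply: le_lt_trans (solution_velocity_bound nu0 T0 sol tT) _.
rewrite BE lte_fin ltr_pdivlMr ?exprn_gt0 //.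
apply: le_lt_trans (_ : (`|B| + 1) * rad ^+ 2 < _).
  rewrite ler_wpM2r ?sqr_ge0 //; apply: le_trans (ler_norm B) _; by rewrite lerDl.
rewrite mulrC -ltr_pdivlMr // -(sqr_sqrtr (ltW q0)).
by rewrite ltrXn2r ?nnegrE ?sqrtr_ge0 // ltW.
Qed.
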